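(* Let $E\subset\mathcal{X}$ be a quasi-Banach function space on $(0,\infty)$ (a priori, not necessarily symmetric). Let $p,q\in(0,\infty)$ be such that $p<q$. Then: (a) $E$ is an interpolation space for the couple $(L_p,L_\infty)$ if and only if there exists $c_{p,E}>0$ such that for any $f\in E$ and $g\in L_p+L_\infty$, $$|g|^p\prec\prec_{\rm hd}|f|^p\ \Rightarrow\ g\in E\ \text{ and }\ \|g\|_E\le c_{p,E}\|f\|_E;$$ (b) $E$ is an interpolation space for the couple $(L_0,L_q)$ if and only if there exists $c_{q,E}>0$ such that for any $f\in E$ and $g\in L_0+L_q$, $$|g|^q\prec\prec_{\rm tl}|f|^q\ \Rightarrow\ g\in E\ \text{ and }\ \|g\|_E\le c_{q,E}\|f\|_E;$$ (c) $E$ is an interpolation space for the couples $(L_0,L_q)$ and $(L_p,L_\infty)$ if and only if it is an interpolation space for the couple $(L_p,L_q)$.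
   Context: The underlying measure space is $(0,\infty)$ with Lebesgue measure $m$. $\mathcal{X}$ is the linear space of all measurable functions on it. $L_0\subset\mathcal{X}$ is the set of functions whose supports have finite measure, with $\|f\|_0=m(\mathrm{supp}\,f)$; for a linear operator $T:L_0\to L_0$, $\|T\|_{L_0\to L_0}=\sup_{f\in L_0}m(\mathrm{supp}(Tf))/m(\mathrm{supp}(f))$, and $T$ is bounded on $L_0$ if this is finite. For $0<r\le\infty$, $L_r$ has its usual (quasi-)norm. Rearrangement: for $f\in L_0+L_\infty$, $\mu(f):t\mapsto\mu(t,f)$ is the right-continuous decreasing rearrangement of $|f|$. Head majorization is defined on $L_1+L_\infty$ by: $g\prec\prec_{\rm hd}f$ if and only if $\int_0^t\mu(s,g)\,ds\le\int_0^t\mu(s,f)\,ds$ for all $t>0$. Tail majorization is defined on $L_0+L_1$ by: $g\prec\prec_{\rm tl}f$ if and only if $\int_t^\infty\mu(s,g)\,ds\le\int_t^\infty\mu(s,f)\,ds$ for all $t>0$. A quasi-Banach function space is a linear space $E\subset\mathcal{X}$ with a complete quasi-norm $\|\cdot\|_E$ such that if $f\in E$, $g\in\mathcal{X}$ and $|g|\le|f|$, then $g\in E$ and $\|g\|_E\le\|f\|_E$. It is symmetric if, moreover, $f\in E$, $g\in\mathcal{X}$ and $\mu(f)=\mu(g)$ imply $g\in E$ and $\|g\|_E=\|f\|_E$. Let $X$ be a quasi-Banach function space or $X=L_0$, and let $Y$ be a quasi-Banach function space. A linear operator $T$ is bounded on $(X,Y)$ if $T$ is defined from $X+Y$ to $X+Y$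 and restricts to bounded operators $X\to X$ and $Y\to Y$. A quasi-Banach function space $Z$ is an interpolation space for $(X,Y)$ if $X\cap Y\subset Z\subset X+Y$ and every bounded operator on $(X,Y)$ restricts to a bounded operator on $Z$.
   Formalization: In (a) and (b) the space E is assumed nonzero: for E = {0} the majorization condition holds trivially, while the intersection of the couple is not contained in E, so the stated equivalence fails there. *)

(* Defs.v *)
From HB Require Import structures.
From mathcomp Require Import all_boot all_order all_algebra.
From mathcomp Require Import all_classical all_reals all_analysis.

Set Implicit Arguments.
Unset Strict Implicit.
Unset Printing Implicit Defensive.

Import Order.TTheory GRing.Theory Num.Theory.
Import numFieldNormedType.Exports.

Local Open Scope classical_set_scope.
Local Open Scope ring_scope.

(* Lebesgue measure on (0, +oo), carried by the whole line: the mu-classes of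
   measurable functions R -> R are exactly the classes of measurable functions
   on (0, +oo).  Function spaces below consist of representatives; equalities
   and inequalities between functions are meant mu-almost everywhere. *)
Definition halfline_measure (R : realType) : {measure set (measurableTypeR R) -> \bar R} :=
  mrestr (@lebesgue_measure R) (measurable_itv `]0%R, +oo[).

Section rearrangement.
Variable R : realType.
Let mu := halfline_measure R.

Definition supp_measure (f : R -> R) : \bar R := mu [set x | f x != 0].

Definition rearrangement (f : R -> R) (t : R) : \bar R :=
  ereal_inf [set s%:E | s in
    [set s : R | 0 <= s /\ (mu [set x | (s < `|f x|)%R] <= t%:E)%E]].

End rearrangement.

(* A set of functions together with the functional measuring boundedness
   on it: a quasi-norm, or the measure of the support for L_0.  The values of
   qnorm outside the set are irrelevant. *)
Record fspace (R : realType) := FSpace {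
  carrier :> (R -> R) -> Prop ;
  qnorm : (R -> R) -> R }.

Section spaces.
Variable R : realType.
Let mu := halfline_measure R.

Definition L0 : fspace R :=
  FSpace (fun f => measurable_fun setT f /\ (supp_measure f < +oo)%E)
         (fun f => fine (supp_measure f)).

Definition L (r : \bar R) : fspace R :=
  FSpace (fun f => f \in Lfun mu r)
         (fun f => fine ('N[mu]_r[EFin \o f])%E).

Definition sum_space (X Y : (R -> R) -> Prop) (h : R -> R) : Prop :=
  exists f g, [/\ X f, Y g & h = f \+ g].

Definition head_majorized (g f : R -> R) : Prop :=
  [/\ sum_space (L 1%:E) (L +oo%E) g,
      sum_space (L 1%:E) (L +oo%E) f &
      forall t : R, 0 < t ->
        (\int[lebesgue_measure]_(s in `]0%R, t[) rearrangement g s <=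
         \int[lebesgue_measure]_(s in `]0%R, t[) rearrangement f s)%E].

Definition tail_majorized (g f : R -> R) : Prop :=
  [/\ sum_space L0 (L 1%:E) g,
      sum_space L0 (L 1%:E) f &
      forall t : R, 0 < t ->
        (\int[lebesgue_measure]_(s in `]t, +oo[) rearrangement g s <=
         \int[lebesgue_measure]_(s in `]t, +oo[) rearrangement f s)%E].

Definition abs_pow (p : R) (f : R -> R) : R -> R := fun x => `|f x| `^ p.

(* The ideal property makes E and its quasi-norm invariant under mu-a.e. equality. *)
Record quasi_Banach_function_space (E : fspace R) : Prop := {
  qB_measurable : forall f : R -> R, E f -> measurable_fun setT f ;
  qB_zero : E (cst 0) ;
  qB_linear : forall (a : R) f g, E f -> E g -> E (fun x => a * f x + g x) ;
  qB_ge0 : forall f, E f -> 0 <= qnorm E f ;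
  qB_definite : forall f, E f -> qnorm E f = 0 -> f = cst 0 %[ae mu] ;
  qB_homogeneous : forall (a : R) f, E f ->
    qnorm E (fun x => a * f x) = `|a| * qnorm E f ;
  qB_quasi_triangle : exists K : R, forall f g, E f -> E g ->
    qnorm E (f \+ g) <= K * (qnorm E f + qnorm E g) ;
  qB_complete : forall u : nat -> R -> R, (forall n, E (u n)) ->
    (forall e : R, 0 < e -> exists N : nat, forall m n : nat,
       (N <= m)%N -> (N <= n)%N -> qnorm E (u m \- u n) < e) ->
    exists2 f, E f & (fun n => qnorm E (u n \- f)) @ \oo --> (0 : R) ;
  qB_ideal : forall f g : R -> R, E f -> measurable_fun setT g ->
    (\forall x \ae mu, `|g x| <= `|f x|) -> E g /\ qnorm E g <= qnorm E f }.

(* Needed because E = {0} satisfies the majorization criteria trivially, although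
   X `&` Y is not included in it for the couples (X, Y) considered. *)
Definition nontrivial (E : fspace R) : Prop :=
  exists2 f, E f & ~ (f = cst 0 %[ae mu]).

(* T is a total function on representatives, of which only the values on V
   matter; the second clause makes it descend to mu-classes. *)
Definition linear_operator (V : (R -> R) -> Prop) (T : (R -> R) -> R -> R) :
    Prop :=
  [/\ forall f, V f -> V (T f),
      forall f g, V f -> V g -> f = g %[ae mu] -> T f = T g %[ae mu] &
      forall (a : R) f g, V f -> V g ->
        T (fun x => a * f x + g x) = (fun x => a * T f x + T g x) %[ae mu]].

Definition bounded_on (X : fspace R) (T : (R -> R) -> R -> R) : Prop :=
  exists C : R, forall f, X f -> X (T f) /\ qnorm X (T f) <= C * qnorm X f.

Definition bounded_on_couple (X Y : fspace R) (T : (R -> R) -> R -> R) : Prop :=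
  [/\ linear_operator (sum_space X Y) T, bounded_on X T & bounded_on Y T].

Definition interpolation_space (X Y Z : fspace R) : Prop :=
  [/\ forall f, X f -> Y f -> Z f,
      forall f, Z f -> sum_space X Y f &
      forall T, bounded_on_couple X Y T -> bounded_on Z T].

End spaces.

Arguments L0 {R}.
Arguments L {R} r.

(* Main.v *)
(* Write f* for the decreasing rearrangement of f.

   Necessity in (a) and (b): |f| is bounded by C f* o sigma and f* by
   C |f o psi|, where sigma and psi push Lebesgue measure to at most 3 times
   itself. On the half-line, a head (tail) majorization allows one to transport
   the excess of g* over f* to the left (right) into the excess of f* over g*.
   Together these give |g|^p <= C A |f|^p o Phi, where h |-> A^(1/p) (h o Phi) is
   bounded on the couple; the constant on E is uniform because operators with bad
   constants could be glued on disjoint copies of the half-line.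

   Sufficiency: splitting f at the level f*(t) shows that an operator T bounded
   on the couple satisfies the criterion for (T f, C f), in the tail case up to a
   dilation, which is absorbed by replacing f with finitely many disjoint copies.

   In (c), if T is bounded on (L_p, L_q) and g = T f, then for every t either the
   integral of g*^p over (0, t) or that of g*^q over (t, oo) is controlled by the
   corresponding integral of f*; cutting g according to these two cases writes it
   as a sum of two functions to which (a) and (b) apply. The converse holds since
   A^(q/p) <= C A in the head case and A^(p/q) <= 1_{A <> 0} + A in the tail
   case. *)
Require Import Defs.
From HB Require Import structures.
From mathcomp Require Import all_boot all_order all_algebra.
From mathcomp Require Import all_classical all_reals all_analysis.
From mathcomp Require Import measurable_realfun ess_sup_inf ring lra.
Import Order.TTheory GRing.Theory Num.Theory.
Import numFieldNormedType.Exports.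
Local Open Scope classical_set_scope.
Local Open Scope ring_scope.

Set Implicit Arguments.
Unset Strict Implicit.
Unset Printing Implicit Defensive.

(** * Densities, push-forwards and quantiles *)

(** Every criterion carries a constant, so functions need only be compared with their rearrangements
    up to [rank_cst], by maps that push the measure to a bounded multiple of itself. This tolerance
    accommodates functions that do not vanish at infinity, whose low superlevel sets have infinite
    measure, and replaces measure-preserving rearrangements by one-dimensional quantile couplings:
    an atomless measure is pushed by its distribution function to at most Lebesgue measure, which a
    quantile function pushes to any prescribed target. All operators built are weighted
    compositions. A single inequality on nonnegative integrands ([dom]) yields their bound on L_p,
    their passage to classes and their stability under gluing. The obstacle in the tail case is that
    an exceptional set of measure t costs a dilation of the variable, which no multiplicative
    constant repairs. In (c), the estimates for T f are obtained at a common level k for both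
    exponents; taking k as the larger of the two natural scales makes one of them sharp. That E lies
    in the sum space is not known beforehand: it is read off from truncations tested against the
    indicator of (0, 1). *)

Section density_measure.
Local Open Scope ereal_scope.
Context d (T : measurableType d) (R : realType).
Variables (m : {measure set T -> \bar R}) (w : T -> R).
Hypotheses (w0 : forall x, (0 <= w x)%R) (mw : measurable_fun setT w).

(** The proofs of nonnegativity and measurability are arguments so that the measure structure
    declared below attaches to the term [mdensity w0 mw]. *)
Definition mdensity of (forall x, (0 <= w x)%R) & measurable_fun setT w :=
  fun A : set T => \int[m]_(x in A) (w x)%:E.

Local Notation nu := (mdensity w0 mw).

Let nu0 : nu set0 = 0. Proof. exact: integral_set0. Qed.

Let nu_ge0 A : 0 <= nu A.
Proof. by apply: integral_ge0 => x _; rewrite lee_fin. Qed.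

Let nu_sigma : semi_sigma_additive nu.
Proof.
move=> F mF tF mUF; rewrite /mdensity ge0_integral_bigcup//.
- apply: is_cvg_ereal_nneg_natsum_cond => n _ _.
  by apply: integral_ge0 => x _; rewrite lee_fin.
- by apply/measurable_EFinP; exact: measurable_funTS.
- by move=> x _; rewrite lee_fin.
Qed.

HB.instance Definition _ := isMeasure.Build _ _ _ nu nu0 nu_ge0 nu_sigma.

End density_measure.

Section integral_density.
Local Open Scope ereal_scope.
Context d (T : measurableType d) (R : realType).
Variables (m : {measure set T -> \bar R}) (w : T -> R).
Hypotheses (w0 : forall x, (0 <= w x)%R) (mw : measurable_fun setT w).

Import HBNNSimple.

(** True for indicators by definition; simple functions increasing to [h] carry it over by monotone
    convergence. *)
Lemma integral_mdensity (h : T -> \bar R) : (forall x, 0 <= h x) ->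
  measurable_fun setT h ->
  \int[mdensity m w0 mw]_x h x = \int[m]_x ((w x)%:E * h x).
Proof.
move=> h0 mh.
have ew0 x : 0 <= (w x)%:E by rewrite lee_fin.
have mew : measurable_fun setT (EFin \o w) by exact/measurable_EFinP.
pose f_ := nnsfun_approx measurableT mh.
have f_nd x : nondecreasing_seq (fun n => (f_ n x)%:E).
  by move=> a b ab; rewrite lee_fin; exact/lefP/nd_nnsfun_approx.
have f_cvg x : (f_ n x)%:E @[n --> \oo] --> h x.
  exact: cvg_nnsfun_approx.
transitivity (limn (fun n => \int[mdensity m w0 mw]_x (f_ n x)%:E)).
  rewrite -monotone_convergence//.
  - by apply: eq_integral => x _; apply/esym/cvg_lim.
  - by move=> n; exact/measurable_EFinP.
  - by move=> n x _; rewrite lee_fin.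
transitivity (limn (fun n => \int[m]_x ((w x)%:E * (f_ n x)%:E))); last first.
  rewrite -monotone_convergence//.
  - apply: eq_integral => x _; apply/cvg_lim => //.
    exact: cvgeZl.
  - by move=> n; apply: emeasurable_funM => //; exact/measurable_EFinP.
  - by move=> n x _; rewrite mule_ge0// lee_fin.
  - by move=> x _ a b ab; rewrite lee_wpmul2l// f_nd.
congr (limn _); apply/funext => n.
under [LHS]eq_integral do rewrite fimfunE -fsumEFin//.
rewrite ge0_integral_fsum//; last 2 first.
  - by move=> r; exact/measurable_EFinP/measurableT_comp.
  - by move=> r x _; rewrite nnfun_muleindic_ge0.
under [RHS]eq_integral.
  move=> x _; rewrite fimfunE -fsumEFin// ge0_mule_fsumr; last first.
    by move=> r; rewrite nnfun_muleindic_ge0.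
  over.
rewrite ge0_integral_fsum//; last 2 first.
  - move=> r; apply: emeasurable_funM => //.
    exact/measurable_EFinP/measurableT_comp.
  - by move=> r x _; rewrite mule_ge0// nnfun_muleindic_ge0.
apply: eq_fsbigr => r _.
under [RHS]eq_integral.
  move=> x _; rewrite EFinM muleCA; over.
have mA : measurable (f_ n @^-1` [set r]) by exact: measurable_funPTI.
have [r0|r0] := ltP r 0%R.
  have -> : f_ n @^-1` [set r] = set0 by exact: preimage_nnfun0.
  rewrite !integral0_eq// => x _; rewrite indic0 ?mulr0 ?mule0//.
have mi : measurable_fun setT (fun x => (\1_(f_ n @^-1` [set r]) x)%:E : \bar R).
  by apply/measurable_EFinP; exact: measurable_indic.
under eq_integral do rewrite EFinM.
rewrite ge0_integralZl// ?lee_fin//.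
rewrite ge0_integralZl// ?lee_fin//; last 2 first.
- exact: emeasurable_funM.
- by move=> x _; rewrite mule_ge0// lee_fin.
congr (_ * _); rewrite integral_indic// setIT.
change (\int[m]_(x in f_ n @^-1` [set r]) (w x)%:E =
  \int[m]_x ((w x)%:E * (\1_(f_ n @^-1` [set r]) x)%:E)).
rewrite integral_mkcond; apply: eq_integral => x _.
by rewrite /patch indicE; case: ifPn => _; rewrite ?mule1 ?mule0.
Qed.

End integral_density.

Section pushforward_lebesgue.
Local Open Scope ereal_scope.
Context (R : realType).
Notation leb := (@lebesgue_measure R).

(** Lebesgue measure is an infimum over covers by half-open intervals, so countable subadditivity of
    [nu] transfers the bound from intervals to all measurable sets. Every change of variables below
    is an inequality obtained in this way. *)
Lemma le_lebesgue (nu : {measure set (measurableTypeR R) -> \bar R}) (C : R) :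
  (0 < C)%R ->
  (forall a b : R, (a < b)%R -> nu `]a, b]%classic <= (C * (b - a))%:E) ->
  forall S, measurable S -> nu S <= C%:E * leb S.
Proof.
move=> C0 nuC S mS.
have : C^-1%:E * nu S <= leb S.
  rewrite /lebesgue_measure /= /lebesgue_stieltjes_measure /= /measure_extension /=.
  apply: le_ereal_inf_tmp => _ [A [mA SA] <-].
  have mA' k : measurable (A k : set (measurableTypeR R)).
    by apply: sub_sigma_algebra; exact: mA.
  have : nu S <= \sum_(k <oo) nu (A k).
    by apply: measure_sigma_subadditive.
  move=> /(lee_wpmul2l _) => /(_ C^-1%:E); rewrite lee_fin invr_ge0 => /(_ (ltW C0)).
  move=> /le_trans; apply.
  rewrite -nneseriesZl; last by move=> *; exact: measure_ge0.
  apply: lee_nneseries => [k _ _|k _].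
    by rewrite mule_ge0// lee_fin invr_ge0 ltW.
  have /ocitvP[->|[[a b] /= ab ->]] := mA k.
    by rewrite measure0 mule0 wlength0.
  rewrite wlength_itv_bnd ?(ltW ab)//= /idfun.
  have Ci : (0 <= C^-1%:E :> \bar R) by rewrite lee_fin invr_ge0 ltW.
  apply: (le_trans (lee_wpmul2l Ci (nuC a b ab))).
  by rewrite -EFinM lee_fin mulrA mulVf ?gt_eqF// mul1r.
move=> /(lee_wpmul2l _) => /(_ C%:E); rewrite lee_fin => /(_ (ltW C0)).
by rewrite muleA -EFinM mulfV ?gt_eqF// mul1e.
Qed.

End pushforward_lebesgue.

Section integral_mrestr.
Local Open Scope ereal_scope.
Context d (T : measurableType d) (R : realType).
Variables (m : {measure set T -> \bar R}) (D : set T) (mD : measurable D).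

Lemma integral_mrestr (h : T -> \bar R) : (forall x, 0 <= h x) ->
  measurable_fun setT h -> \int[mrestr m mD]_x h x = \int[m]_(x in D) h x.
Proof.
move=> h0 mh.
have w0 x : (0 <= \1_D x :> R)%R by [].
have mw : measurable_fun setT (\1_D : T -> R) by exact: measurable_indic.
transitivity (\int[mdensity m w0 mw]_x h x); last first.
  rewrite integral_mdensity// [RHS]integral_mkcond; apply: eq_integral => x _.
  by rewrite /patch indicE; case: ifPn; rewrite ?mul1e ?mul0e.
apply: eq_measure_integral => A mA _; rewrite -[RHS]/(\int[m]_(x in A) (\1_D x)%:E).
by rewrite integral_indic// setIC.
Qed.

End integral_mrestr.

Section pushforward_measure.
Local Open Scope ereal_scope.
Context d d' (T : measurableType d) (T' : measurableType d') (R : realType).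
Variables (m : {measure set T -> \bar R}) (f : T -> T').
Hypothesis mf : measurable_fun setT f.

Definition mpush : {measure set T' -> \bar R} :=
  measure_function_pushforward__canonical__measure_function_Measure m mf.

Lemma mpushE A : mpush A = m (f @^-1` A). Proof. by []. Qed.

Lemma integral_mpush (H : T' -> \bar R) : (forall x, 0 <= H x) ->
  measurable_fun setT H -> \int[mpush]_y H y = \int[m]_x H (f x).
Proof. by move=> H0 mH; rewrite ge0_integral_pushforward. Qed.

End pushforward_measure.

Section measure_continuity.
Local Open Scope ereal_scope.
Context d (T : measurableType d) (R : realType).
Variable nu : {measure set T -> \bar R}.

Lemma measure_sub_bigcup_le (F : (set T)^nat) A c : (forall n, measurable (F n)) ->
  measurable A -> nondecreasing_seq F -> A `<=` \bigcup_n F n ->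
  (forall n, nu (F n) <= c) -> nu A <= c.
Proof.
move=> mF mA ndF AF Fc.
have mU : measurable (\bigcup_n F n) by exact: bigcupT_measurable.
apply: (@le_trans _ _ (nu (\bigcup_n F n))); first by apply: le_measure; rewrite ?inE.
have cv := nondecreasing_cvg_mu (mu := nu) mF mU ndF.
rewrite -(cvg_lim _ cv)//; apply: lime_le; first by apply/cvg_ex; exists (nu (\bigcup_n F n)).
exact: nearW.
Qed.

Lemma measure_bigcap_sub_ge (F : (set T)^nat) A c : (forall n, measurable (F n)) ->
  measurable A -> nonincreasing_seq F -> \bigcap_n F n `<=` A ->
  nu (F 0%N) < +oo -> (forall n, c <= nu (F n)) -> c <= nu A.
Proof.
move=> mF mA niF AF Foo Fc.
have mI : measurable (\bigcap_n F n) by exact: bigcapT_measurable.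
apply: (@le_trans _ _ (nu (\bigcap_n F n))); last by apply: le_measure; rewrite ?inE.
have cv := nonincreasing_cvg_mu Foo mF mI niF.
rewrite -(cvg_lim _ cv)//; apply: lime_ge; first by apply/cvg_ex; exists (nu (\bigcap_n F n)).
exact: nearW.
Qed.

End measure_continuity.

Section cdf_quantile.
Local Open Scope ereal_scope.
Context (R : realType).
Notation leb := (@lebesgue_measure R).
Variable nu : {measure set (measurableTypeR R) -> \bar R}.

Definition mcdf (x : R) : R := fine (nu `]-oo, x]%classic).

(** Generalised inverse of the distribution function. On [quantile_dom] the infimum is taken over a
    nonempty set that is bounded below. *)
Definition mquantile (s : R) : R := inf [set y | (s <= mcdf y)%R].

Definition quantile_dom : set R := [set s | (0 < s)%R /\ s%:E < nu setT].

Hypothesis nu_fin : forall x, nu `]-oo, x]%classic < +oo.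

Lemma mcdfE x : nu `]-oo, x]%classic = (mcdf x)%:E.
Proof. by rewrite /mcdf fineK// ge0_fin_numE. Qed.

Lemma mcdf_ge0 x : (0 <= mcdf x)%R.
Proof. by rewrite -lee_fin -mcdfE. Qed.

Lemma mcdf_nd : {homo mcdf : x y / (x <= y)%R}.
Proof.
move=> x y xy; rewrite -lee_fin -!mcdfE; apply: le_measure; rewrite ?inE//.
by move=> z /=; rewrite !in_itv/= => /le_trans; apply.
Qed.

Lemma measurable_mcdf : measurable_fun setT mcdf.
Proof. by apply: nondecreasing_measurable => //; exact: mcdf_nd. Qed.

Lemma mcdf_left (z c : R) : (forall x, (x < z)%R -> (mcdf x <= c)%R) ->
  nu `]-oo, z[%classic <= c%:E.
Proof.
move=> zc.
apply: (@measure_sub_bigcup_le _ _ _ nu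
  (fun n => `]-oo, (z - n.+1%:R^-1)%R]%classic)) => //.
- move=> m n mn; apply/subsetPset => x /=; rewrite !in_itv/= => /le_trans; apply.
  by rewrite lerD2l lerN2 lef_pV2 ?posrE// ler_nat.
- move=> x /=; rewrite in_itv/= => /ltr_add_invr[n xn]; exists n => //=.
  by rewrite in_itv/= lerBrDr ltW.
- by move=> n; rewrite mcdfE lee_fin zc// ltrBlDr ltrDl.
Qed.

Lemma mcdf_right (z c : R) : (forall x, (z < x)%R -> (c <= mcdf x)%R) ->
  (c <= mcdf z)%R.
Proof.
move=> zc; rewrite -lee_fin -mcdfE.
apply: (@measure_bigcap_sub_ge _ _ _ nu
  (fun n => `]-oo, (z + n.+1%:R^-1)%R]%classic)) => //.
- move=> m n mn; apply/subsetPset => x /=; rewrite !in_itv/= => /le_trans; apply.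
  by rewrite lerD2l lef_pV2 ?posrE// ler_nat.
- move=> x xF; rewrite /= in_itv/= leNgt; apply/negP => /ltr_add_invr[n xn].
  by have := xF n I; rewrite /= in_itv/= leNgt xn.
- by move=> n; rewrite mcdfE lee_fin zc// ltrDl.
Qed.

Lemma mcdf_pinfty (c : \bar R) : (forall x, (mcdf x)%:E <= c) -> nu setT <= c.
Proof.
move=> zc.
apply: (@measure_sub_bigcup_le _ _ _ nu
  (fun n => `]-oo, n%:R]%classic)) => //.
- move=> m n mn; apply/subsetPset => x /=; rewrite !in_itv/= => /le_trans; apply.
  by rewrite ler_nat.
- move=> x _; exists (Num.truncn `|x|).+1 => //=; rewrite in_itv/=.
  by rewrite (le_trans (ler_norm x))// ltW// truncnS_gt.
- by move=> n; rewrite mcdfE zc.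
Qed.

Lemma mcdf_ninfty (c : R) : (forall x, (c <= mcdf x)%R) -> (c <= 0)%R.
Proof.
move=> zc; rewrite -lee_fin -[leRHS](measure0 nu).
apply: (@measure_bigcap_sub_ge _ _ _ nu
  (fun n => `]-oo, (- n%:R)%R]%classic)) => //.
- move=> m n mn; apply/subsetPset => x /=; rewrite !in_itv/= => /le_trans; apply.
  by rewrite lerN2 ler_nat.
- move=> x /(_ (Num.truncn `|x|).+1 I) /=; rewrite in_itv/= lerNr.
  rewrite leNgt => /negP; apply.
  by rewrite (le_lt_trans (ler_norm (- x)%R))// normrN truncnS_gt.
- by move=> n; rewrite mcdfE lee_fin.
Qed.

(** The Galois connection between quantile and distribution function, on which all later uses rest.
    Positivity of [s] gives the lower bound, since [mcdf] tends to 0 at minus infinity;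
    [s < nu setT] gives nonemptiness; right continuity of [mcdf] makes the infimum attained. *)
Lemma mquantile_le (s y : R) : quantile_dom s ->
  (mquantile s <= y)%R = (s <= mcdf y)%R.
Proof.
move=> [s0 snu].
have lb : has_lbound [set y | (s <= mcdf y)%R].
  have [x xs] : exists x, (mcdf x < s)%R.
    apply: contrapT => /forallNP H; suff: (s <= 0)%R by rewrite leNgt s0.
    by apply: mcdf_ninfty => x; rewrite leNgt; apply/negP/H.
  exists x => z /= sz; rewrite leNgt; apply/negP => zx.
  by have := le_lt_trans (le_trans sz (mcdf_nd (ltW zx))) xs; rewrite ltxx.
have ne : [set y | (s <= mcdf y)%R] !=set0.
  apply: contrapT => /forallNP H; move: snu; apply/negP; rewrite -leNgt.
  by apply: mcdf_pinfty => x; rewrite lee_fin leNgt; apply/negP => /ltW /H.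
apply/idP/idP => [qy|sy]; last exact: ge_inf.
apply: le_trans (mcdf_nd qy); apply: mcdf_right => x qx.
have e0 : (0 < x - mquantile s)%R by rewrite subr_gt0.
have [z /= sz zx] := inf_adherent e0 (conj ne lb).
rewrite -/(mquantile s) subrKC in zx.
by rewrite (le_trans sz)// mcdf_nd// ltW.
Qed.

Lemma measurable_quantile_dom : measurable quantile_dom.
Proof.
have -> : quantile_dom = `]0%R, +oo[%classic `&` EFin @^-1` [set x | x < nu setT].
  by apply/seteqP; split=> x /=; rewrite in_itv/= andbT.
apply: measurableI => //; rewrite -[X in measurable X]setTI.
apply: EFin_measurable => //.
rewrite (_ : [set x | _] = `]-oo, nu setT[%classic); first exact: emeasurable_itv.
by apply/seteqP; split => x /=; rewrite in_itv.
Qed.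


Lemma measurable_mquantile : measurable_fun quantile_dom mquantile.
Proof.
apply: (measurability (@RGenOInfty.G R)); first exact: RGenOInfty.measurableE.
move=> /= _ [_] [r] -> <-.
have -> : quantile_dom `&` mquantile @^-1` `]r, +oo[ =
    quantile_dom `&` `]mcdf r, +oo[.
  apply/seteqP; split=> x /= [xd]; rewrite !in_itv/= !andbT ltNge.
    by rewrite mquantile_le// -ltNge.
  by move=> rx; rewrite ltNge mquantile_le// -ltNge.
by apply: measurableI => //; exact: measurable_quantile_dom.
Qed.

(** Inverse transform sampling: on rays the claim is [mquantile_le], up to an endpoint of an
    interval, and rays generate the Borel sets. *)
Lemma lebesgue_mquantile A : measurable A ->
  leb (quantile_dom `&` mquantile @^-1` A) = nu A.
Proof.
have mD := measurable_quantile_dom.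
pose Q := mquantile \_ quantile_dom.
have mQ : measurable_fun setT Q.
  by apply/(measurable_restrictT _ mD); exact: measurable_mquantile.
pose m1 := mpush (mrestr leb mD) (mQ : @measurable_fun _ _ (measurableTypeR R) (measurableTypeR R) setT Q).
have m1E B : m1 B = leb (quantile_dom `&` mquantile @^-1` B).
  rewrite mpushE /= /mrestr; congr leb; apply/seteqP; split=> s /=.
    by rewrite /Q /patch => -[+ sd]; rewrite mem_set.
  by move=> [sd Bs]; split => //; rewrite /Q /patch mem_set.
have key x : leb (quantile_dom `&` mquantile @^-1` `]-oo, x]) = (mcdf x)%:E.
  have mS : measurable (quantile_dom `&` mquantile @^-1` `]-oo, x]).
    by apply: measurable_mquantile => //; exact: measurable_quantile_dom.
  have lebN b : leb [set` Interval (BRight 0%R) (BSide b (mcdf x))] = (mcdf x)%:E.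
    rewrite lebesgue_measure_itv/= lte_fin.
    by have := mcdf_ge0 x; rewrite le_eqVlt => /predU1P[<-|->]; rewrite ?ltxx// sube0.
  apply/eqP; rewrite eq_le; apply/andP; split.
    rewrite -(lebN false); apply: le_measure; rewrite ?inE//.
    move=> s /= [sd]; rewrite !in_itv/= mquantile_le// => ->.
    by rewrite sd.1.
  rewrite -(lebN true); apply: le_measure; rewrite ?inE//.
  move=> s /=; rewrite !in_itv/= => /andP[s0 sx].
  have sd : quantile_dom s.
    split => //; apply: (@lt_le_trans _ _ (mcdf x)%:E); first by rewrite lte_fin.
    by rewrite -mcdfE; apply: le_measure; rewrite ?inE.
  by split => //; rewrite mquantile_le// ltW.
move=> mA; rewrite -m1E.
(* The closed left rays are stable under intersection, and those ending at the naturals exhaust the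
   line with finite mass. *)
apply: (@measure_unique _ R (measurableTypeR R) [set A | exists x : R, A = `]-oo, x]%classic]
  (fun n => `]-oo, n%:R]%classic) _ _ _ _ m1 nu _ _ A mA).
- rewrite (RGenOInfty.measurableE R); apply/seteqP; split => B.
    apply: smallest_sub; first exact: smallest_sigma_algebra.
    move=> _ [x ->]; rewrite -setCitvl; apply: sigma_algebraC.
    by apply: sub_sigma_algebra; exists x.
  apply: smallest_sub; first exact: smallest_sigma_algebra.
  move=> _ [x ->]; rewrite -setCitvr; apply: sigma_algebraC.
  by apply: sub_sigma_algebra; exists x.
- move=> _ _ [x ->] [y ->]; exists (Num.min x y).
  by apply/seteqP; split => z /=; rewrite !in_itv/= le_min => /andP.
- by move=> i; exists i%:R.
- apply/seteqP; split => // x _; exists (Num.truncn `|x|).+1 => //=; rewrite in_itv/=.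
  by rewrite (le_trans (ler_norm x))// ltW// truncnS_gt.
- by move=> _ [x ->]; rewrite [LHS]m1E mcdfE key.
- by move=> k; rewrite [ltLHS]m1E key ltry.
Qed.

Lemma integral_mquantile (H : R -> \bar R) : (forall x, 0 <= H x) ->
  measurable_fun setT H ->
  \int[leb]_(s in quantile_dom) H (mquantile s) = \int[nu]_x H x.
Proof.
move=> H0 mH.
have mD := measurable_quantile_dom.
have mQ : measurable_fun setT (mquantile \_ quantile_dom).
  by apply/(measurable_restrictT _ mD); exact: measurable_mquantile.
transitivity (\int[mpush (mrestr leb mD)
    (mQ : @measurable_fun _ _ (measurableTypeR R) (measurableTypeR R) setT _)]_x H x).
  rewrite integral_mpush// integral_mrestr//.
    by apply: eq_integral => x xD; rewrite /patch xD.
  exact: (measurableT_comp mH mQ).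
apply: eq_measure_integral => A mA _; rewrite -lebesgue_mquantile// mpushE /= /mrestr.
congr leb; apply/seteqP; split=> s /=.
  by rewrite /patch => -[+ sd]; rewrite mem_set.
by move=> [sd As]; split => //; rewrite /patch mem_set.
Qed.

Hypothesis nu_atomless : forall x, nu [set x] = 0.

(** Writing F for [mcdf nu], the set {F <= b} has mass at most b and {F <= a} has mass at least a,
    and the two are subtracted. Both bounds use that a ray weighs the same with or without its
    endpoint. *)
Lemma mcdf_level_le (a b : R) : (a < b)%R ->
  nu (mcdf @^-1` `]a, b]) <= (b - a)%:E.
Proof.
move=> ab.
have mN A : measurable A -> measurable (mcdf @^-1` A).
  by move=> mA; rewrite -[X in measurable X]setTI; exact: measurable_mcdf.
have [->|/set0P[x0 /=]] := eqVneq (mcdf @^-1` `]a, b]%classic) set0.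
  by rewrite measure0 lee_fin subr_ge0 ltW.
rewrite in_itv/= => /andP[ax0 x0b].
have b0 : (0 <= b)%R by exact: le_trans (mcdf_ge0 _) x0b.
(* If F never exceeds b, the total mass is at most b. Otherwise {F <= b} lies in the closed ray
   ending at its supremum z, and F <= b strictly to the left of z. *)
have Tb : nu (mcdf @^-1` `]-oo, b]) <= b%:E.
  have [[z1 bz1]|] := pselect (exists z, (b < mcdf z)%R); last first.
    move=> /forallNP H; apply: (@le_trans _ _ (nu setT)).
      by apply: le_measure; rewrite ?inE//; exact: mN.
    by apply: mcdf_pinfty => x; rewrite lee_fin leNgt; apply/negP/H.
  pose T := mcdf @^-1` `]-oo, b]%classic; pose z := sup T.
  have hs : has_sup T.
    split; first by exists x0; rewrite /T/= in_itv.
    exists z1 => y; rewrite /T/= in_itv/= => yb; rewrite leNgt; apply/negP => zy.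
    by have := lt_le_trans bz1 (le_trans (mcdf_nd (ltW zy)) yb); rewrite ltxx.
  apply: (@le_trans _ _ (nu (`]-oo, z[%classic `|` [set z]))).
    apply: le_measure; rewrite ?inE; [exact: mN|exact: measurableU|].
    move=> y Ty; have : (y <= z)%R by exact: sup_ubound hs.2 _ Ty.
    by rewrite le_eqVlt => /predU1P[->|yz]; [right|left; rewrite /= in_itv].
  rewrite measureU//; last first.
    by apply/seteqP; split => y //= [] /[swap] ->; rewrite in_itv/= ltxx.
  rewrite [X in _ + X]nu_atomless adde0; apply: mcdf_left => x xz.
  have e0 : (0 < z - x)%R by rewrite subr_gt0.
  have [y Ty] := sup_adherent e0 hs.
  rewrite -/z subKr => xy; move: Ty; rewrite /T/= in_itv/=.
  by apply: le_trans; apply: mcdf_nd; exact: ltW.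
have [a0|a0] := leP a 0%R.
  apply: (@le_trans _ _ (nu (mcdf @^-1` `]-oo, b]))).
    apply: le_measure; rewrite ?inE; [exact: mN|exact: mN|].
    by move=> y /=; rewrite !in_itv/= => /andP[].
  by rewrite (le_trans Tb)// lee_fin lerDl oppr_ge0.
have [y1 y1a] : exists y, (mcdf y <= a)%R.
  apply: contrapT => /forallNP H; suff: (a <= 0)%R by rewrite leNgt a0.
  by apply: mcdf_ninfty => x; rewrite leNgt; apply/negP => /ltW/H.
(* {F <= a} contains the open ray ending at its supremum w, which weighs F(w); and F(w) >= a by
   right continuity, as F > a beyond w. *)
have Ua : a%:E <= nu (mcdf @^-1` `]-oo, a]).
  pose T := mcdf @^-1` `]-oo, a]%classic; pose w := sup T.
  have hs : has_sup T.
    split; first by exists y1; rewrite /T/= in_itv.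
    exists x0 => y; rewrite /T/= in_itv/= => ya; rewrite leNgt; apply/negP => zy.
    by have := lt_le_trans ax0 (le_trans (mcdf_nd (ltW zy)) ya); rewrite ltxx.
  apply: (@le_trans _ _ (nu `]-oo, w[%classic)); last first.
    apply: le_measure; rewrite ?inE//; first exact: mN.
    move=> y /=; rewrite !in_itv/= => yw.
    have e0 : (0 < w - y)%R by rewrite subr_gt0.
    have [t Tt] := sup_adherent e0 hs.
    rewrite -/w subKr => xy; move: Tt; rewrite /T/= in_itv/=.
    by apply: le_trans; apply: mcdf_nd; exact: ltW.
  rewrite -[leRHS]adde0 -[X in _ + X](nu_atomless w) -measureU//; last first.
    by apply/seteqP; split => y //= [] /[swap] ->; rewrite in_itv/= ltxx.
  have -> : `]-oo, w[%classic `|` [set w] = `]-oo, w]%classic.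
    apply/seteqP; split => y /=; rewrite !in_itv/= le_eqVlt.
      by move=> [->|->]; rewrite ?eqxx ?orbT.
    by move=> /predU1P[->|->]; [right|left].
  rewrite [leRHS]mcdfE lee_fin; apply: mcdf_right => x wx; rewrite leNgt; apply/negP => xa.
  have : (x <= w)%R by apply: (sup_ubound hs.2); rewrite /T/= in_itv/= ltW.
  by rewrite leNgt wx.
have TE : mcdf @^-1` `]-oo, b]%classic =
    mcdf @^-1` `]-oo, a]%classic `|` mcdf @^-1` `]a, b]%classic.
  apply/seteqP; split => y /=; rewrite !in_itv/=.
    by move=> yb; have [ya|ya] := leP (mcdf y) a; [left|right].
  by move=> [/le_trans|/andP[]//]; apply; exact: ltW.
move: Tb; rewrite TE measureU; last 3 first.
- exact: mN.
- exact: mN.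
- by apply/seteqP; split => y //= []; rewrite !in_itv/= leNgt => /negbTE ->.
move=> Tb; rewrite EFinB leeBrDl//.
by apply: le_trans Tb; exact: leeD2r.
Qed.

Lemma le_integral_mcdf (H : R -> \bar R) : (forall x, 0 <= H x) ->
  measurable_fun setT H ->
  \int[nu]_x H (mcdf x) <= \int[leb]_s H s.
Proof.
move=> H0 mH.
rewrite -(integral_mpush _ (measurable_mcdf : @measurable_fun _ _ (measurableTypeR R)
  (measurableTypeR R) setT mcdf))//.
apply: ge0_le_measure_integral => // S mS.
rewrite -[leRHS]mul1e; apply: le_lebesgue => // a b ab.
by rewrite mul1r; exact: mcdf_level_le.
Qed.

End cdf_quantile.

(** * The half-line and rearrangements *)

Section halfline.
Local Open Scope ereal_scope.
Context (R : realType).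
Notation leb := (@lebesgue_measure R).
Notation mu := (halfline_measure R).
Implicit Types (h : R -> \bar R) (f g : R -> R).

Lemma integral_halfline h : (forall x, 0 <= h x) -> measurable_fun setT h ->
  \int[mu]_x h x = \int[leb]_(x in `]0%R, +oo[) h x.
Proof.
move=> h0 mh; exact: (@integral_mrestr _ (measurableTypeR R) R leb _ (measurable_itv `]0%R, +oo[) h h0 mh).
Qed.

Lemma measurable_restrict_itv (i : interval R) h : measurable_fun setT h ->
  measurable_fun setT (h \_ [set` i]).
Proof.
move=> mh; have mi : measurable ([set` i] : set R) by exact: measurable_itv.
by apply/(measurable_restrictT h mi); exact: measurable_funTS.
Qed.

Lemma halfline_head h t : (forall x, 0 <= h x) -> measurable_fun setT h ->
  \int[leb]_(s in `]0%R, t[) h s = \int[mu]_(s in `]-oo, t[) h s.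
Proof.
move=> h0 mh; rewrite [RHS]integral_mkcond integral_halfline.
- rewrite -integral_mkcondr; congr integral.
  by apply/seteqP; split => x /=; rewrite !in_itv/= ?andbT; [move=> /andP[]|move=> [-> ->]].
- by apply: erestrict_ge0 => x _.
- exact: measurable_restrict_itv.
Qed.

Lemma halfline_tail h t : (0 <= t)%R -> (forall x, 0 <= h x) -> measurable_fun setT h ->
  \int[leb]_(s in `]t, +oo[) h s = \int[mu]_(s in `]t, +oo[) h s.
Proof.
move=> t0 h0 mh; rewrite [RHS]integral_mkcond integral_halfline.
- rewrite -integral_mkcondr; congr integral.
  apply/seteqP; split => x /=; rewrite !in_itv/= ?andbT; last by move=> [_ ->].
  by move=> tx; split => //; exact: le_lt_trans tx.
- by apply: erestrict_ge0 => x _.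
- exact: measurable_restrict_itv.
Qed.

Lemma halfline_gt0 : {ae mu, forall x : R, (0 < x)%R}.
Proof.
exists `]-oo, 0%R]%classic; split => //.
  rewrite /= /mrestr (_ : _ `&` _ = set0) ?measure0//.
  apply/seteqP; split => x //= [].
  by rewrite !in_itv/= andbT leNgt => /negP.
by move=> x /= /negP; rewrite in_itv/= -leNgt.
Qed.

Lemma halfline_set1 x : mu [set x] = 0.
Proof.
apply/eqP; rewrite eq_le measure_ge0 andbT -(lebesgue_measure_set1 x) /= /mrestr.
by apply: le_measure; rewrite ?inE//; exact: measurableI.
Qed.

Lemma halfline_le_lebesgue A : measurable A -> mu A <= leb A.
Proof. by move=> mA; apply: le_measure; rewrite ?inE//; exact: measurableI. Qed.

Lemma halfline_itv (a b : R) : (0 <= a)%R -> (a <= b)%R -> mu `]a, b[%classic = (b - a)%:E.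
Proof.
move=> a0 ab; rewrite /= /mrestr setIidl; last first.
  by move=> x /=; rewrite !in_itv/= andbT => /andP[+ _]; exact: le_lt_trans.
rewrite lebesgue_measure_itv/= lte_fin.
by move: ab; rewrite le_eqVlt => /predU1P[->|->//]; rewrite ltxx subrr.
Qed.

Lemma halfline_Ny_itv (b : bool) (t : R) : (0 <= t)%R ->
  mu [set` Interval -oo%O (BSide b t)] = t%:E.
Proof.
move=> t0; rewrite /= /mrestr.
rewrite (_ : _ `&` _ = [set` Interval (BRight 0%R) (BSide b t)]).
  rewrite lebesgue_measure_itv/= lte_fin.
  by move: t0; rewrite le_eqVlt => /predU1P[<-|->]; rewrite ?ltxx// sube0.
apply/seteqP; split => x /=; rewrite !in_itv/= andbT; last by move=> /andP[].
by move=> [-> ->].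
Qed.

(** A dilation by [c] pushes Lebesgue measure to at most [c^-1] times itself, as one sees on
    intervals. *)
Lemma integral_scale (c : R) h : (0 < c)%R -> (forall x, 0 <= h x) -> measurable_fun setT h ->
  \int[mu]_x h (c * x)%R <= c^-1%:E * \int[mu]_x h x.
Proof.
move=> c0 h0 mh.
have mc : measurable_fun setT ( *%R c : R -> R) by exact: mulrl_measurable.
have mhc : measurable_fun setT (fun x => h (c * x)%R).
  exact: (measurableT_comp mh mc).
pose h' := h \_ `]0%R, +oo[.
have h'0 x : 0 <= h' x by apply: erestrict_ge0.
have mh' : measurable_fun setT h'.
  exact: measurable_restrict_itv.
have -> : \int[mu]_x h (c * x)%R = \int[leb]_x h' (c * x)%R.
  rewrite integral_halfline// integral_mkcond; apply: eq_integral => x _.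
  rewrite /h' /patch; congr (if _ then _ else _).
  by rewrite !mem_setE !in_itv/= !andbT pmulr_rgt0.
rewrite integral_halfline// [in leRHS]integral_mkcond -/h'.
rewrite -(integral_mpush _ (mc : @measurable_fun _ _ (measurableTypeR R)
  (measurableTypeR R) setT _))//.
have ci0 : (0 <= c^-1)%R by rewrite invr_ge0 ltW.
rewrite -(@ge0_integral_mscale _ _ _ leb _ measurableT (NngNum ci0))//.
apply: ge0_le_measure_integral => // S mS.
apply: le_lebesgue => //; first by rewrite invr_gt0.
move=> a b ab; apply: (@le_trans _ _ (leb `](c^-1 * a)%R, (c^-1 * b)%R]%classic)).
  rewrite mpushE; apply: (@le_measure _ _ _ leb); rewrite ?inE//.
    by rewrite -[X in measurable X]setTI; exact: mc.
  by move=> x /=; rewrite !in_itv/= ltr_pdivrMl// ler_pdivlMl.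
by rewrite lebesgue_measure_itv/= lte_fin ltr_pM2l ?invr_gt0// ab -EFinB mulrBr.
Qed.


(** The image under [phi] of the measure with density [w] is at most [C] times [mu]; equivalently, h
    |-> w * (h o phi) has norm at most [C] on nonnegative integrable functions. *)
Definition dom (w phi : R -> R) (C : R) := forall h : R -> \bar R,
  (forall x, 0 <= h x) -> measurable_fun setT h ->
  \int[mu]_x ((w x)%:E * h (phi x)) <= C%:E * \int[mu]_x h x.

Lemma ae_imp (P Q : R -> Prop) : (forall x, P x -> Q x) ->
  {ae mu, forall x, P x} -> {ae mu, forall x, Q x}.
Proof.
move=> PQ [N [mN N0 PN]]; exists N; split => // x /= nQ; apply: PN => /= Px.
by apply: nQ; exact: PQ.
Qed.

Lemma ae_and (P Q : R -> Prop) : {ae mu, forall x, P x} -> {ae mu, forall x, Q x} ->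
  {ae mu, forall x, P x /\ Q x}.
Proof.
move=> aP aQ; apply: negligibleS (negligibleU aP aQ) => x /= /not_andP[]; by [left|right].
Qed.

Lemma ae_integral_eq0 h : (forall x, 0 <= h x) -> measurable_fun setT h ->
  \int[mu]_x h x = 0 -> {ae mu, forall x, h x = 0}.
Proof.
move=> h0 mh ih; have : ae_eq mu setT h (cst 0).
  apply/ae_eq_integral_abs => //; rewrite -[RHS]ih; apply: eq_integral => x _.
  by rewrite gee0_abs.
by apply: ae_imp => x /(_ I).
Qed.

(** Tested on the indicator of the exceptional null set, [dom] says that [phi] reaches that set only
    where [w] vanishes, up to a null set. Hence weighted compositions act on classes. *)
Lemma ae_dom (w phi : R -> R) (C : R) (P : R -> Prop) :
  (forall x, (0 <= w x)%R) -> measurable_fun setT w -> measurable_fun setT phi ->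
  dom w phi C -> {ae mu, forall x, P x} ->
  {ae mu, forall x, w x != 0%R -> P (phi x)}.
Proof.
move=> w0 mw mphi D [N [mN muN PN]].
have mi : measurable_fun setT (fun x => (\1_N x)%:E : \bar R).
  by apply/measurable_EFinP; exact: measurable_indic.
have i0 x : 0 <= (\1_N x : R)%:E by rewrite lee_fin.
have := D _ i0 mi.
rewrite integral_indic// setIT [X in _ * X]muN mule0 => Dle.
have h0 x : 0 <= (w x)%:E * (\1_N (phi x))%:E by rewrite mule_ge0// lee_fin.
have ae0 : {ae mu, forall x, (w x)%:E * (\1_N (phi x))%:E = 0}.
  apply: ae_integral_eq0 => //.
    apply: emeasurable_funM; first exact/measurable_EFinP.
    exact: (measurableT_comp mi mphi).
  by apply/eqP; rewrite eq_le Dle integral_ge0.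
apply: ae_imp ae0 => x /eqP; rewrite -EFinM eqe mulf_eq0 => /orP[/eqP->|].
  by rewrite eqxx.
rewrite indicE; case: (boolP (phi x \in N)) => [_|]; first by rewrite oner_eq0.
move=> + _ _; rewrite notin_setE => Nphi.
by apply: contrapT => nP; apply: Nphi; apply: PN.
Qed.

Section rearrangement_theory.
Local Notation ddf f s := (mu [set x | (s < `|f x|)%R]).

Lemma measurable_gt f s : measurable_fun setT f -> measurable [set x | (s < `|f x|)%R].
Proof.
move=> mf; rewrite -[X in measurable X]setTI.
have mnf : measurable_fun setT (fun x => `|f x|%R) by exact: measurableT_comp.
have := mnf measurableT _ (measurable_itv `]s, +oo[).
by congr (measurable (_ `&` _)); apply/seteqP; split => x /=; rewrite in_itv/= andbT.
Qed.

Lemma ddf_mono f s s' : measurable_fun setT f -> (s <= s')%R -> ddf f s' <= ddf f s.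
Proof.
move=> mf ss; apply: le_measure; rewrite ?inE; [exact: measurable_gt..|].
by move=> x /=; exact: le_lt_trans.
Qed.

Lemma rearr_ge0 f t : 0 <= rearrangement f t.
Proof. by apply: le_ereal_inf_tmp => _ [s [s0 _] <-]; rewrite lee_fin. Qed.

(** Galois connection between the rearrangement and the distribution function; it needs the right
    continuity in [s] of the measure of superlevel sets. *)
Lemma rearr_le f t s : measurable_fun setT f -> (0 <= s)%R ->
  (rearrangement f t <= s%:E) = (ddf f s <= t%:E).
Proof.
move=> mf s0; apply/idP/idP => [rs|ds]; last first.
  by apply: ereal_inf_lbound; exists s.
apply: (@measure_sub_bigcup_le _ _ _ mu (fun n => [set x | (s + n.+1%:R^-1 < `|f x|)%R])) => //.
- by move=> n; exact: measurable_gt.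
- exact: measurable_gt.
- move=> m n mn; apply/subsetPset => x /=; apply: le_lt_trans.
  by rewrite lerD2l lef_pV2 ?posrE// ler_nat.
- by move=> x /= /ltr_add_invr[n xn]; exists n.
move=> n; have : rearrangement f t < (s + n.+1%:R^-1)%:E.
  by rewrite (le_lt_trans rs)// lte_fin ltrDl.
move=> /ereal_inf_lt[_ [s' [s'0 ds'] <-]]; rewrite lte_fin => ss'.
by rewrite (le_trans _ ds')// ddf_mono// ltW.
Qed.

Lemma rearr_nincr f t t' : (t <= t')%R -> rearrangement f t' <= rearrangement f t.
Proof.
move=> tt; apply: ereal_inf_le_tmp => _ [s [s0 ds] <-]; exists s => //.
by split => //; rewrite (le_trans ds)// lee_fin.
Qed.

Lemma measurable_rearr f : measurable_fun setT (rearrangement f).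
Proof.
apply: (measurability (@ErealGenOInfty.G R)); first exact: ErealGenOInfty.measurableE.
move=> /= _ [_] [r ->] <-; rewrite setTI; apply: is_interval_measurable => s t/=.
rewrite !in_itv/= !andbT => fs ft u /andP[su ut].
by rewrite in_itv/= andbT (lt_le_trans ft)// rearr_nincr.
Qed.

Lemma rearr_ae_mono f g t : measurable_fun setT f -> measurable_fun setT g ->
  {ae mu, forall x, (`|f x| <= `|g x|)%R} -> rearrangement f t <= rearrangement g t.
Proof.
move=> mf mg fg; apply: ereal_inf_le_tmp => _ [s [s0 ds] <-]; exists s => //.
split => //; apply: le_trans ds.
case: fg => N [mN N0 fgN].
rewrite -[leRHS]adde0 -[X in _ + X]N0; apply: (@le_trans _ _ (mu ([set x | (s < `|g x|)%R] `|` N))).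
  apply: le_measure; rewrite ?inE; [exact: measurable_gt|apply: measurableU => //; exact: measurable_gt|].
  move=> x /= sx; have [fgx|/negP fgx] := boolP (`|f x| <= `|g x|)%R.
    by left; exact: lt_le_trans fgx.
  by right; exact: fgN.
by apply: measureU2 => //; exact: measurable_gt.
Qed.

(** For measurable [f] this is membership in L_0 + L_oo. It lets the extended-valued rearrangement
    be replaced on the half-line by the real-valued [rearr]. *)
Definition rearr_fin f := forall t, (0 < t)%R -> rearrangement f t < +oo.

Definition rearr f t := fine (rearrangement f t).

Lemma rearrE f t : rearr_fin f -> (0 < t)%R -> rearrangement f t = (rearr f t)%:E.
Proof.
by move=> ff t0; rewrite /rearr fineK// ge0_fin_numE ?rearr_ge0//; exact: ff.
Qed.

Lemma fine_rearr_ge0 f t : (0 <= rearr f t)%R.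
Proof. by rewrite /rearr fine_ge0// rearr_ge0. Qed.

Lemma fine_rearr_le f t s : measurable_fun setT f -> rearr_fin f -> (0 < t)%R ->
  (0 <= s)%R -> (rearr f t <= s)%R = (ddf f s <= t%:E).
Proof. by move=> mf ff t0 s0; rewrite -lee_fin -rearrE// rearr_le. Qed.

Lemma fine_rearr_nincr f t t' : rearr_fin f -> (0 < t)%R -> (t <= t')%R ->
  (rearr f t' <= rearr f t)%R.
Proof.
by move=> ff t0 tt; rewrite -lee_fin -!rearrE ?rearr_nincr// (lt_le_trans t0).
Qed.

Lemma measurable_fine_rearr f : measurable_fun setT (rearr f).
Proof. exact: measurableT_comp (measurable_rearr f). Qed.

End rearrangement_theory.

End halfline.

(** * Ranking functions *)

Section ranking.
Context (R : realType).
Local Notation leb := (@lebesgue_measure R).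
Local Notation mu := (halfline_measure R).
Local Notation dfun f s := (mu [set x | (s < `|f x|)%R]).
Implicit Types (h : R -> \bar R) (f g phi : R -> R).

(** The substitute for measure preservation: the image of [mu] under [phi] is at most [C] times
    [mu]. *)
Definition submp phi (C : R) := forall h, (forall x, 0 <= h x)%E ->
  measurable_fun setT h -> (\int[mu]_x h (phi x) <= C%:E * \int[mu]_x h x)%E.

(** The factor e is lost inside a logarithmic level, the factor 2 at the cutoff, where c is compared
    with c / 2. *)
Definition rank_cst : R := expR 1 + 2.

(** c is the supremum of the levels whose superlevel sets have infinite measure. The superlevel set
    at c itself may have finite measure, hence the weaker information at c / 2. *)
Lemma rearr_cutoff f : measurable_fun setT f -> rearr_fin f -> exists c : R,
  [/\ 0 <= c, forall s, c < s -> (dfun f s < +oo)%E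
    & c = 0 \/ dfun f (c / 2) = +oo%E].
Proof.
move=> mf ff; pose S := [set s : R | 0 <= s /\ dfun f s = +oo%E].
have [s0 [s00 ds0]] : exists s, 0 <= s /\ (dfun f s <= 1%:E)%E.
  exists (rearr f 1); split; first exact: fine_rearr_ge0.
  by rewrite -fine_rearr_le// fine_rearr_ge0.
have Sub s : S s -> s <= s0.
  move=> [s0' ds]; rewrite leNgt; apply/negP => ss.
  have := le_trans (ddf_mono mf (ltW ss)) ds0.
  by rewrite ds leye_eq.
have finN s : 0 <= s -> ~ S s -> (dfun f s < +oo)%E.
  by move=> s0' nS; rewrite ltey; apply/eqP => ds; apply: nS.
have [[s1 Ss1]|] := pselect (exists s, S s); last first.
  move=> /forallNP nS; exists 0; split => //; last by left.
  by move=> s s_gt0; apply: finN => //; exact: ltW.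
have hs : has_sup S by split; [exists s1|exists s0 => s; exact: Sub].
have c0 : 0 <= sup S by apply: le_trans Ss1.1 _; exact: (ub_le_sup hs.2 Ss1).
exists (sup S); split => //.
  move=> s cs; apply: finN; first by rewrite ltW// (le_lt_trans c0).
  by move=> Ss; have := ub_le_sup hs.2 Ss; rewrite leNgt cs.
move: c0; rewrite le_eqVlt => /predU1P[<-|c0]; [by left|right].
have e0 : 0 < sup S / 2 by rewrite divr_gt0.
have [s [s0' ds] cs] := sup_adherent e0 hs.
apply/eqP; rewrite -leye_eq -ds; apply: ddf_mono => //; apply: ltW.
by apply: le_lt_trans cs; lra.
Qed.

Lemma measurable_if_in (D : set R) (a b : R -> R) : measurable D ->
  measurable_fun D a -> measurable_fun setT b ->
  measurable_fun setT (fun x => if x \in D then a x else b x).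
Proof.
move=> mD ma mb; apply: measurable_fun_if => //.
- by apply: (measurable_fun_bool true); rewrite setTI preimage_mem_true.
- by rewrite setTI preimage_mem_true.
- exact: measurable_funTS.
Qed.

Lemma le_integral_if (D : set R) (a b : R -> R) (C1 C2 : R) h : measurable D ->
  measurable_fun D a -> measurable_fun setT b -> (forall x, 0 <= h x)%E ->
  measurable_fun setT h -> 0 <= C1 -> 0 <= C2 ->
  (\int[mu]_(x in D) h (a x) <= C1%:E * \int[mu]_x h x)%E ->
  (\int[mu]_x h (b x) <= C2%:E * \int[mu]_x h x)%E ->
  (\int[mu]_x h (if x \in D then a x else b x) <= (C1 + C2)%:E * \int[mu]_x h x)%E.
Proof.
move=> mD ma mb h0 mh C10 C20 ha hb.
have mif := measurable_if_in mD ma mb.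
rewrite -(setUv D) ge0_integral_setU//; last 3 first.
- exact: measurableC.
- by rewrite setUv; exact: (measurableT_comp mh mif).
- by rewrite disj_set2E setICr.
rewrite EFinD ge0_muleDl ?lee_fin// setUv; apply: leeD.
  by under eq_integral => x xD do rewrite xD.
apply: le_trans hb; under eq_integral => x xD.
  rewrite (_ : (x \in D) = false); last first.
    by apply/negbTE; rewrite notin_setE; move: xD; rewrite inE.
  over.
apply: ge0_subset_integral => //; first exact: measurableC.
exact: (measurableT_comp mh mb).
Qed.

Lemma halfline_gt0I (A : set R) : mu A = mu (A `&` `]0, +oo[).
Proof. by rewrite /= /mrestr -setIA setIid. Qed.

Lemma integral_halfline_sub (A : set R) h : measurable A -> A `<=` `]0, +oo[ ->
  (forall x, A x -> 0 <= h x)%E -> measurable_fun A h ->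
  (\int[mu]_(x in A) h x = \int[leb]_(x in A) h x)%E.
Proof.
move=> mA A0 h0 mh; rewrite integral_mkcond integral_halfline.
- by rewrite -integral_mkcondr setIC (setIidl A0).
- by apply: erestrict_ge0.
- exact/(measurable_restrictT h mA).
Qed.

(** The quantile function has image measure [nu], so it avoids a [nu]-null set at almost every
    time. *)
Lemma ae_mquantile (nu : {measure set (measurableTypeR R) -> \bar R}) (B : set R) :
  (forall x, nu `]-oo, x]%classic < +oo)%E -> measurable B -> nu (~` B) = 0%E ->
  {ae mu, forall t, quantile_dom nu t -> B (mquantile nu t)}.
Proof.
move=> nf mB nB.
have mZ : measurable (quantile_dom nu `&` mquantile nu @^-1` (~` B)).
  apply: (measurable_mquantile nf); last exact: measurableC.
  exact: measurable_quantile_dom.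
exists (quantile_dom nu `&` mquantile nu @^-1` (~` B)); split => //.
  apply/eqP; rewrite -measure_le0 -[leRHS]nB -(lebesgue_mquantile nf (measurableC mB)).
  exact: halfline_le_lebesgue.
by move=> t /= /not_implyP.
Qed.

Lemma quantile_dom_gt0 (nu : {measure set (measurableTypeR R) -> \bar R}) :
  quantile_dom nu `<=` `]0, +oo[.
Proof. by move=> t [t0 _]; rewrite /= in_itv/= t0. Qed.

Section cutoff.
Variables (f : R -> R) (c : R).
Hypotheses (mf : measurable_fun setT f) (ff : rearr_fin f) (c0 : 0 <= c)
  (hc : forall s, c < s -> (dfun f s < +oo)%E)
  (hc2 : c = 0 \/ dfun f (c / 2) = +oo%E).

Let D := [set x : R | 0 < x /\ c < `|f x|].

Let mD : measurable D.
Proof.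
have -> : D = `]0, +oo[%classic `&` [set x | c < `|f x|].
  by apply/seteqP; split => x /=; rewrite in_itv/= andbT.
by apply: measurableI => //; exact: measurable_gt.
Qed.

(* [kap] orders the points of [D] by decreasing logarithmic level of [|f| - c],
   then by position, so that its distribution under [mu] has no atoms. *)
Let lev x : R := (Num.floor (ln (`|f x| - c)))%:~R.
Let kap x : R := (1 - expR (- x)) - lev x.
(** Left inverse of [kap] on positive reals: the integer part of [kap x] is [- lev x], and its
    fractional part [1 - expR (- x)] determines x. *)
Let kinv y : R := - ln (1 - (y - (Num.floor y)%:~R)).

Let mfloor : measurable_fun setT (fun x : R => (Num.floor x)%:~R : R).
Proof.
by apply: nondecreasing_measurable => // x y xy; rewrite ler_int; exact: le_floor.
Qed.

Let mkap : measurable_fun setT kap.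
Proof.
apply: measurable_funB.
  apply: measurable_funB => //.
  exact: measurableT_comp (@measurable_expR R) (@oppr_measurable R setT).
apply: (measurableT_comp mfloor); apply: (measurableT_comp (@measurable_ln R)).
by apply: measurable_funB => //; exact: measurableT_comp.
Qed.

Let mkinv : measurable_fun setT kinv.
Proof.
apply: measurableT_comp; first exact: oppr_measurable.
apply: (measurableT_comp (@measurable_ln R)).
by apply: measurable_funB => //; apply: measurable_funB.
Qed.

Let u_itv (x : R) : 0 < x -> 0 < 1 - expR (- x) < 1.
Proof.
move=> x0; rewrite subr_gt0 expR_lt1 oppr_lt0 x0/=.
by rewrite ltrBlDr ltrDl expR_gt0.
Qed.

Let floor_kap (x : R) : 0 < x -> (Num.floor (kap x))%:~R = - lev x.
Proof.
move=> x0; rewrite /kap /lev -rmorphN; congr (_%:~R); apply/floor_def.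
rewrite rmorphD/= rmorphN/=; have /andP[? ?] := u_itv x0.
by apply/andP; split; lra.
Qed.

Let kapK (x : R) : 0 < x -> kinv (kap x) = x.
Proof.
move=> x0; rewrite /kinv floor_kap// /kap opprK subrK.
by rewrite opprB addrC subrK expRK opprK.
Qed.

Let lev_lb (x : R) : D x -> c + expR (lev x) <= `|f x|.
Proof.
move=> [x0 cf]; have fc : 0 < `|f x| - c by rewrite subr_gt0.
rewrite -lerBrDl -[leRHS]lnK// ler_expR; exact: floor_le.
Qed.

Let lev_ub (x : R) : D x -> `|f x| < c + expR (lev x + 1).
Proof.
move=> [x0 cf]; have fc : 0 < `|f x| - c by rewrite subr_gt0.
rewrite -ltrBlDl -[ltLHS]lnK// ltr_expR.
by have := floorD1_gt (ln (`|f x| - c)); rewrite rmorphD.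
Qed.

Let lev_ge (x : R) (k : int) : 0 < x -> c + expR k%:~R < `|f x| -> D x /\ k%:~R <= lev x.
Proof.
move=> x0 kf; have cf : c < `|f x| by apply: lt_trans kf; rewrite ltrDl expR_gt0.
split => //; rewrite /lev ler_int floor_ge_int -ler_expR lnK; last first.
  by rewrite posrE subr_gt0.
by rewrite lerBrDl ltW.
Qed.

Let nu : {measure set (measurableTypeR R) -> \bar R} := mpush (mrestr mu mD)
  (mkap : @measurable_fun _ _ (measurableTypeR R) (measurableTypeR R) setT kap).

Let nuE A : nu A = mu (kap @^-1` A `&` D).
Proof. by []. Qed.

Let mkapI A : measurable A -> measurable (kap @^-1` A `&` D).
Proof. by move=> mA; apply: measurableI => //; rewrite -[X in measurable X]setTI; exact: mkap. Qed.

(** A point of [D] of rank at most y has [|f|] above [c + expR (- y)], a level strictly beyond the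
    cutoff. *)
Let nu_fin y : (nu `]-oo, y]%classic < +oo)%E.
Proof.
rewrite nuE; apply: (@le_lt_trans _ _ (dfun f (c + expR (- y)))); last first.
  by apply: hc; rewrite ltrDl expR_gt0.
apply: le_measure; rewrite ?inE; [exact: mkapI|exact: measurable_gt|].
move=> x /= []; rewrite in_itv/= => kxy Dx; apply: lt_le_trans (lev_lb Dx).
rewrite ltrD2l ltr_expR; have [x0 _] := Dx; have /andP[? ?] := u_itv x0.
by move: kxy; rewrite /kap => ?; lra.
Qed.

Let nu_atomless y : nu [set y] = 0%E.
Proof.
rewrite nuE; apply/eqP; rewrite -measure_le0 -[leRHS](halfline_set1 (kinv y)).
apply: le_measure; rewrite ?inE//; first exact: mkapI.
by move=> x /= [<- [x0 _]]; rewrite kapK.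
Qed.

(** Half of the mass ranked no later than x. The rearrangement is right continuous, so at the full
    mass it may already have dropped to a smaller level; halving excludes this at the cost of a
    factor 2 in [submp]. *)
Let sig x : R := mcdf nu (kap x) / 2.

Let le_integral_rank h : (forall x, 0 <= h x)%E -> measurable_fun setT h ->
  (\int[mu]_(x in D) h (sig x) <= 2%:E * \int[mu]_x h x)%E.
Proof.
move=> h0 mh.
pose H := (fun s : R => h (2^-1 * s)) \_ `[0, +oo[.
have mh2 : measurable_fun setT (fun s : R => h (2^-1 * s)).
  by apply: (measurableT_comp mh); exact: mulrl_measurable.
have mH : measurable_fun setT H by exact: measurable_restrict_itv.
have H0 s : (0 <= H s)%E by apply: erestrict_ge0.
have -> : (\int[mu]_(x in D) h (sig x) = \int[nu]_y H (mcdf nu y))%E.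
  rewrite integral_mpush//; last first.
    by apply: (measurableT_comp mH); exact: measurable_mcdf.
  rewrite integral_mrestr//; last first.
    by apply: (measurableT_comp (measurableT_comp mH (measurable_mcdf nu_fin)) mkap).
  apply: eq_integral => x _; rewrite /H /patch mem_setE in_itv/= andbT.
  by rewrite mcdf_ge0// /sig mulrC.
apply: le_trans (le_integral_mcdf nu_fin nu_atomless H0 mH) _.
rewrite -integral_mkcond -integral_itv_obnd_cbnd; last exact: measurable_funTS.
rewrite -integral_halfline//.
by apply: le_trans (integral_scale _ h0 mh) _ => //; rewrite invrK.
Qed.

(** The distribution function pushes [nu] to at most Lebesgue measure, which does not charge the
    value 0. *)
Let sig_gt0 : {ae mu, forall x, D x -> 0 < sig x}.
Proof.
pose Z := D `&` [set x | mcdf nu (kap x) = 0].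
have mcK : measurable_fun setT (fun x => mcdf nu (kap x)).
  exact: measurableT_comp (measurable_mcdf nu_fin) mkap.
have mZ : measurable Z.
  apply: measurableI => //; rewrite -[X in measurable X]setTI.
  exact: mcK measurableT _ (measurable_set1 0).
have Z0 : mu Z = 0%E.
  apply/eqP; rewrite -measure_le0.
  have lebE : (\int[leb]_s (\1_[set 0%R] s)%:E = 0 :> \bar R)%E.
    by rewrite integral_indic// setIT [LHS]lebesgue_measure_set1.
  have := @le_integral_mcdf _ nu nu_fin nu_atomless (fun x : R => (\1_[set 0%R] x)%:E).
  rewrite lebE.
  have m1 : measurable_fun setT (fun x : R => (\1_[set 0%R] x)%:E : \bar R).
    by apply/measurable_EFinP; exact: measurable_indic.
  rewrite integral_mpush//; last first.
    exact: (measurableT_comp m1 (measurable_mcdf nu_fin)).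
  rewrite integral_mrestr//; last exact: (measurableT_comp m1 mcK).
  have i0 (x : R) : (0 <= (\1_[set 0%R] x : R)%:E :> \bar R)%E by rewrite lee_fin.
  move=> /(_ i0 m1); apply: le_trans.
    rewrite -[leLHS]mul1e -integral_cst//.
    apply: (@le_trans _ _ (\int[mu]_(x in Z) (\1_[set 0%R] (mcdf nu (kap x)))%:E)%E).
      apply: ge0_le_integral => //.
        by apply: measurable_funTS; exact: (measurableT_comp m1 mcK).
      by move=> x [_ /= ->]; rewrite indicE mem_set.
    apply: ge0_subset_integral => //; last by move=> x [].
    by apply: measurable_funTS; exact: (measurableT_comp m1 mcK).
exists Z; split => // x /= /not_implyP[Dx]; move=> /negP; rewrite -leNgt => sx.
split => //=; apply/eqP; rewrite eq_le mcdf_ge0// andbT.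
by move: sx; rewrite /sig pmulr_lle0.
Qed.

(** If [rearr f (sig x)] were below the lower end of the level of x, all points ranked no later than
    x would exceed it, so their mass, twice [sig x], would be at most [sig x]. *)
Let rank_lb (x : R) : D x -> 0 < sig x -> `|f x| <= expR 1 * rearr f (sig x).
Proof.
move=> Dx s0; apply: (@le_trans _ _ (expR 1 * (c + expR (lev x)))).
  apply: (le_trans (ltW (lev_ub Dx))).
  rewrite addrC expRD mulrDr addrC [_ * expR 1]mulrC lerD2r.
  by rewrite ler_peMl// -expR0 ler_expR.
rewrite ler_pM2l ?expR_gt0// leNgt; apply/negP => rs.
have := lexx (rearr f (sig x)); rewrite fine_rearr_le// ?fine_rearr_ge0// => ds.
have : ((mcdf nu (kap x))%:E <= (sig x)%:E)%E.
  rewrite -mcdfE// nuE; apply: le_trans ds.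
  apply: le_measure; rewrite ?inE; [exact: mkapI|exact: measurable_gt|].
  move=> z /= []; rewrite in_itv/= => kz Dz; apply: (lt_le_trans rs).
  apply: le_trans (lev_lb Dz); rewrite lerD2l ler_expR.
  rewrite -[lev x]opprK -[lev z]opprK lerN2 -!floor_kap ?ler_int; last 2 first.
  - by case: Dx.
  - by case: Dz.
  exact: le_floor.
by rewrite lee_fin /sig leNgt => /negP; apply; move: s0; rewrite /sig; lra.
Qed.

Let sigma x : R := if x \in D then sig x else x.

Let msig : measurable_fun setT sig.
Proof.
apply: measurable_funM => //.
exact: measurableT_comp (measurable_mcdf nu_fin) mkap.
Qed.

(** Outside [D] the identity serves: there [|f|] is at most c, and either c is 0 or the
    rearrangement never falls below c / 2. The constant 3 is 2 on [D] plus 1 for the identity. *)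
Lemma ranking_cutoff : exists sigma, [/\ measurable_fun setT sigma, submp sigma 3 &
  {ae mu, forall x, 0 < sigma x /\ `|f x| <= rank_cst * rearr f (sigma x)}].
Proof.
exists sigma; split.
- by apply: measurable_if_in => //; exact: measurable_funTS.
- move=> h h0 mh; have -> : (3 : R) = 2 + 1 by lra.
  apply: (@le_integral_if D sig id) => //.
  + exact: measurable_funTS.
  + exact: le_integral_rank.
  + by rewrite mul1e.
- apply: ae_imp (ae_and (halfline_gt0 R) sig_gt0) => x [x0 sx].
  rewrite /sigma; case: ifPn; rewrite ?inE ?notin_setE => Dx.
    split; first exact: sx.
    apply: (le_trans (rank_lb Dx (sx Dx))); rewrite ler_wpM2r ?fine_rearr_ge0//.
    by rewrite lerDl.
  have fc : `|f x| <= c by rewrite leNgt; apply/negP => fc; apply: Dx.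
  split => //.
  case: hc2 => [c00|dinf].
    rewrite (le_trans fc)// c00 mulr_ge0 ?fine_rearr_ge0// /rank_cst.
    by rewrite addr_ge0 ?expR_ge0.
  apply: (@le_trans _ _ (2 * rearr f x)); last first.
    by rewrite ler_wpM2r ?fine_rearr_ge0// lerDr expR_ge0.
  apply: (le_trans fc); rewrite mulrC -ler_pdivrMr// leNgt; apply/negP => rc.
  have := lexx (rearr f x); rewrite fine_rearr_le// ?fine_rearr_ge0//.
  move/(le_trans (ddf_mono mf (ltW rc))).
  by rewrite dinf leye_eq.
Qed.

(* Beyond the total mass of [nu] the rearrangement is at most [c]; if [c] is
   positive the quantile function of an infinite superlevel set takes over. *)
Lemma ranking_inverse_cutoff : exists psi, [/\ measurable_fun setT psi, submp psi 3 &
  {ae mu, forall t, rearr f t <= rank_cst * `|f (psi t)|}].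
Proof.
pose QD := quantile_dom nu; pose Q := mquantile nu.
have mQD : measurable QD by exact: measurable_quantile_dom.
have [psi2 [mpsi2 psi2S psi2f]] : exists psi2, [/\ measurable_fun setT psi2, submp psi2 1 &
    {ae mu, forall t, ~ QD t -> rearr f t <= rank_cst * `|f (psi2 t)|}].
  have rc t : 0 < t -> ~ QD t -> rearr f t <= c.
    move=> t0 nQ; rewrite fine_rearr_le//.
    rewrite leNgt; apply/negP => tD; apply: nQ; split => //.
    apply: (lt_le_trans tD); rewrite halfline_gt0I nuE.
    apply: le_measure; rewrite ?inE; [|exact: mkapI|].
      by apply: measurableI => //; exact: measurable_gt.
    by move=> x /= []; rewrite in_itv/= andbT.
  have K0 : 0 <= rank_cst by rewrite addr_ge0 ?expR_ge0.
  case: hc2 => [c00|dinf].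
    exists id; split => //.
      by move=> h h0 mh; rewrite mul1e.
    apply: ae_imp (halfline_gt0 R) => t t0 nQ.
    by rewrite (le_trans (rc _ t0 nQ))// c00 mulr_ge0.
  have mD' : measurable [set x | c / 2 < `|f x|] by exact: measurable_gt.
  pose nu' : {measure set (measurableTypeR R) -> \bar R} := mrestr mu mD'.
  have nf' x : (nu' `]-oo, x]%classic < +oo)%E.
    apply: (@le_lt_trans _ _ (mu `]-oo, Num.max x 0%R]%classic)).
      apply: le_measure; rewrite ?inE//; first exact: measurableI.
      by move=> y /= []; rewrite !in_itv/= le_max => ->.
    by rewrite [ltLHS]halfline_Ny_itv ?ltry// le_max lexx orbT.
  have QD'E : quantile_dom nu' = `]0, +oo[%classic.
    apply/seteqP; split => t /=; first by move=> [t0 _]; rewrite in_itv/= t0.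
    rewrite in_itv/= andbT => t0; split => //.
    by rewrite /nu' /= {1}/mrestr setTI [ltRHS]dinf ltry.
  have mQ' := measurable_mquantile nf'.
  exists (fun t => if t \in `]0, +oo[%classic then mquantile nu' t else t); split.
  - by apply: measurable_if_in => //; rewrite -QD'E.
  - move=> h h0 mh; rewrite mul1e integral_halfline//; last first.
      by apply: (measurableT_comp mh); apply: measurable_if_in => //; rewrite -QD'E.
    under eq_integral => x xD do rewrite xD.
    rewrite -QD'E integral_mquantile// integral_mrestr//.
    exact: ge0_subset_integral.
  - have nB : nu' (~` [set x | c / 2 < `|f x|]) = 0%E.
      by rewrite /nu' /= {1}/mrestr setICl measure0.
    apply: ae_imp (ae_and (halfline_gt0 R) (ae_mquantile nf' mD' nB)) => t [t0 tB] nQ.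
    rewrite mem_set; last by rewrite /= in_itv/= t0.
    have := tB; rewrite QD'E /= in_itv/= t0 => /(_ isT) cf.
    apply: (le_trans (rc _ t0 nQ)); rewrite mulrDl.
    have : 0 <= expR 1 * `|f (mquantile nu' t)| by rewrite mulr_ge0 ?expR_ge0.
    by lra.
have mQ : measurable_fun QD (fun t => kinv (Q t)).
  exact: (measurableT_comp mkinv (measurable_mquantile nu_fin)).
pose psi t : R := if t \in QD then kinv (Q t) else psi2 t.
exists psi; split.
- exact: measurable_if_in.
- move=> h h0 mh.
  apply: (@le_trans _ _ ((1 + 1)%:E * \int[mu]_x h x)%E); last first.
    by apply: lee_wpmul2r; [exact: integral_ge0|rewrite lee_fin; lra].
  apply: (@le_integral_if QD (fun t => kinv (Q t)) psi2) => //; last exact: psi2S.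
  rewrite integral_halfline_sub//; [|exact: quantile_dom_gt0|]; last first.
    exact: (measurableT_comp mh mQ).
  rewrite (integral_mquantile nu_fin (H := fun y => h (kinv y)))//; last first.
    exact: (measurableT_comp mh mkinv).
  rewrite integral_mpush//; last exact: (measurableT_comp mh mkinv).
  rewrite integral_mrestr//; last first.
    exact: (measurableT_comp (measurableT_comp mh mkinv) mkap).
  rewrite mul1e; under eq_integral => x.
    by rewrite inE => -[x0 _]; rewrite (kapK x0); over.
  exact: ge0_subset_integral.
(* [G] carries [nu], so for almost every t in [QD] the quantile is the rank of an actual point of
   [D]. *)
pose G := [set y | kap (kinv y) = y] `&` kinv @^-1` D.
have mG : measurable G.
  apply: measurableI; last by rewrite -[X in measurable X]setTI; exact: mkinv.
  have mb : measurable_fun setT (fun y => kap (kinv y) == y).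
    apply: measurable_fun_eqr => //; exact: (measurableT_comp mkap mkinv).
  have := mb measurableT [set true] I; rewrite setTI.
  by congr measurable; apply/seteqP; split => y /= /eqP.
have nG : nu (~` G) = 0%E.
  rewrite nuE (_ : _ `&` D = set0) ?measure0//.
  apply/seteqP; split => x //= [nGx Dx]; apply: nGx; have [x0 _] := Dx.
  by split => /=; rewrite kapK.
apply: ae_imp (ae_and (ae_and psi2f (halfline_gt0 R)) (ae_mquantile nu_fin mG nG)).
move=> t [[tp t0] tG]; rewrite /psi; case: ifPn; rewrite ?inE ?notin_setE => Qt; last exact: tp.
have [/= kQ Dx] := tG Qt; rewrite -/Q in kQ Dx *; set x := kinv (Q t) in kQ Dx *.
have [x0 cf] := Dx.
(* All points of levels strictly above that of x have rank at most [- lev x], which is below the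
   quantile of t. Their mass is therefore less than t, so the rearrangement at t is at most the
   upper end of the level of x. *)
have tN : mcdf nu (- lev x) < t.
  rewrite ltNge -(mquantile_le nu_fin _ Qt) -/Q -kQ -ltNge /kap.
  by have /andP[? _] := u_itv x0; lra.
apply: (@le_trans _ _ (c + expR (lev x + 1))).
  rewrite fine_rearr_le//; last by rewrite addr_ge0 ?expR_ge0.
  apply: (@le_trans _ _ (mcdf nu (- lev x))%:E); last by rewrite lee_fin ltW.
  rewrite -mcdfE// nuE halfline_gt0I; apply: le_measure; rewrite ?inE; [|exact: mkapI|].
    by apply: measurableI => //; exact: measurable_gt.
  move=> z /=; rewrite !in_itv/= andbT => -[fz z0].
  have [Dz lz] : D z /\ (Num.floor (ln (`|f x| - c)) + 1)%:~R <= lev z.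
    by apply: lev_ge => //; rewrite rmorphD.
  split => //; rewrite /kap; have /andP[_ ?] := u_itv z0.
  by move: lz; rewrite rmorphD /= -/(lev x); lra.
apply: (@le_trans _ _ (expR 1 * (c + expR (lev x)))).
  rewrite addrC expRD mulrDr addrC [_ * expR 1]mulrC lerD2r.
  by rewrite ler_peMl// -expR0 ler_expR.
apply: (@le_trans _ _ (expR 1 * `|f x|)); first by rewrite ler_pM2l ?expR_gt0// lev_lb.
by rewrite ler_wpM2r// lerDl.
Qed.

End cutoff.

Lemma ranking f : measurable_fun setT f -> rearr_fin f ->
  exists sigma, [/\ measurable_fun setT sigma, submp sigma 3 &
    {ae mu, forall x, 0 < sigma x /\ `|f x| <= rank_cst * rearr f (sigma x)}].
Proof.
move=> mf ff; have [c [c0 hc hc2]] := rearr_cutoff mf ff.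
exact: (ranking_cutoff mf ff c0 hc hc2).
Qed.

Lemma ranking_inverse f : measurable_fun setT f -> rearr_fin f ->
  exists psi, [/\ measurable_fun setT psi, submp psi 3 &
    {ae mu, forall t, rearr f t <= rank_cst * `|f (psi t)|}].
Proof.
move=> mf ff; have [c [c0 hc hc2]] := rearr_cutoff mf ff.
exact: (ranking_inverse_cutoff mf ff c0 hc hc2).
Qed.

End ranking.

(** * Transport on the half-line *)

Section transport.
Context (R : realType).
Local Notation leb := (@lebesgue_measure R).
Local Notation mu := (halfline_measure R).
Implicit Types (h : R -> \bar R) (f g a b u v phi : R -> R).

(** phi is the quantile function of [nu'] composed with the distribution function of [nu]. It moves
    points to the left because the distribution function of [nu'] dominates that of [nu], by the
    Galois connection. *)
Lemma monotone_transport (nu nu' : {measure set (measurableTypeR R) -> \bar R}) :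
  (forall x, nu `]-oo, x]%classic < +oo)%E ->
  (forall x, nu' `]-oo, x]%classic < +oo)%E ->
  (forall x, nu [set x] = 0%E) ->
  (forall x, nu `]-oo, x]%classic <= nu' `]-oo, x]%classic)%E ->
  exists phi, [/\ measurable_fun setT phi, forall x, phi x <= x &
    forall h, (forall x, 0 <= h x)%E -> measurable_fun setT h ->
      (\int[nu]_x h (phi x) <= \int[nu']_x h x)%E].
Proof.
move=> nf nf' na le; pose QD := quantile_dom nu'; pose Q := mquantile nu'.
have mN := measurable_mcdf nf.
have mQD : measurable QD by exact: measurable_quantile_dom.
have mQ : measurable_fun QD Q by exact: measurable_mquantile.
have NP x : mcdf nu x <= mcdf nu' x by rewrite -lee_fin -!mcdfE.
pose B := mcdf nu @^-1` QD.
have mB : measurable B by rewrite -[X in measurable X]setTI; exact: mN.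
have mphi : measurable_fun setT (fun x => if x \in B then Q (mcdf nu x) else x).
  apply: measurable_if_in => //.
  apply: (measurable_comp mQD _ mQ (measurable_funTS mN)).
  by move=> _ [x Bx <-].
exists (fun x => if x \in B then Q (mcdf nu x) else x); split => //.
  move=> x; case: ifPn => //; rewrite inE => Bx.
  by rewrite /Q mquantile_le.
move=> h h0 mh.
(* Off [B] the distribution function of [nu] takes only the value 0 or the total mass of [nu']: a
   Lebesgue-null set of values, hence a [nu]-null set of points. *)
have nB : nu (~` B) = 0%E.
  pose Z := [set 0] `|` [set s : R | s%:E = nu' setT].
  have mZ : measurable Z.
    apply: measurableU => //.
    rewrite (_ : [set s : R | _] = EFin @^-1` [set nu' setT])//.
    rewrite -[X in measurable X]setTI; apply: EFin_measurable => //.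
  have Z0 : leb Z = 0%E.
    apply/eqP; rewrite -measure_le0.
    apply: (@le_trans _ _ (leb ([set 0] `|` [set fine (nu' setT)]))).
      apply: le_measure; rewrite ?inE//; first exact: measurableU.
      by move=> s [->|/= <-]; [left|right].
    apply: le_trans (measureU2 _ _ _) _ => //.
    by rewrite [X in (X + _)%E]lebesgue_measure_set1 [X in (_ + X)%E]lebesgue_measure_set1 adde0.
  have i0 (x : R) : (0 <= (\1_Z x : R)%:E)%E by rewrite lee_fin.
  have mi : measurable_fun setT (fun x : R => (\1_Z x : R)%:E).
    by apply/measurable_EFinP; exact: measurable_indic.
  have LE := le_integral_mcdf nf na i0 mi.
  rewrite [X in (_ <= X)%E]integral_indic// setIT [X in (_ <= X)%E]Z0 in LE.
  apply/eqP; rewrite -measure_le0; apply: le_trans LE.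
  have -> : (\int[nu]_x (\1_Z (mcdf nu x))%:E = \int[nu]_x (\1_(mcdf nu @^-1` Z) x)%:E)%E.
    by apply: eq_integral.
  have mNZ : measurable (mcdf nu @^-1` Z) by rewrite -[X in measurable X]setTI; exact: mN.
  rewrite integral_indic// setIT; apply: le_measure; rewrite ?inE//.
    exact: measurableC.
  move=> x /= nBx; have := mcdf_ge0 nf x; rewrite le_eqVlt => /predU1P[<-|N0]; first by left.
  right => /=; apply/eqP; rewrite eq_le; apply/andP; split.
    rewrite (@le_trans _ _ (mcdf nu' x)%:E) ?lee_fin ?NP//.
    by rewrite -mcdfE//; apply: le_measure; rewrite ?inE.
  by rewrite leNgt; apply/negP => Nx; apply: nBx.
pose H := (fun s => h (Q s)) \_ QD.
have H0 s : (0 <= H s)%E by apply: erestrict_ge0.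
have mH : measurable_fun setT H.
  by apply/(measurable_restrictT _ mQD); exact: (measurableT_comp mh mQ).
rewrite -(integral_mquantile nf' h0 mh) [leRHS]integral_mkcond.
apply: le_trans (le_integral_mcdf nf na H0 mH).
rewrite le_eqVlt; apply/orP; left; apply/eqP.
apply: ge0_ae_eq_integral => //.
- exact: (measurableT_comp mh mphi).
- exact: (measurableT_comp mH mN).
exists (~` B); split => //; first exact: measurableC.
move=> x /= nx Bx; apply: nx => _; rewrite mem_set// /H /patch mem_set//.
Qed.

Lemma transport_head u v : (forall x, 0 <= u x) -> (forall x, 0 <= v x) ->
  measurable_fun setT u -> measurable_fun setT v ->
  (forall t : R, \int[mu]_(x in `]-oo, t]) (v x)%:E < +oo)%E ->
  (forall t : R, \int[mu]_(x in `]-oo, t]) (u x)%:E <= \int[mu]_(x in `]-oo, t]) (v x)%:E)%E ->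
  exists phi, [/\ measurable_fun setT phi, forall x, phi x <= x &
    forall h, (forall x, 0 <= h x)%E -> measurable_fun setT h ->
      (\int[mu]_x ((u x)%:E * h (phi x)) <= \int[mu]_x ((v x)%:E * h x))%E].
Proof.
move=> u0 v0 mu_ mv vf uv.
pose nu : {measure set (measurableTypeR R) -> \bar R} := mdensity mu u0 mu_.
pose nu' : {measure set (measurableTypeR R) -> \bar R} := mdensity mu v0 mv.
have [phi [mphi phi_le phiS]] : exists phi, [/\ measurable_fun setT phi, forall x, phi x <= x &
    forall h, (forall x, 0 <= h x)%E -> measurable_fun setT h ->
      (\int[nu]_x h (phi x) <= \int[nu']_x h x)%E].
  apply: monotone_transport => // x; first exact: le_lt_trans (uv x) (vf x).
  apply: null_set_integral => //; first exact/measurable_EFinP/measurable_funTS.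
  exact: halfline_set1.
exists phi; split => // h h0 mh.
have := phiS h h0 mh; rewrite !integral_mdensity//.
exact: (measurableT_comp mh mphi).
Qed.

(** The substitution [- ln s] reverses the order, turning tails into left rays. It sends the
    half-line onto the whole line, so that each ray corresponds to a tail from some t > 0; a plain
    reflection would also require finiteness up to 0. *)
Lemma transport_tail u v : (forall x, 0 <= u x) -> (forall x, 0 <= v x) ->
  measurable_fun setT u -> measurable_fun setT v ->
  (forall t : R, 0 < t -> (\int[mu]_(x in `[t, +oo[) (v x)%:E < +oo)%E) ->
  (forall t : R, 0 < t ->
    (\int[mu]_(x in `[t, +oo[) (u x)%:E <= \int[mu]_(x in `[t, +oo[) (v x)%:E)%E) ->
  exists phi, [/\ measurable_fun setT phi, forall x, 0 < x -> x <= phi x &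
    forall h, (forall x, 0 <= h x)%E -> measurable_fun setT h ->
      (\int[mu]_x ((u x)%:E * h (phi x)) <= \int[mu]_x ((v x)%:E * h x))%E].
Proof.
move=> u0 v0 mu_ mv vf uv.
pose nl (s : R) : R := - ln s.
have mk : measurable_fun setT nl.
  apply: measurableT_comp; [exact: oppr_measurable|exact: measurable_ln].
have nlI A : measurable A -> measurable (nl @^-1` A).
  by move=> mA; rewrite -[X in measurable X]setTI; exact: mk.
have mk' : measurable_fun setT (fun s : R => expR (- s)).
  by apply: measurableT_comp; [exact: measurable_expR|exact: oppr_measurable].
pose mkk : @measurable_fun _ _ (measurableTypeR R) (measurableTypeR R) setT nl := mk.
pose nu : {measure set (measurableTypeR R) -> \bar R} := mpush (mdensity mu u0 mu_) mkk.
pose nu' : {measure set (measurableTypeR R) -> \bar R} := mpush (mdensity mu v0 mv) mkk.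
have cdfE (w : R -> R) (w0 : forall x, 0 <= w x) (mw : measurable_fun setT w) y :
    (mpush (mdensity mu w0 mw) mkk `]-oo, y]%classic =
     \int[mu]_(x in `[expR (- y), +oo[) (w x)%:E)%E.
  rewrite mpushE -[LHS]/(\int[mu]_(x in nl @^-1` `]-oo, y]) (w x)%:E)%E.
  have mI : measurable (nl @^-1` `]-oo, y]) by exact: nlI.
  rewrite integral_mkcond [RHS]integral_mkcond; apply: ge0_ae_eq_integral => //.
  - by apply/(measurable_restrictT _ mI); exact/measurable_EFinP/measurable_funTS.
  - by apply: measurable_restrict_itv; exact/measurable_EFinP.
  - by move=> x _; apply: erestrict_ge0 => z _; rewrite lee_fin.
  - by move=> x _; apply: erestrict_ge0 => z _; rewrite lee_fin.
  apply: ae_imp (halfline_gt0 R) => x x0 _; rewrite /patch; congr (if _ then _ else _).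
  apply/idP/idP; rewrite !inE/= !in_itv/= andbT lerNl => H.
    by rewrite -[leRHS]lnK ?ler_expR.
  by rewrite -ler_expR lnK.
have [phi [mphi phi_le phiS]] : exists phi, [/\ measurable_fun setT phi, forall x, phi x <= x &
    forall h, (forall x, 0 <= h x)%E -> measurable_fun setT h ->
      (\int[nu]_x h (phi x) <= \int[nu']_x h x)%E].
  apply: monotone_transport => x.
  - by rewrite cdfE (le_lt_trans (uv _ _) (vf _ _))// expR_gt0.
  - by rewrite cdfE vf// expR_gt0.
  - rewrite mpushE.
    rewrite -[LHS]/(\int[mu]_(z in nl @^-1` [set x]) (u z)%:E)%E.
    have mI : measurable (nl @^-1` [set x]) by exact: nlI.
    apply: null_set_integral => //; first exact/measurable_EFinP/measurable_funTS.
    apply/eqP; rewrite -measure_le0 -[leRHS](halfline_set1 (expR (- x))).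
    rewrite [leLHS]halfline_gt0I; apply: le_measure; rewrite ?inE//; first exact: measurableI.
    by move=> z /= [<-]; rewrite in_itv/= andbT opprK => z0; rewrite lnK.
  - by rewrite !cdfE uv// expR_gt0.
pose psi (s : R) : R := expR (- phi (- ln s)).
have mpsi : measurable_fun setT psi.
  by apply: (measurableT_comp mk'); exact: (measurableT_comp mphi mk).
exists psi; split => //.
  by move=> x x0; rewrite /psi -[leLHS]lnK// ler_expR lerNr phi_le.
move=> h h0 mh.
have := phiS (fun y => h (expR (- y))) (fun=> h0 _) (measurableT_comp mh mk').
rewrite !integral_mpush//; last 2 first.
- exact: (measurableT_comp mh mk').
- by apply: (measurableT_comp (measurableT_comp mh mk') mphi).
rewrite !integral_mdensity//; last 2 first.
- by apply: (measurableT_comp (measurableT_comp mh mk') mk).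
- by apply: (measurableT_comp mh mpsi).
move=> /le_trans; apply; rewrite le_eqVlt; apply/orP; left; apply/eqP.
apply: ge0_ae_eq_integral => //.
- apply: emeasurable_funM; first exact/measurable_EFinP.
  by apply: (measurableT_comp (measurableT_comp mh mk') mk).
- by apply: emeasurable_funM => //; exact/measurable_EFinP.
- by move=> x _; rewrite mule_ge0// lee_fin.
- by move=> x _; rewrite mule_ge0// lee_fin.
by apply: ae_imp (halfline_gt0 R) => x x0 _; rewrite opprK lnK.
Qed.

End transport.

(** * Weights realising a majorization *)

Section operators.
Context (R : realType).
Local Notation leb := (@lebesgue_measure R).
Local Notation mu := (halfline_measure R).
Implicit Types (h : R -> \bar R) (f g a b phi : R -> R).

(** Conditions under which h |-> A^(1/p) (h o Phi) is bounded on L_oo (bounded weight) and on L_p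
    ([dom]); the exponent does not occur, so one pair serves every p. *)
Definition head_op (C : R) (A Phi : R -> R) : Prop :=
  [/\ measurable_fun setT A, measurable_fun setT Phi, forall x, 0 <= A x,
      forall x, A x <= C & dom A Phi C].

(** The second [dom] controls supports: the image of h can be nonzero only where A is nonzero and h
    o Phi is nonzero. The weight itself may be unbounded. *)
Definition tail_op (C : R) (A Phi : R -> R) : Prop :=
  [/\ measurable_fun setT A, measurable_fun setT Phi, forall x, 0 <= A x,
      dom A Phi C & dom (\1_[set x | A x != 0]) Phi C].

Lemma measurable_neq0 a : measurable_fun setT a -> measurable [set x | a x != 0].
Proof.
move=> ma; rewrite (_ : [set x | a x != 0] = ~` (a @^-1` [set 0])); last first.
  by apply/seteqP; split => x /= /eqP.
apply: measurableC; rewrite -[X in measurable X]setTI.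
exact: ma measurableT _ (measurable_set1 0).
Qed.

Lemma measurable_invr a : measurable_fun setT a -> (forall x, 0 <= a x) ->
  measurable_fun setT (fun x => (a x)^-1).
Proof.
move=> ma a0; rewrite (_ : (fun x => _) = (fun x => a x `^ (- 1))).
  exact: measurableT_comp (measurable_powR (- 1)) ma.
by apply/funext => x; rewrite powR_inv1.
Qed.

(** Mass transported into the density [v] lands where [v] is nonzero. This is what permits division
    by the target density and, in the head case, comparison of [a] and [b] at the target point. *)
Lemma ae_weight (u v phi : R -> R) (P : R -> Prop) :
  (forall x, 0 <= u x) -> (forall x, 0 <= v x) ->
  measurable_fun setT u -> measurable_fun setT v -> measurable_fun setT phi ->
  (forall h, (forall x, 0 <= h x)%E -> measurable_fun setT h ->
      (\int[mu]_x ((u x)%:E * h (phi x)) <= \int[mu]_x ((v x)%:E * h x))%E) ->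
  {ae mu, forall x, v x != 0 -> P x} -> {ae mu, forall x, u x != 0 -> P (phi x)}.
Proof.
move=> u0 v0 mu_ mv mphi uv [N [mN muN PN]].
pose Z : set R := N `|` [set x | v x = 0].
have mZ : measurable Z.
  apply: measurableU => //; rewrite -[X in measurable X]setTI.
  exact: mv measurableT _ (measurable_set1 0).
have i0 (x : R) : (0 <= (\1_Z x : R)%:E)%E by rewrite lee_fin.
have mi : measurable_fun setT (fun x : R => (\1_Z x : R)%:E).
  by apply/measurable_EFinP; exact: measurable_indic.
have m1 : measurable_fun setT (fun x : R => ((u x)%:E * (\1_Z (phi x))%:E)%E).
  by apply: emeasurable_funM; [exact/measurable_EFinP|exact: (measurableT_comp mi mphi)].
have h1 (x : R) : (0 <= (u x)%:E * (\1_Z (phi x) : R)%:E)%E by rewrite mule_ge0// lee_fin.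
have vZ : (\int[mu]_x ((v x)%:E * (\1_Z x)%:E) = 0)%E.
  transitivity (\int[mu]_x (cst 0%E x : \bar R))%E; last by rewrite integral0.
  apply: ge0_ae_eq_integral => //.
  - by apply: emeasurable_funM => //; exact/measurable_EFinP.
  - by move=> x _; rewrite mule_ge0// lee_fin.
  exists N; split => // x /= nx; apply: contrapT => Nx; apply: nx => _.
  rewrite indicE; case: (boolP (x \in Z)); last by rewrite mule0.
  by rewrite inE => -[//|/= ->]; rewrite mul0e.
have := uv _ i0 mi; rewrite vZ => uZ.
have : {ae mu, forall x, (u x)%:E * (\1_Z (phi x))%:E = 0}%E.
  by apply: ae_integral_eq0 => //; apply/eqP; rewrite eq_le uZ integral_ge0.
apply: ae_imp => x /eqP; rewrite -EFinM eqe mulf_eq0 => /orP[/eqP->|].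
  by rewrite eqxx.
rewrite indicE; case: (boolP (phi x \in Z)) => [_|]; first by rewrite oner_eq0.
rewrite notin_setE => nZ _ _; apply: contrapT => nP; apply: nZ.
have [v00|v0n] := eqVneq (v (phi x)) 0; first by right.
by left; apply: PN => /=; apply/not_implyP.
Qed.

(** Where a <= 2 b nothing has to move. Elsewhere a is at most twice its excess over b, and
    transport of the excess to the left reaches a point y with a(y) < b(y); as a decreases, the
    weight a(x) / b(y) is at most 1. The constant 4 is 2 for the fixed part plus 2 for the moved
    part. *)
Lemma head_weights a b : measurable_fun setT a -> measurable_fun setT b ->
  (forall x, 0 <= a x) -> (forall x, 0 <= b x) ->
  (forall s t, 0 < s -> s <= t -> a t <= a s) ->
  (forall t : R, \int[mu]_(x in `]-oo, t]) (b x)%:E < +oo)%E ->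
  (forall t : R, \int[mu]_(x in `]-oo, t]) (a x)%:E <= \int[mu]_(x in `]-oo, t]) (b x)%:E)%E ->
  exists A Phi, head_op 4 A Phi /\ {ae mu, forall x, a x <= A x * b (Phi x)}.
Proof.
move=> ma mb a0 b0 and_ bf ab.
pose u x := Num.max (a x - b x) 0; pose v x := Num.max (b x - a x) 0.
have u0 x : 0 <= u x by rewrite le_max lexx orbT.
have v0 x : 0 <= v x by rewrite le_max lexx orbT.
have mu_ : measurable_fun setT u by apply: measurable_maxr => //; exact: measurable_funB.
have mv : measurable_fun setT v by apply: measurable_maxr => //; exact: measurable_funB.
have vb x : v x <= b x by rewrite ge_max b0 andbT lerBlDr lerDl.
have af : forall t : R, (\int[mu]_(x in `]-oo, t]) (a x)%:E < +oo)%E.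
  by move=> t; exact: le_lt_trans (ab t) (bf t).
have Efin w : measurable_fun setT w -> measurable_fun setT (fun x : R => (w x)%:E : \bar R).
  by move=> mw; exact/measurable_EFinP.
have vf (t : R) : (\int[mu]_(x in `]-oo, t]) (v x)%:E < +oo)%E.
  apply: le_lt_trans (bf t); apply: ge0_le_integral => //.
  - by move=> x _; rewrite lee_fin.
  - by apply: measurable_funTS; exact: Efin.
  - by apply: measurable_funTS; exact: Efin.
  by move=> x _; rewrite lee_fin.
have uv : forall t : R, (\int[mu]_(x in `]-oo, t]) (u x)%:E <= \int[mu]_(x in `]-oo, t]) (v x)%:E)%E.
  move=> t.
  (* Pointwise b + u = a + v, so the comparison of the integrals of a and b passes to the excesses,
     the integral of b being finite. *)
  have : (\int[mu]_(x in `]-oo, t]) (b x)%:E + \int[mu]_(x in `]-oo, t]) (u x)%:E =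
      \int[mu]_(x in `]-oo, t]) (a x)%:E + \int[mu]_(x in `]-oo, t]) (v x)%:E)%E.
    rewrite -!ge0_integralD//; try by [move=> x _; rewrite lee_fin|apply: measurable_funTS; exact: Efin].
    apply: eq_integral => x _; rewrite -!EFinD; congr EFin; rewrite /u /v.
    have [xy|xy] := leP (a x) (b x).
      rewrite max_r ?subr_le0// max_l ?subr_ge0//; lra.
    rewrite max_l ?subr_ge0 1?ltW// max_r ?subr_le0 1?ltW//; lra.
  move=> E; have bfin : (\int[mu]_(x in `]-oo, t]) (b x)%:E)%E \is a fin_num.
    by rewrite ge0_fin_numE//; apply: integral_ge0 => x _; rewrite lee_fin.
  by rewrite -(leeD2lE _ _ bfin) E; exact: leeD2r.
have [phi [mphi phi_le phiS]] := transport_head u0 v0 mu_ mv vf uv.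
have good : {ae mu, forall x, u x != 0 -> 0 < phi x /\ v (phi x) != 0}.
  apply: (ae_weight (P := fun y => 0 < y /\ v y != 0) u0 v0 mu_ mv mphi phiS).
  by apply: ae_imp (halfline_gt0 R) => x x0 vx.
pose B := [set x | 2 * b x < a x].
have mB : measurable B.
  have : measurable_fun setT (fun x => 2 * b x < a x).
    by apply: measurable_fun_ltr => //; exact: measurable_funM.
  move=> /(_ measurableT [set true] I); rewrite setTI.
  by congr measurable; apply/seteqP; split => x.
have mbi := measurable_invr mb b0.
(* The quotient is at most 1 only almost everywhere; the minimum makes the bound on the weight hold
   at every point. *)
pose W x := Num.min 1 (a x * (b (phi x))^-1).
have mW : measurable_fun setT W.
  apply: measurable_minr => //; apply: measurable_funM => //.
  exact: (measurableT_comp mbi mphi).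
have W0 x : 0 <= W x by rewrite le_min ler01 mulr_ge0// invr_ge0.
pose A x := if x \in B then W x else cst 2 x.
pose Phi x := if x \in B then phi x else id x.
have mA : measurable_fun setT A by apply: measurable_if_in => //; exact: measurable_funTS.
have mPhi : measurable_fun setT Phi by apply: measurable_if_in => //; exact: measurable_funTS.
have A0 x : 0 <= A x by rewrite /A; case: ifP.
exists A, Phi; split; first split => //.
- move=> x; rewrite /A; case: ifP => _ /=; last by lra.
  by rewrite ge_min; apply/orP; left; lra.
- move=> h h0 mh.
  have mhp : measurable_fun setT (fun x => h (phi x)) by exact: (measurableT_comp mh mphi).
  have m1 : measurable_fun setT (fun x => (2 * u x)%:E * ((b (phi x))^-1%:E * h (phi x)))%E.
    apply: emeasurable_funM; first by apply: Efin; exact: measurable_funM.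
    by apply: emeasurable_funM => //; apply: Efin; exact: (measurableT_comp mbi mphi).
  have p1 x : (0 <= (2 * u x)%:E * ((b (phi x))^-1%:E * h (phi x)))%E.
    by rewrite !mule_ge0// lee_fin ?invr_ge0// mulr_ge0.
  apply: (@le_trans _ _ (\int[mu]_x ((2 * u x)%:E * ((b (phi x))^-1%:E * h (phi x)) + 2%:E * h x))%E).
    apply: ge0_le_integral => //.
    - by move=> x _; rewrite mule_ge0// lee_fin.
    - apply: emeasurable_funM; first exact: Efin.
      exact: (measurableT_comp mh mPhi).
    - apply: emeasurable_funD => //; exact: measurable_funeM.
    move=> x _; rewrite /A /Phi; case: ifPn => xB; last first.
      by rewrite /=; apply: leeDr.
    apply: (@le_trans _ _ ((2 * u x)%:E * ((b (phi x))^-1%:E * h (phi x)))%E); last first.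
      by apply: leeDl; rewrite mule_ge0// lee_fin.
    rewrite muleA -EFinM; apply: lee_wpmul2r => //.
    rewrite lee_fin (@le_trans _ _ (a x * (b (phi x))^-1)) ?ge_min ?lexx ?orbT//.
    apply: ler_wpM2r; first by rewrite invr_ge0.
    move: xB; rewrite inE /B /= => xB; rewrite /u.
    have : a x - b x <= Num.max (a x - b x) 0 by rewrite le_max lexx.
    by have := b0 x; lra.
  rewrite ge0_integralD//; last 2 first.
  - by move=> x _; rewrite mule_ge0// lee_fin.
  - exact: measurable_funeM.
  have -> : ((4 : R)%:E * \int[mu]_x h x = 2%:E * \int[mu]_x h x + 2%:E * \int[mu]_x h x)%E.
    rewrite -ge0_muleDl ?lee_fin// -EFinD; congr (_%:E * _)%E; lra.
  apply: leeD; last by rewrite ge0_integralZl// lee_fin.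
  under eq_integral do rewrite EFinM -muleA.
  rewrite ge0_integralZl//; last 2 first.
  - apply: emeasurable_funM; first exact: Efin.
    by apply: emeasurable_funM => //; apply: Efin; exact: (measurableT_comp mbi mphi).
  - by move=> x _; rewrite !mule_ge0// lee_fin ?invr_ge0.
  apply: lee_wpmul2l; first by rewrite lee_fin.
  have mbh : measurable_fun setT (fun y => (b y)^-1%:E * h y)%E.
    by apply: emeasurable_funM => //; apply: Efin.
  have bh0 y : (0 <= (b y)^-1%:E * h y)%E by rewrite mule_ge0// lee_fin invr_ge0.
  apply: le_trans (phiS _ bh0 mbh) _.
  apply: ge0_le_integral => //.
  - by move=> x _; rewrite mule_ge0// lee_fin.
  - by apply: emeasurable_funM => //; exact: Efin.
  move=> x _; rewrite muleA -EFinM -[leRHS]mul1e; apply: lee_wpmul2r => //.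
  rewrite lee_fin; have [->|bx] := eqVneq (b x) 0; first by rewrite invr0 mulr0.
  by rewrite ler_pdivrMr ?mul1r// lt0r bx b0.
apply: ae_imp good => x gx; rewrite /A /Phi.
case: ifPn; rewrite ?inE ?notin_setE /B /= => xB; last by rewrite leNgt; apply/negP.
have ux : u x != 0.
  rewrite gt_eqF// /u lt_max subr_gt0; apply/orP; left.
  by have := b0 x; lra.
have [px vx] := gx ux.
have abp : a (phi x) < b (phi x).
  move: vx; rewrite /v; apply: contra_neqT; rewrite -leNgt => ba.
  by rewrite max_r// subr_le0.
have bp : 0 < b (phi x) by exact: le_lt_trans (a0 _) abp.
rewrite /W min_r; first by rewrite divfK// gt_eqF.
by rewrite ler_pdivrMr// mul1r (le_trans (and_ _ _ px (phi_le x)))// ltW.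
Qed.

(** Transport goes to the right here, so it is [b] whose monotonicity is used. The constant 2 is
    that of the target density [v]: the tail of max(a, b) is at most the sum of two tails, each
    bounded by that of b. *)
Lemma tail_weights a b : measurable_fun setT a -> measurable_fun setT b ->
  (forall x, 0 <= a x) -> (forall x, 0 <= b x) ->
  (forall s t, 0 < s -> s <= t -> b t <= b s) ->
  (forall t : R, 0 < t -> (\int[mu]_(x in `[t, +oo[) (b x)%:E < +oo)%E) ->
  (forall t : R, 0 < t ->
    (\int[mu]_(x in `[t, +oo[) (a x)%:E <= \int[mu]_(x in `[t, +oo[) (b x)%:E)%E) ->
  exists A Phi, tail_op 2 A Phi /\ {ae mu, forall x, a x <= A x * b (Phi x)}.
Proof.
move=> ma mb a0 b0 bnd bf ab.
have Efin w : measurable_fun setT w -> measurable_fun setT (fun x : R => (w x)%:E : \bar R).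
  by move=> mw; exact/measurable_EFinP.
(* Raising [a] to [max a b] makes the weight [u / b (phi)] at least 1 wherever
   it does not vanish, so the measure of its support is controlled by the weight. *)
pose u x := Num.max (a x) (b x); pose v x := 2 * b x.
have u0 x : 0 <= u x by rewrite le_max a0.
have v0 x : 0 <= v x by rewrite mulr_ge0.
have mu_ : measurable_fun setT u by exact: measurable_maxr.
have mv : measurable_fun setT v by exact: measurable_funM.
have vE (t : R) : (\int[mu]_(x in `[t, +oo[) (v x)%:E =
    \int[mu]_(x in `[t, +oo[) (b x)%:E + \int[mu]_(x in `[t, +oo[) (b x)%:E)%E.
  rewrite -ge0_integralD//; try by [move=> x _; rewrite lee_fin|apply: measurable_funTS; exact: Efin].
  by apply: eq_integral => x _; rewrite -EFinD /v; congr EFin; lra.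
have vf (t : R) : 0 < t -> (\int[mu]_(x in `[t, +oo[) (v x)%:E < +oo)%E.
  by move=> t0; rewrite vE lte_add_pinfty// bf.
have uv (t : R) : 0 < t ->
    (\int[mu]_(x in `[t, +oo[) (u x)%:E <= \int[mu]_(x in `[t, +oo[) (v x)%:E)%E.
  move=> t0; rewrite vE; apply: le_trans (leeD2r _ (ab t t0)).
  rewrite -ge0_integralD//; try by [move=> x _; rewrite lee_fin|apply: measurable_funTS; exact: Efin].
  apply: ge0_le_integral => //.
  - by move=> x _; rewrite lee_fin.
  - by apply: measurable_funTS; exact: Efin.
  - by apply: measurable_funTS; apply: Efin; exact: measurable_funD.
  by move=> x _; rewrite -EFinD lee_fin ge_max lerDl b0 lerDr a0.
have [phi [mphi phi_ge phiS]] := transport_tail u0 v0 mu_ mv vf uv.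
have good : {ae mu, forall x, u x != 0 -> v (phi x) != 0}.
  by apply: (ae_weight (P := fun y => v y != 0) u0 v0 mu_ mv mphi phiS); exact: aeW.
have mbi := measurable_invr mb b0.
pose A x := u x * (b (phi x))^-1.
have mA : measurable_fun setT A.
  by apply: measurable_funM => //; exact: (measurableT_comp mbi mphi).
have A0 x : 0 <= A x by rewrite mulr_ge0// invr_ge0.
have dA : dom A phi 2.
  move=> h h0 mh.
  have mbh : measurable_fun setT (fun y => (b y)^-1%:E * h y)%E.
    by apply: emeasurable_funM => //; apply: Efin.
  have bh0 y : (0 <= (b y)^-1%:E * h y)%E by rewrite mule_ge0// lee_fin invr_ge0.
  have -> : (\int[mu]_x ((A x)%:E * h (phi x)) =
      \int[mu]_x ((u x)%:E * ((b (phi x))^-1%:E * h (phi x))))%E.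
    by apply: eq_integral => x _; rewrite EFinM muleA.
  apply: le_trans (phiS _ bh0 mbh) _.
  rewrite -ge0_integralZl// ?lee_fin//.
  apply: ge0_le_integral => //.
  - by move=> x _; rewrite mule_ge0// lee_fin.
  - by apply: emeasurable_funM => //; exact: Efin.
  - exact: measurable_funeM.
  move=> x _; rewrite muleA -EFinM; apply: lee_wpmul2r => //.
  rewrite lee_fin /v -mulrA; have [->|bx] := eqVneq (b x) 0; first by rewrite mul0r mulr0.
  by rewrite mulfV// mulr1.
exists A, phi; split; first split => //.
- move=> h h0 mh; apply: le_trans (dA h h0 mh).
  have mn := measurable_neq0 mA.
  have mhp : measurable_fun setT (fun x => h (phi x)) by exact: (measurableT_comp mh mphi).
  apply: ae_ge0_le_integral => //.
  - by move=> x _; rewrite mule_ge0// lee_fin.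
  - apply: emeasurable_funM => //; apply: Efin; exact: measurable_indic.
  - by move=> x _; rewrite mule_ge0// lee_fin.
  - by apply: emeasurable_funM => //; exact: Efin.
  apply: ae_imp (halfline_gt0 R) => x x0 _; apply: lee_wpmul2r => //.
  rewrite lee_fin indicE; case: (boolP (x \in _)) => [|_]; last exact: A0.
  rewrite inE /= => Ax.
  have bp : 0 < b (phi x).
    rewrite lt0r b0 andbT; apply: contra_neq Ax => bp; by rewrite /A bp invr0 mulr0.
  rewrite /A ler_pdivlMr// mul1r (le_trans (bnd _ _ x0 (phi_ge x x0)))//.
  by rewrite le_max lexx orbT.
apply: ae_imp good => x gx.
have [ux|ux] := eqVneq (u x) 0.
  by rewrite (@le_trans _ _ (u x))// ?le_max ?lexx// ux mulr_ge0// -ux.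
have := gx ux; rewrite /v mulf_eq0 negb_or => /andP[_ bp].
by rewrite /A divfK// le_max lexx.
Qed.

Lemma integral_rearr_head f t : rearr_fin f ->
  (\int[mu]_(x in `]-oo, t]) (rearr f x)%:E =
   \int[leb]_(x in `]0%R, t[) rearrangement f x)%E.
Proof.
move=> ff; rewrite integral_mkcond integral_halfline; last 2 first.
- by apply: erestrict_ge0 => x _; rewrite lee_fin fine_rearr_ge0.
- by apply: measurable_restrict_itv; apply/measurable_EFinP; exact: measurable_fine_rearr.
rewrite -integral_mkcondr (_ : _ `&` _ = `]0, t]%classic).
  rewrite -integral_itv_bndo_bndc; last first.
    by apply/measurable_funTS/measurable_EFinP; exact: measurable_fine_rearr.
  apply: eq_integral => x; rewrite inE/= in_itv/= => /andP[x0 _].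
  by rewrite rearrE.
by apply/seteqP; split => x /=; rewrite !in_itv/= andbT => /andP.
Qed.

Lemma integral_rearr_tail f (t : R) : rearr_fin f -> 0 < t ->
  (\int[mu]_(x in `[t, +oo[) (rearr f x)%:E =
   \int[leb]_(x in `]t, +oo[) rearrangement f x)%E.
Proof.
move=> ff t0; rewrite integral_mkcond integral_halfline; last 2 first.
- by apply: erestrict_ge0 => x _; rewrite lee_fin fine_rearr_ge0.
- by apply: measurable_restrict_itv; apply/measurable_EFinP; exact: measurable_fine_rearr.
rewrite -integral_mkcondr (_ : _ `&` _ = `[t, +oo[%classic).
  rewrite -integral_itv_obnd_cbnd; last first.
    by apply/measurable_funTS/measurable_EFinP; exact: measurable_fine_rearr.
  apply: eq_integral => x; rewrite inE/= in_itv/= andbT => tx.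
  by rewrite rearrE// (lt_trans t0).
apply/seteqP; split => x /=; rewrite !in_itv/= !andbT; first by case.
by move=> tx; split => //; exact: lt_le_trans tx.
Qed.

(** Each of the two ranking maps contributes a factor 3. *)
Lemma dom_comp (sigma psi w Phi : R -> R) (C : R) : 0 <= C ->
  measurable_fun setT sigma -> measurable_fun setT psi ->
  measurable_fun setT w -> measurable_fun setT Phi -> (forall x, 0 <= w x) ->
  submp sigma 3 -> submp psi 3 -> dom w Phi C ->
  dom (w \o sigma) (psi \o Phi \o sigma) (9 * C).
Proof.
move=> C0 msi mps mw mPhi w0 sS pS wD h h0 mh.
have mhp : measurable_fun setT (fun y => h (psi y)) by exact: (measurableT_comp mh mps).
have mH : measurable_fun setT (fun t => (w t)%:E * h (psi (Phi t)))%E.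
  by apply: emeasurable_funM; [exact/measurable_EFinP|exact: (measurableT_comp mhp mPhi)].
have H0 t : (0 <= (w t)%:E * h (psi (Phi t)))%E by rewrite mule_ge0// lee_fin.
apply: le_trans (sS _ H0 mH) _.
rewrite (_ : 9 * C = 3 * (C * 3)); last by lra.
rewrite EFinM -muleA; apply: lee_wpmul2l => //.
apply: le_trans (wD (fun y => h (psi y)) (fun=> h0 _) mhp) _.
rewrite EFinM -muleA; apply: lee_wpmul2l; first by rewrite lee_fin.
exact: pS.
Qed.

Lemma ae_submp (sigma : R -> R) (C : R) (P : R -> Prop) : measurable_fun setT sigma ->
  submp sigma C -> {ae mu, forall x, P x} -> {ae mu, forall x, P (sigma x)}.
Proof.
move=> ms sS aP; have sD : dom (cst 1) sigma C.
  move=> h h0 mh; under eq_integral do rewrite mul1e; exact: sS.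
have := ae_dom (fun=> ler01) (measurable_cst (1 : R)) ms sD aP.
by apply: ae_imp => x; apply; rewrite oner_neq0.
Qed.

(* The operator of [g <= A * f(Phi)] is assembled on the half-line from the
   weights for the rearrangements, conjugated by the ranking maps. *)
Lemma ranked_bound f g (sigma psi w Phi : R -> R) (C : R) :
  measurable_fun setT sigma -> submp sigma 3 ->
  {ae mu, forall x, 0 < sigma x /\ `|g x| <= rank_cst R * rearr g (sigma x)} ->
  {ae mu, forall t, rearr f t <= rank_cst R * `|f (psi t)|} ->
  measurable_fun setT w -> measurable_fun setT Phi -> (forall x, 0 <= w x) ->
  dom w Phi C -> {ae mu, forall x, rearr g x <= w x * rearr f (Phi x)} ->
  {ae mu, forall x, `|g x| <= rank_cst R ^+ 2 *
     ((w \o sigma) x * `|f ((psi \o Phi \o sigma) x)|)}.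
Proof.
move=> ms sS gs fp mw mPhi w0 wD gf.
have fpP := ae_dom w0 mw mPhi wD fp.
have K0 : 0 <= rank_cst R by rewrite addr_ge0 ?expR_ge0.
apply: ae_imp (ae_and gs (ae_and (ae_submp ms sS gf) (ae_submp ms sS fpP))).
move=> x [[_ gx] [gfx fx]] /=.
apply: (le_trans gx); rewrite expr2 -mulrA; apply: ler_wpM2l => //.
have [w00|wn0] := eqVneq (w (sigma x)) 0.
  by rewrite (le_trans gfx)// w00 !mul0r mulr0.
apply: (le_trans gfx); rewrite mulrCA; apply: ler_wpM2l => //.
exact: fx.
Qed.

(** 36 is 9 from conjugation by the ranking maps times 4 from [head_weights]; each ranking map also
    costs one factor [rank_cst]. *)
Lemma head_operator f g : measurable_fun setT f -> measurable_fun setT g ->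
  rearr_fin f -> rearr_fin g ->
  (forall t : R, 0 < t -> (\int[leb]_(s in `]0%R, t[) rearrangement f s < +oo)%E) ->
  (forall t : R, 0 < t -> (\int[leb]_(s in `]0%R, t[) rearrangement g s <=
     \int[leb]_(s in `]0%R, t[) rearrangement f s)%E) ->
  exists A Phi, head_op 36 A Phi /\
    {ae mu, forall x, `|g x| <= rank_cst R ^+ 2 * (A x * `|f (Phi x)|)}.
Proof.
move=> mf mg ff gf fin gf_le.
have [sigma [ms sS gs]] := ranking mg gf.
have [psi [mp pS fp]] := ranking_inverse mf ff.
have [w [Phi [[mw mPhi w0 wC wD] gfw]]] : exists w Phi, head_op 4 w Phi /\
    {ae mu, forall x, rearr g x <= w x * rearr f (Phi x)}.
  apply: head_weights; try exact: measurable_fine_rearr;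
    try by move=> x; exact: fine_rearr_ge0.
  - by move=> s t; exact: fine_rearr_nincr.
  - move=> t; rewrite integral_rearr_head//.
    by have [/fin//|t0] := ltP 0 t; rewrite set_itv_ge ?integral_set0// bnd_simp -leNgt.
  - move=> t; rewrite (integral_rearr_head t gf) (integral_rearr_head t ff).
    by have [/gf_le//|t0] := ltP 0 t; rewrite set_itv_ge ?integral_set0// bnd_simp -leNgt.
exists (w \o sigma), (psi \o Phi \o sigma); split; first split.
- exact: measurableT_comp.
- by apply: measurableT_comp => //; exact: measurableT_comp.
- by move=> x /=.
- by move=> x /=; apply: (le_trans (wC _)); lra.
- rewrite (_ : 36 = 9 * 4 :> R); last by lra.
  by apply: (@dom_comp sigma psi w Phi).
exact: (ranked_bound ms sS gs fp mw mPhi w0 wD gfw).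
Qed.

Lemma tail_operator f g : measurable_fun setT f -> measurable_fun setT g ->
  rearr_fin f -> rearr_fin g ->
  (forall t : R, 0 < t -> (\int[leb]_(s in `]t, +oo[) rearrangement f s < +oo)%E) ->
  (forall t : R, 0 < t -> (\int[leb]_(s in `]t, +oo[) rearrangement g s <=
     \int[leb]_(s in `]t, +oo[) rearrangement f s)%E) ->
  exists A Phi, tail_op 18 A Phi /\
    {ae mu, forall x, `|g x| <= rank_cst R ^+ 2 * (A x * `|f (Phi x)|)}.
Proof.
move=> mf mg ff gf fin gf_le.
have [sigma [ms sS gs]] := ranking mg gf.
have [psi [mp pS fp]] := ranking_inverse mf ff.
have [w [Phi [[mw mPhi w0 wD wD']] gfw]] : exists w Phi, tail_op 2 w Phi /\
    {ae mu, forall x, rearr g x <= w x * rearr f (Phi x)}.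
  apply: tail_weights; try exact: measurable_fine_rearr;
    try by move=> x; exact: fine_rearr_ge0.
  - by move=> s t; exact: fine_rearr_nincr.
  - by move=> t t0; rewrite integral_rearr_tail// fin.
  - by move=> t t0; rewrite (integral_rearr_tail gf t0) (integral_rearr_tail ff t0) gf_le.
have mPs : measurable_fun setT (psi \o Phi \o sigma).
  by apply: measurableT_comp => //; exact: measurableT_comp.
exists (w \o sigma), (psi \o Phi \o sigma); split; first split => //.
- exact: measurableT_comp.
- by move=> x /=.
- rewrite (_ : 18 = 9 * 2 :> R); last by lra.
  by apply: (@dom_comp sigma psi w Phi).
- rewrite (_ : 18 = 9 * 2 :> R); last by lra.
  have := @dom_comp sigma psi (\1_[set x | w x != 0]) Phi 2 _ ms mp _ mPhi _ sS pS wD'.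
  apply => //; exact: measurable_indic (measurable_neq0 mw).
exact: (ranked_bound ms sS gs fp mw mPhi w0 wD gfw).
Qed.

End operators.

(** * The spaces L_p, L_0 and their sums *)

Section spaces.
Context (R : realType).
Local Notation mu := (halfline_measure R).
Local Notation dfun f s := (mu [set x | (s < `|f x|)%R]).
Implicit Types (f g : R -> R) (p q l : R).

Definition Ipow p f : \bar R := (\int[mu]_x (`|f x| `^ p)%:E)%E.

Definition big_part l f x : R := if l < `|f x| then f x else 0.
Definition small_part l f x : R := if l < `|f x| then 0 else f x.

Lemma big_small l f : big_part l f \+ small_part l f = f.
Proof. by apply/funext => x /=; rewrite /big_part /small_part; case: ifP; rewrite ?addr0 ?add0r. Qed.

Lemma measurable_big_part l f : measurable_fun setT f -> measurable_fun setT (big_part l f).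
Proof.
move=> mf; apply: measurable_fun_ifT => //.
by apply: measurable_fun_ltr => //; exact: measurableT_comp.
Qed.

Lemma measurable_small_part l f : measurable_fun setT f -> measurable_fun setT (small_part l f).
Proof.
move=> mf; apply: measurable_fun_ifT => //.
by apply: measurable_fun_ltr => //; exact: measurableT_comp.
Qed.

Lemma Ipow_ge0 p f : (0 <= Ipow p f)%E.
Proof. by apply: integral_ge0 => x _; rewrite lee_fin powR_ge0. Qed.

Lemma abs_pow_ge0 p f x : 0 <= abs_pow p f x.
Proof. exact: powR_ge0. Qed.

Lemma measurable_abs_pow p f : measurable_fun setT f -> measurable_fun setT (abs_pow p f).
Proof.
by move=> mf; apply: (measurableT_comp (measurable_powR p)); exact: measurableT_comp.
Qed.

Lemma measurable_eabs_pow p f : measurable_fun setT f ->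
  measurable_fun setT (fun x => (`|f x| `^ p)%:E).
Proof. by move=> mf; apply/measurable_EFinP; exact: (measurable_abs_pow p mf). Qed.

Lemma Ipow_ae_le p f g (c : R) : measurable_fun setT f -> measurable_fun setT g ->
  0 <= c -> {ae mu, forall x, `|f x| `^ p <= c * `|g x| `^ p} ->
  (Ipow p f <= c%:E * Ipow p g)%E.
Proof.
move=> mf mg c0 fg; rewrite /Ipow -ge0_integralZl_EFin//; last exact: measurable_eabs_pow.
apply: ae_ge0_le_integral => //.
- exact: measurable_eabs_pow.
- by move=> x _; rewrite mule_ge0// lee_fin powR_ge0.
- by apply: measurable_funeM; exact: measurable_eabs_pow.
by apply: ae_imp fg => x fgx _; rewrite -EFinM lee_fin.
Qed.

Lemma Ipow_le p f g : measurable_fun setT f -> measurable_fun setT g -> 0 <= p ->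
  (forall x, `|f x| <= `|g x|) -> (Ipow p f <= Ipow p g)%E.
Proof.
move=> mf mg p0 fg; rewrite -[leRHS]mul1e; apply: Ipow_ae_le => //.
by apply: aeW => x; rewrite mul1r ge0_ler_powR.
Qed.

(** Bounding the sum by twice the maximum covers exponents below 1 and above 1 alike. *)
Lemma powR_normD p (x y : R) : 0 <= p ->
  `|x + y| `^ p <= 2 `^ p * (`|x| `^ p + `|y| `^ p).
Proof.
move=> p0; apply: (@le_trans _ _ ((2 * Num.max `|x| `|y|) `^ p)).
  apply: ge0_ler_powR => //; rewrite ?nnegrE// ?mulr_ge0// ?le_max ?normr_ge0//.
  apply: (le_trans (ler_normD _ _)).
  have : `|x| <= Num.max `|x| `|y| by rewrite le_max lexx.
  have : `|y| <= Num.max `|x| `|y| by rewrite le_max lexx orbT.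
  by lra.
rewrite powRM// ?le_max ?normr_ge0//; apply: ler_wpM2l; first exact: powR_ge0.
by have [_|_] := leP `|x| `|y|; rewrite ?lerDr ?lerDl powR_ge0.
Qed.

Lemma IpowD p f g : measurable_fun setT f -> measurable_fun setT g -> 0 <= p ->
  (Ipow p (f \+ g)%R <= (2 `^ p)%:E * (Ipow p f + Ipow p g))%E.
Proof.
move=> mf mg p0; rewrite /Ipow -ge0_integralD//; last 2 first.
- exact: measurable_eabs_pow.
- exact: measurable_eabs_pow.
rewrite -ge0_integralZl_EFin ?powR_ge0//; last 2 first.
- by move=> x _; rewrite adde_ge0// lee_fin powR_ge0.
- by apply: emeasurable_funD; exact: measurable_eabs_pow.
apply: ge0_le_integral => //.
- by apply: measurable_eabs_pow; exact: measurable_funD.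
- by apply: measurable_funeM; apply: emeasurable_funD; exact: measurable_eabs_pow.
by move=> x _; rewrite -EFinD -EFinM lee_fin; exact: powR_normD.
Qed.

Lemma Lnorm_Ipow p f : 'N[mu]_p%:E[EFin \o f]%E = (Ipow p f `^ p^-1)%E.
Proof. by rewrite unlock. Qed.

Lemma LfunE (r : \bar R) f : f \in Lfun mu r <->
  measurable_fun setT f /\ ('N[mu]_r[EFin \o f] < +oo)%E.
Proof.
split; first by move=> /andP[]; rewrite inE /= => mf /asboolP.
by move=> [mf ff]; apply/andP; split; [rewrite inE|apply/asboolP].
Qed.

Lemma LpP p f : 0 < p ->
  L p%:E f <-> measurable_fun setT f /\ (Ipow p f < +oo)%E.
Proof.
move=> p0; apply: (iff_trans (LfunE _ _)); rewrite Lnorm_Ipow; split => -[mf ff]; split => //.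
  by apply: lty_poweRy ff; rewrite invr_neq0// gt_eqF.
exact: poweR_lty.
Qed.

Lemma qnorm_Lp p f : qnorm (L p%:E) f = fine (Ipow p f) `^ p^-1.
Proof. by rewrite /= Lnorm_Ipow fine_poweR. Qed.

Lemma halfline_setT : mu setT = +oo%E.
Proof.
have E : lebesgue_measure (`]0, +oo[%classic : set R) = +oo%E.
  by rewrite lebesgue_measure_itv/= ltry.
by rewrite -[RHS]E /= /mrestr setTI.
Qed.

Lemma Lnorm_oo f : 'N[mu]_+oo[EFin \o f]%E = ess_sup mu (abse \o (EFin \o f)).
Proof. by rewrite unlock /Lnorm halfline_setT ltry. Qed.

Lemma ess_sup_halfline_ge0 f : (0 <= ess_sup mu (abse \o (EFin \o f)))%E.
Proof. by rewrite -Lnorm_oo Lnorm_ge0. Qed.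

Lemma ess_sup_leP f (M : R) :
  (ess_sup mu (abse \o (EFin \o f)) <= M%:E)%E <-> {ae mu, forall x, `|f x| <= M}.
Proof.
split=> [/ess_supP|fM]; first by apply: ae_imp => x /=; rewrite lee_fin.
by apply/ess_supP; apply: ae_imp fM => x /=; rewrite lee_fin.
Qed.

Lemma LooP f : L +oo%E f <-> measurable_fun setT f /\
  exists M : R, {ae mu, forall x, `|f x| <= M}.
Proof.
apply: (iff_trans (LfunE _ _)); rewrite Lnorm_oo; split => -[mf ff]; split => //.
  have fn : ess_sup mu (abse \o (EFin \o f)) \is a fin_num.
    by rewrite ge0_fin_numE// ess_sup_halfline_ge0.
  by exists (fine (ess_sup mu (abse \o (EFin \o f)))); apply/ess_sup_leP; rewrite fineK.
by have [M /ess_sup_leP fM] := ff; rewrite (le_lt_trans fM)// ltry.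
Qed.

Lemma qnorm_Loo_ge0 f : 0 <= qnorm (L +oo%E) f.
Proof. by rewrite /= fine_ge0// Lnorm_ge0. Qed.

Lemma qnorm_Loo_ae f : L +oo%E f -> {ae mu, forall x, `|f x| <= qnorm (L +oo%E) f}.
Proof.
move=> /LfunE[mf]; rewrite /= Lnorm_oo => ff; apply/ess_sup_leP; rewrite fineK//.
by rewrite ge0_fin_numE// ess_sup_halfline_ge0.
Qed.

Lemma qnorm_Loo_le f (M : R) : 0 <= M -> {ae mu, forall x, `|f x| <= M} ->
  qnorm (L +oo%E) f <= M.
Proof.
move=> M0 /ess_sup_leP fM; rewrite /= Lnorm_oo -lee_fin fineK//.
by rewrite ge0_fin_numE ?ess_sup_halfline_ge0// (le_lt_trans fM)// ltry.
Qed.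

(** Passing to p-th powers removes the roots; the absolute value of the given constant makes the new
    one nonnegative. *)
Lemma bounded_LpP p T : 0 < p -> bounded_on (L p%:E) T <->
  exists2 C : R, 0 <= C & forall f, L p%:E f ->
    L p%:E (T f) /\ (Ipow p (T f) <= C%:E * Ipow p f)%E.
Proof.
move=> p0; have pi0 : 0 <= p^-1 by rewrite invr_ge0 ltW.
have fn f : L p%:E f -> Ipow p f = (fine (Ipow p f))%:E.
  by move=> /(LpP _ p0)[_ ff]; rewrite fineK// ge0_fin_numE// Ipow_ge0.
have f0 f : 0 <= fine (Ipow p f) by rewrite fine_ge0// Ipow_ge0.
have rootK x : 0 <= x -> (x `^ p^-1) `^ p = x.
  by move=> x0; rewrite -powRrM mulVf ?gt_eqF// powRr1.
split=> [[C TC]|[C C0 TC]].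
  exists (`|C| `^ p); first exact: powR_ge0.
  have H x y : 0 <= x -> 0 <= y -> x `^ p^-1 <= C * y `^ p^-1 -> x <= `|C| `^ p * y.
    move=> x0 y0 xy; rewrite -[leLHS](rootK _ x0) -[y](rootK _ y0) -powRM ?powR_ge0//.
    apply: ge0_ler_powR; rewrite ?nnegrE ?mulr_ge0 ?powR_ge0 ?(ltW p0)//.
    by apply: (le_trans xy); rewrite ler_wpM2r ?powR_ge0// ler_norm.
  move=> f Lf; have [LT TCf] := TC f Lf; split; first exact: LT.
  rewrite !qnorm_Lp in TCf; rewrite (fn _ LT) (fn _ Lf) -EFinM lee_fin.
  exact: (H _ _ (f0 _) (f0 _) TCf).
exists (C `^ p^-1) => f Lf; have [LT TCf] := TC f Lf; split; first exact: LT.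
rewrite !qnorm_Lp -powRM//; apply: ge0_ler_powR; rewrite ?nnegrE ?mulr_ge0//.
by move: TCf; rewrite (fn _ LT) (fn _ Lf) -EFinM lee_fin.
Qed.

Lemma bounded_LooP (T : (R -> R) -> R -> R) : bounded_on (L +oo%E) T <->
  exists2 C : R, 0 <= C & forall f, L +oo%E f ->
    L +oo%E (T f) /\ forall M, 0 <= M -> {ae mu, forall x, `|f x| <= M} ->
      {ae mu, forall x, `|T f x| <= C * M}.
Proof.
split=> [[C TC]|[C C0 TC]].
  exists `|C| => // f Lf; have [LT TCf] := TC f Lf; split => // M M0 fM.
  apply: ae_imp (qnorm_Loo_ae LT) => x /le_trans; apply; apply: (le_trans TCf).
  apply: (@le_trans _ _ (`|C| * qnorm (L +oo%E) f)).
    by rewrite ler_wpM2r ?qnorm_Loo_ge0// ler_norm.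
  by rewrite ler_wpM2l// qnorm_Loo_le.
exists C => f Lf; have [LT TCf] := TC f Lf; split => //.
apply: qnorm_Loo_le; first by rewrite mulr_ge0// qnorm_Loo_ge0.
by apply: TCf; [exact: qnorm_Loo_ge0|exact: qnorm_Loo_ae].
Qed.

Lemma bounded_L0P (T : (R -> R) -> R -> R) : bounded_on L0 T <->
  exists2 C : R, 0 <= C & forall f, L0 f ->
    L0 (T f) /\ (supp_measure (T f) <= C%:E * supp_measure f)%E.
Proof.
have fn f : L0 f -> supp_measure f = (fine (supp_measure f))%:E.
  by move=> [_ ff]; rewrite fineK// ge0_fin_numE.
split=> [[C TC]|[C C0 TC]].
  exists `|C| => // f Lf; have [LT TCf] := TC f Lf; split => //.
  rewrite (fn _ LT) (fn _ Lf) -EFinM lee_fin; apply: (le_trans TCf).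
  by rewrite ler_wpM2r ?ler_norm// fine_ge0.
exists C => f Lf; have [LT TCf] := TC f Lf; split; first exact: LT.
by move: TCf; rewrite (fn _ LT) (fn _ Lf) -EFinM lee_fin.
Qed.

Lemma LpD p f g : 0 < p -> L p%:E f -> L p%:E g -> L p%:E (f \+ g).
Proof.
move=> p0 /(LpP _ p0)[mf ff] /(LpP _ p0)[mg fg]; apply/(LpP _ p0); split.
  exact: measurable_funD.
apply: le_lt_trans (IpowD mf mg (ltW p0)) _.
by apply: lte_mul_pinfty; rewrite ?lee_fin ?powR_ge0//; apply: lte_add_pinfty; [exact: ff|exact: fg].
Qed.

Lemma supp_measureD f g : measurable_fun setT f -> measurable_fun setT g ->
  (supp_measure (f \+ g)%R <= supp_measure f + supp_measure g)%E.
Proof.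
move=> mf mg; apply: (@le_trans _ _ (mu ([set x | f x != 0] `|` [set x | g x != 0]))).
  apply: le_measure; rewrite ?inE.
  - by apply: measurable_neq0; exact: measurable_funD.
  - by apply: measurableU; exact: measurable_neq0.
  move=> x /=; have [->|] := eqVneq (f x) 0; last by left.
  by rewrite add0r => ?; right.
by apply: measureU2; exact: measurable_neq0.
Qed.

Lemma L0D f g : L0 f -> L0 g -> L0 (f \+ g).
Proof.
move=> [mf ff] [mg fg]; split; first exact: measurable_funD.
by apply: le_lt_trans (supp_measureD mf mg) _; rewrite lte_add_pinfty.
Qed.

(** Replaces an arbitrary decomposition by truncation at a level, which later arguments can
    choose. *)
Lemma sum_LpLooP p f : 0 < p -> sum_space (L p%:E) (L +oo%E) f <->
  measurable_fun setT f /\ exists2 l : R, 0 <= l & (Ipow p (big_part l f) < +oo)%E.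
Proof.
move=> p0; split.
  move=> [a [b [/(LpP _ p0)[ma fa] /LooP[mb [M bM]] ->]]]; split; first exact: measurable_funD.
  (* Where |a + b| exceeds 2 |M| while |b| <= M, the L_p summand carries at least half: |a + b| <= 2
     |a|. *)
  exists (2 * `|M|); first by rewrite mulr_ge0.
  apply: (@le_lt_trans _ _ ((2 `^ p)%:E * Ipow p a)%E); last first.
    by rewrite lte_mul_pinfty ?lee_fin ?powR_ge0.
  apply: Ipow_ae_le => //; last first.
  - apply: ae_imp bM => x bM; rewrite /big_part.
    have -> : 2 `^ p * `|a x| `^ p = (2 * `|a x|) `^ p by rewrite powRM.
    apply: ge0_ler_powR; rewrite ?nnegrE ?mulr_ge0 ?(ltW p0)//.
    case: ifPn => [|_]; last by rewrite normr0 mulr_ge0.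
    have := ler_normD (a x) (b x); have := ler_norm M; rewrite /=; lra.
  by apply: measurable_big_part; exact: measurable_funD.
move=> [mf [l l0 fl]]; exists (big_part l f), (small_part l f); split.
- by apply/(LpP _ p0); split => //; exact: measurable_big_part.
- apply/LooP; split; first exact: measurable_small_part.
  exists l; apply: aeW => x; rewrite /small_part; case: ifPn; rewrite ?normr0//.
  by rewrite -leNgt.
- by rewrite big_small.
Qed.

Lemma Ipow_bounded p f (M : R) (A : set R) : 0 <= p -> 0 <= M -> measurable A ->
  measurable_fun setT f -> (forall x, `|f x| `^ p <= M * \1_A x) ->
  (Ipow p f <= M%:E * mu A)%E.
Proof.
move=> p0 M0 mA mf fM; rewrite -[in leRHS](setIT A) -integral_indic//.
rewrite -ge0_integralZl_EFin//; last by apply/measurable_EFinP; exact: measurable_indic.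
apply: ge0_le_integral => //.
- exact: measurable_eabs_pow.
- by apply: measurable_funeM; apply/measurable_EFinP; exact: measurable_indic.
by move=> x _; rewrite -EFinM lee_fin.
Qed.

Lemma Ipow_chebyshev q l f : 0 <= q -> 0 <= l -> measurable_fun setT f ->
  ((l `^ q)%:E * dfun f l <= Ipow q f)%E.
Proof.
move=> q0 l0 mf; have mA := measurable_gt l mf.
set A := [set x | _] in mA *.
rewrite -[in leLHS](setIT A) -integral_indic//.
rewrite -ge0_integralZl_EFin ?powR_ge0//; last by apply/measurable_EFinP; exact: measurable_indic.
apply: ge0_le_integral => //.
- by move=> x _; rewrite mule_ge0// lee_fin ?powR_ge0.
- by apply: measurable_funeM; apply/measurable_EFinP; exact: measurable_indic.
- exact: measurable_eabs_pow.
move=> x _; rewrite -EFinM lee_fin indicE; case: (boolP (x \in _)); rewrite ?mulr0 ?powR_ge0//.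
rewrite inE mulr1 /A /= => lx; apply: ge0_ler_powR; rewrite ?nnegrE ?(ltW lx)//.
Qed.

Lemma sum_L0LqP q f : 0 < q -> sum_space L0 (L q%:E) f <->
  measurable_fun setT f /\ exists l : R, [/\ 0 <= l, (dfun f l < +oo)%E
    & (Ipow q (small_part l f) < +oo)%E].
Proof.
move=> q0; split.
  move=> [a [b [[ma fa] /(LpP _ q0)[mb fb] ->]]]; split; first exact: measurable_funD.
  have mS : measurable [set x | a x != 0] by exact: measurable_neq0.
  have mab : measurable_fun setT (a \+ b) by exact: measurable_funD.
  (* At level 1, |a + b| exceeds 1 only where a is nonzero or |b| > 1, and the small part is at most
     the indicator of the support of a plus |b|. *)
  exists 1; split; [exact: ler01| |].
    have fb1 : (mu [set x | (1 < `|b x|)%R] < +oo)%E.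
      apply: le_lt_trans fb.
      have := Ipow_chebyshev (ltW q0) ler01 mb.
      by rewrite powR1 mul1e.
    apply: (@le_lt_trans _ _ (mu ([set x | a x != 0] `|` [set x | (1 < `|b x|)%R]))).
      apply: le_measure; rewrite ?inE; first exact: measurable_gt.
        by apply: measurableU => //; exact: measurable_gt.
      move=> x /=; have [->|] := eqVneq (a x) 0; last by left.
      by rewrite add0r => ?; right.
    apply: le_lt_trans (measureU2 _ _ _) _ => //; first exact: measurable_gt.
    by rewrite lte_add_pinfty.
  pose c := \1_[set x | a x != 0] : R -> R.
  have mc : measurable_fun setT c by exact: measurable_indic.
  apply: (@le_lt_trans _ _ (Ipow q (fun x => c x + `|b x|))).
    apply: Ipow_le => //; [exact: measurable_small_part| |exact: ltW|].
      by apply: measurable_funD => //; exact: measurableT_comp.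
    move=> x; rewrite [leRHS]ger0_norm ?addr_ge0// /small_part /c indicE.
    case: ifPn => [_|]; first by rewrite normr0 addr_ge0.
    rewrite -leNgt /= => ab1; case: (boolP (x \in _)) => [_|].
      by rewrite (le_trans ab1)// lerDl.
    by rewrite notin_setE /= => /negP; rewrite negbK => /eqP ->; rewrite !add0r.
  have mnb : measurable_fun setT (fun x => `|b x|) by exact: measurableT_comp.
  apply: le_lt_trans (IpowD mc mnb (ltW q0)) _.
  apply: lte_mul_pinfty; rewrite ?lee_fin ?powR_ge0//; apply: lte_add_pinfty.
    apply: le_lt_trans fa; rewrite -[X in (_ <= X)%E]mul1e; apply: Ipow_bounded => //.
      exact: ltW.
    move=> x; rewrite mul1r /c indicE; case: (x \in _); rewrite ?normr1 ?powR1//.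
    by rewrite normr0 powR0// gt_eqF.
  apply: le_lt_trans fb; apply: Ipow_le => //; first exact: ltW.
  by move=> x; rewrite normr_id.
move=> [mf [l [l0 fl1 fl2]]]; exists (big_part l f), (small_part l f); split.
- split; first exact: measurable_big_part.
  apply: le_lt_trans fl1; apply: le_measure; rewrite ?inE.
  + by apply: measurable_neq0; exact: measurable_big_part.
  + exact: measurable_gt.
  by move=> x /=; rewrite /big_part; case: ifP => //; rewrite eqxx.
- by apply/(LpP _ q0); split => //; exact: measurable_small_part.
- by rewrite big_small.
Qed.

End spaces.

(** * Weighted composition operators and gluing *)

Section weighted_composition.
Context (R : realType).
Local Notation leb := (@lebesgue_measure R).
Local Notation mu := (halfline_measure R).
Implicit Types (h : R -> \bar R) (f g A Phi : R -> R) (p q : R).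

Definition wop p A Phi f x : R := A x `^ p^-1 * f (Phi x).

Lemma measurable_wop p A Phi f : measurable_fun setT A -> measurable_fun setT Phi ->
  measurable_fun setT f -> measurable_fun setT (wop p A Phi f).
Proof.
move=> mA mP mf; apply: measurable_funM; last exact: measurableT_comp.
exact: (measurableT_comp (measurable_powR p^-1) mA).
Qed.

Lemma powR_root p x : 0 < p -> 0 <= x -> (x `^ p^-1) `^ p = x.
Proof. by move=> p0 x0; rewrite -powRrM mulVf ?gt_eqF// powRr1. Qed.

Lemma Ipow_wop p A Phi f C : 0 < p -> (forall x, 0 <= A x) -> dom A Phi C ->
  measurable_fun setT f -> (Ipow p (wop p A Phi f) <= C%:E * Ipow p f)%E.
Proof.
move=> p0 A0 dA mf.
have := dA (fun x => (`|f x| `^ p)%:E) (fun=> powR_ge0 _ _) (measurable_eabs_pow p mf).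
apply: le_trans; rewrite le_eqVlt; apply/orP; left; apply/eqP.
apply: eq_integral => x _; rewrite -EFinM; congr EFin.
by rewrite /wop normrM powRM// ger0_norm ?powR_ge0// powR_root.
Qed.

Lemma wop_linear (X Y : fspace R) p A Phi C : (forall x, 0 <= A x) ->
  measurable_fun setT A -> measurable_fun setT Phi -> dom A Phi C -> 0 < p ->
  (forall f, X f -> X (wop p A Phi f)) -> (forall f, Y f -> Y (wop p A Phi f)) ->
  linear_operator (sum_space X Y) (wop p A Phi).
Proof.
move=> A0 mA mP dA p0 XX YY; split.
- move=> _ [f [g [Xf Yg ->]]]; exists (wop p A Phi f), (wop p A Phi g).
  by split; [exact: XX|exact: YY|apply/funext => x; rewrite /wop/= mulrDr].
- move=> f g _ _ fg; apply: ae_imp (ae_dom A0 mA mP dA fg) => x fgx _.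
  rewrite /wop; have [->|/fgx/(_ I)->//] := eqVneq (A x) 0.
  by rewrite powR0 ?mul0r// invr_neq0// gt_eqF.
- by move=> a f g _ _; apply: aeW => x _; rewrite /wop; ring.
Qed.

Lemma head_op_bounded p A Phi C : 0 < p -> head_op C A Phi ->
  bounded_on_couple (L p%:E) (L +oo%E) (wop p A Phi).
Proof.
move=> p0 [mA mP A0 AC dA].
have bp f : L p%:E f -> L p%:E (wop p A Phi f) /\
    (Ipow p (wop p A Phi f) <= C%:E * Ipow p f)%E.
  move=> /(LpP _ p0)[mf ff]; have le := Ipow_wop p0 A0 dA mf; split => //.
  apply/(LpP _ p0); split; first exact: measurable_wop.
  by apply: le_lt_trans le _; rewrite lte_mul_pinfty ?lee_fin ?(le_trans (A0 0) (AC 0)).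
have C0 : 0 <= C := le_trans (A0 0) (AC 0).
have boo f M : 0 <= M -> {ae mu, forall x, `|f x| <= M} ->
    {ae mu, forall x, `|wop p A Phi f x| <= C `^ p^-1 * M}.
  move=> M0 fM; apply: ae_imp (ae_dom A0 mA mP dA fM) => x fx.
  rewrite /wop normrM ger0_norm ?powR_ge0//.
  have [->|An] := eqVneq (A x) 0.
    by rewrite powR0 ?mul0r ?mulr_ge0 ?powR_ge0// invr_neq0// gt_eqF.
  apply: ler_pM => //; rewrite ?powR_ge0//; last exact: fx.
  by apply: ge0_ler_powR; rewrite ?nnegrE ?invr_ge0 ?(ltW p0).
have Loo f : L +oo%E f -> L +oo%E (wop p A Phi f).
  move=> /[dup] Lf /LooP[mf _]; apply/LooP; split; first exact: measurable_wop.
  exists (C `^ p^-1 * qnorm (L +oo%E) f); apply: boo; first exact: qnorm_Loo_ge0.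
  exact: qnorm_Loo_ae.
split.
- by apply: wop_linear => //; [exact: dA|move=> f /bp[]].
- by apply/bounded_LpP => //; exists C.
- apply/bounded_LooP; exists (C `^ p^-1); first exact: powR_ge0.
  by move=> f Lf; split; [exact: Loo|move=> M; exact: boo].
Qed.

(** On L_0 the support of the image is exactly {A nonzero} intersected with the preimage under Phi
    of the support of f, which the second [dom] measures. *)
Lemma tail_op_bounded q A Phi C : 0 < q -> 0 <= C -> tail_op C A Phi ->
  bounded_on_couple L0 (L q%:E) (wop q A Phi).
Proof.
move=> q0 C0 [mA mP A0 dA dA'].
have bq f : L q%:E f -> L q%:E (wop q A Phi f) /\
    (Ipow q (wop q A Phi f) <= C%:E * Ipow q f)%E.
  move=> /(LpP _ q0)[mf ff]; have le := Ipow_wop q0 A0 dA mf; split => //.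
  apply/(LpP _ q0); split; first exact: measurable_wop.
  by apply: le_lt_trans le _; rewrite lte_mul_pinfty ?lee_fin.
have b0 f : L0 f -> L0 (wop q A Phi f) /\
    (supp_measure (wop q A Phi f) <= C%:E * supp_measure f)%E.
  move=> [mf ff]; have mT := measurable_wop q mA mP mf.
  have mS := measurable_neq0 mf.
  have le : (supp_measure (wop q A Phi f) <= C%:E * supp_measure f)%E.
    have mi : measurable_fun setT (fun x : R => (\1_[set x | f x != 0] x : R)%:E).
      by apply/measurable_EFinP; exact: measurable_indic.
    have i0 (x : R) : (0 <= (\1_[set x | f x != 0] x : R)%:E)%E by rewrite lee_fin.
    have E : (\int[mu]_x (\1_[set x | f x != 0] x : R)%:E = supp_measure f)%E.
      by rewrite integral_indic// setIT.
    have := dA' _ i0 mi; rewrite E.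
    apply: le_trans; rewrite /supp_measure -[in leLHS](setIT [set x | wop q A Phi f x != 0]).
    rewrite -integral_indic//; last exact: measurable_neq0.
    rewrite le_eqVlt; apply/orP; left; apply/eqP.
    apply: eq_integral => x _; rewrite -EFinM; congr EFin; rewrite !indicE.
    have mE (P : R -> bool) y : (y \in [set x | P x]) = P y.
      by apply/idP/idP; rewrite inE.
    rewrite !mE -natrM mulnb; congr (_%:R); congr nat_of_bool.
    by rewrite /wop mulf_eq0 powR_eq0 invr_eq0 (gt_eqF q0) andbT negb_or.
  by split => //; split => //; apply: le_lt_trans le _; rewrite lte_mul_pinfty ?lee_fin.
split.
- by apply: wop_linear => //; [exact: dA|move=> f /b0[]|move=> f /bq[]].
- by apply/bounded_L0P; exists C.
- by apply/bounded_LpP => //; exists C.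
Qed.

End weighted_composition.

(** * Countably many disjoint copies of the half-line *)

Section gluing.
Context (R : realType).
Local Notation leb := (@lebesgue_measure R).
Local Notation mu := (halfline_measure R).
Implicit Types (h : R -> \bar R) (f g : R -> R) (n m k : nat).

Local Notation tr := (@Num.truncn R).
Local Notation fr x := (x - (tr x)%:R).

Lemma pickle_inv_some m (nk : nat * nat) : pickle_inv m = Some nk -> pickle nk = m.
Proof. by move=> E; rewrite -[RHS](pickle_invK (T := (nat * nat)%type)) E. Qed.

Lemma measurable_truncn m : measurable [set x : R | tr x = m].
Proof.
have mt : measurable_fun setT (fun x : R => (tr x)%:R : R).
  by apply: nondecreasing_measurable => // x y xy; rewrite ler_nat le_truncn.
have := mt measurableT _ (measurable_set1 m%:R); rewrite setTI.
congr measurable; apply/seteqP; split => x /=; last by move->.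
by move=> /eqP; rewrite eqr_nat => /eqP.
Qed.

Lemma fr_itv (x : R) : 0 <= x -> 0 <= fr x < 1.
Proof.
by move=> /truncn_itv; rewrite -natr1 subr_ge0 ltrBlDl.
Qed.

(* Copies of the half-line: the [k]-th unit interval of the [n]-th copy is the
   unit interval of index [pickle (n, k)]. *)
Definition theta n (y : R) : R := (pickle (n, tr y))%:R + fr y.

Definition copy n : set R := [set x | exists k, pickle_inv (tr x) = Some (n, k)].

(** Common left inverse of all the embeddings [theta n] on nonnegative reals, with default value 0
    off the copies. Since [tr] is 0 on negative reals, nothing forces nonnegativity there, hence the
    absolute values around [rho] later. *)
Definition rho (x : R) : R :=
  if pickle_inv (tr x) is Some nk then (nk : nat * nat).2%:R + fr x else 0.

Definition glue (B : nat -> R -> R) (x : R) : R :=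
  if pickle_inv (tr x) is Some nk then B (nk : nat * nat).1 (nk.2%:R + fr x) else 0.

Lemma truncn_theta n (y : R) : 0 <= y -> tr (theta n y) = pickle (n, tr y).
Proof.
move=> y0; apply: truncn_def; rewrite /theta lerDl -natr1 ltrD2l.
exact: fr_itv.
Qed.

Lemma theta_copy n (y : R) : 0 <= y -> copy n (theta n y).
Proof. by move=> y0; exists (tr y); rewrite truncn_theta// pickleK_inv. Qed.

Lemma rhoK n (y : R) : 0 <= y -> rho (theta n y) = y.
Proof.
move=> y0; rewrite /rho truncn_theta// pickleK_inv/= /theta.
by rewrite addrAC subrr add0r addrC subrK.
Qed.

Lemma theta_ge0 n (y : R) : 0 <= y -> 0 <= theta n y.
Proof. by move=> y0; rewrite addr_ge0//; have /andP[] := fr_itv y0. Qed.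

Lemma glueE B n x : copy n x -> glue B x = B n (rho x).
Proof. by move=> [k E]; rewrite /glue /rho E. Qed.

Lemma glue0 B x : (forall n, ~ copy n x) -> glue B x = 0.
Proof.
rewrite /glue => nC; case E : (pickle_inv _) => [[n k]|//].
by exfalso; apply: (nC n); exists k.
Qed.

Lemma measurable_piecewise (u : R -> R) :
  (forall m, exists2 v, measurable_fun setT v & forall x, tr x = m -> u x = v x) ->
  measurable_fun setT u.
Proof.
move=> uv _ B mB; rewrite setTI.
rewrite (_ : u @^-1` B = \bigcup_m ([set x | tr x = m] `&` u @^-1` B)); last first.
  by apply/seteqP; split => [x Bx|x [m _ []]//]; exists (tr x).
apply: bigcupT_measurable => m; have [v mv uvE] := uv m.
rewrite (_ : _ `&` _ = [set x | tr x = m] `&` v @^-1` B).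
  apply: measurableI; first exact: measurable_truncn.
  by rewrite -[X in measurable X]setTI; exact: mv.
by apply/seteqP; split => x /= [E]; rewrite (uvE x E).
Qed.

Let mshift (c : R) : measurable_fun setT (fun x : R => c + x).
Proof. exact: measurable_funD. Qed.

Lemma measurable_glue B : (forall n, measurable_fun setT (B n)) ->
  measurable_fun setT (glue B).
Proof.
move=> mB; apply: measurable_piecewise => m.
case E : (pickle_inv m : option (nat * nat)) => [[n k]|].
  exists (fun x => B n ((k%:R - m%:R) + x)); first exact: (measurableT_comp (mB n) (mshift _)).
  by move=> x xm; rewrite /glue xm E/= -addrA [- _ + x]addrC.
by exists (cst 0) => // x xm; rewrite /glue xm E.
Qed.

Lemma measurable_rho : measurable_fun setT rho.
Proof.
apply: measurable_piecewise => m.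
case E : (pickle_inv m : option (nat * nat)) => [[n k]|].
  exists (fun x => (k%:R - m%:R) + x); first exact: mshift.
  by move=> x xm; rewrite /rho xm E/= -addrA [- _ + x]addrC.
by exists (cst 0) => // x xm; rewrite /rho xm E.
Qed.

Lemma measurable_theta n : measurable_fun setT (theta n).
Proof.
apply: measurable_piecewise => m.
exists (fun x => ((pickle (n, m))%:R - m%:R) + x); first exact: mshift.
by move=> x xm; rewrite /theta xm -addrA [- _ + x]addrC.
Qed.

Lemma measurable_copy n : measurable (copy n).
Proof.
rewrite (_ : copy n = \bigcup_(k in [set: nat]) [set x : R | tr x = pickle (n, k)]); last first.
  apply/seteqP; split => x /=.
    by move=> [k E]; exists k => //=; rewrite (pickle_inv_some E).
  by move=> [k _ /= E]; exists k; rewrite E pickleK_inv.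
by apply: bigcupT_measurable => k; exact: measurable_truncn.
Qed.

Lemma trivIset_copy : trivIset setT copy.
Proof.
apply/trivIsetP => n n' _ _ nn; apply/seteqP; split => x //= [[k E] [k' E']].
by move: nn; move: E'; rewrite E => -[->]; rewrite eqxx.
Qed.

Lemma integral_shift_le (c : R) h : (forall x, 0 <= h x)%E -> measurable_fun setT h ->
  (\int[leb]_x h (c + x)%R <= \int[leb]_x h x)%E.
Proof.
move=> h0 mh.
rewrite -(integral_mpush _ (mshift c : @measurable_fun _ _ (measurableTypeR R)
  (measurableTypeR R) setT _))//.
apply: ge0_le_measure_integral => // S mS.
rewrite -[leRHS]mul1e; apply: le_lebesgue => // a b ab.
rewrite mpushE; apply: (@le_trans _ _ (leb `](a - c), (b - c)]%classic)).
  apply: (@le_measure _ _ _ leb); rewrite ?inE//.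
    by rewrite -[X in measurable X]setTI; exact: mshift.
  by move=> x /=; rewrite !in_itv/= ltrBlDl lerBrDl.
rewrite lebesgue_measure_itv/= lte_fin ltrD2r ab -EFinB lee_fin; lra.
Qed.

(** tau translates the unit interval of index [a k] onto that of index [b k]. With one of the two
    index maps the identity, this covers both [theta] and [rho]. *)
Lemma integral_piecewise_shift_le (a b : nat -> nat) (tau : R -> R) h :
  injective a -> injective b ->
  (forall k x, (a k)%:R <= x < (a k).+1%:R -> tau x = ((b k)%:R - (a k)%:R) + x) ->
  measurable_fun setT tau ->
  (forall x, 0 <= h x)%E -> measurable_fun setT h ->
  (\int[leb]_(x in \bigcup_k `[(a k)%:R : R, (a k).+1%:R : R[%classic) h (tau x) <=
   \int[leb]_(x in \bigcup_k `[(b k)%:R : R, (b k).+1%:R : R[%classic) h x)%E.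
Proof.
move=> ia ib tauE mtau h0 mh.
have tI (c : nat -> nat) : injective c ->
    trivIset setT (fun k => `[(c k)%:R, (c k).+1%:R[%classic : set R).
  move=> ic; apply/trivIsetP => i j _ _ ij; apply/seteqP; split => x //=.
  rewrite !in_itv/= => -[/truncn_def Ei /truncn_def Ej].
  by move: ij; rewrite -(inj_eq ic) -Ei Ej eqxx.
have mht : measurable_fun setT (fun x => h (tau x)) by exact: (measurableT_comp mh mtau).
rewrite !ge0_integral_bigcup//; last 4 first.
- exact: measurable_funTS.
- exact: tI.
- exact: measurable_funTS.
- exact: tI.
apply: lee_nneseries => [k _ _|k _]; first exact: integral_ge0.
pose H := h \_ `[(b k)%:R, (b k).+1%:R[.
rewrite [leRHS]integral_mkcond -/H.
have H0 x : (0 <= H x)%E by apply: erestrict_ge0.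
have mH : measurable_fun setT H by exact: measurable_restrict_itv.
apply: le_trans (integral_shift_le ((b k)%:R - (a k)%:R) H0 mH).
rewrite integral_mkcond; apply: ge0_le_integral => //.
- by move=> x _; exact: erestrict_ge0.
- exact: measurable_restrict_itv.
- exact: (measurableT_comp mH (mshift _)).
move=> x _; rewrite {1}/patch; case: ifPn => //; rewrite inE /= in_itv/= => xk.
rewrite /H /patch (tauE k)// mem_set// /= in_itv/=.
by move: xk; rewrite -!natr1 => /andP[? ?]; apply/andP; split; lra.
Qed.

Lemma integral_halfline0 h : (forall x, 0 <= h x)%E -> measurable_fun setT h ->
  (\int[mu]_x h x = \int[leb]_(x in `[0%R, +oo[) h x)%E.
Proof.
move=> h0 mh; rewrite integral_halfline// integral_itv_obnd_cbnd//.
exact: measurable_funTS.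
Qed.

Lemma itv0y_bigcup_nat : `[0, +oo[%classic = \bigcup_k `[k%:R, k.+1%:R[%classic :> set R.
Proof.
apply/seteqP; split => x /=; rewrite in_itv/= andbT.
  by move=> x0; exists (tr x) => //=; rewrite in_itv/= truncn_itv.
by move=> [k _ /=]; rewrite in_itv/= => /andP[+ _]; exact: le_trans.
Qed.

Lemma copy_bigcup n : copy n `&` `[0, +oo[ =
  \bigcup_(k in [set: nat]) `[(pickle (n, k))%:R, (pickle (n, k)).+1%:R[%classic.
Proof.
apply/seteqP; split => x /=.
  rewrite in_itv/= andbT => -[[k E] x0]; exists k => //=; rewrite in_itv/=.
  by rewrite (pickle_inv_some E); exact: truncn_itv.
move=> [k _ /=]; rewrite !in_itv/= andbT => xk; split.
  by exists k; rewrite (truncn_def xk) pickleK_inv.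
by case/andP: xk => + _; exact: le_trans.
Qed.

Let pickle_inj n : injective (fun k => pickle (n, k)).
Proof. by move=> k k' /(pcan_inj pickleK_inv)[]. Qed.

Lemma integral_theta_le n h : (forall x, 0 <= h x)%E -> measurable_fun setT h ->
  (\int[mu]_x h (theta n x) <= \int[mu]_(x in copy n) h x)%E.
Proof.
move=> h0 mh; have mt := measurable_theta n.
rewrite integral_halfline0//; last exact: (measurableT_comp mh mt).
rewrite [leRHS]integral_mkcond integral_halfline0; last 2 first.
- by apply: erestrict_ge0.
- by apply/(measurable_restrictT h (measurable_copy n)); exact: measurable_funTS.
rewrite -integral_mkcondr setIC copy_bigcup itv0y_bigcup_nat.
apply: (@integral_piecewise_shift_le id) => // k x xk.
by rewrite /theta (truncn_def xk) -addrA [- _ + x]addrC.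
Qed.

Lemma integral_rho_le n h : (forall x, 0 <= h x)%E -> measurable_fun setT h ->
  (\int[mu]_(x in copy n) h (rho x) <= \int[mu]_x h x)%E.
Proof.
move=> h0 mh; have mr := measurable_rho.
have mhr : measurable_fun setT (fun x => h (rho x)) by exact: (measurableT_comp mh mr).
rewrite [leRHS]integral_halfline0//.
rewrite [leLHS]integral_mkcond integral_halfline0; last 2 first.
- by apply: erestrict_ge0.
- by apply/(measurable_restrictT _ (measurable_copy n)); exact: measurable_funTS.
rewrite -integral_mkcondr setIC copy_bigcup itv0y_bigcup_nat.
apply: (@integral_piecewise_shift_le _ id) => // k x xk.
by rewrite /rho (truncn_def xk) pickleK_inv /= -addrA [- _ + x]addrC.
Qed.

End gluing.

(** * Uniformity of the constant by gluing *)

Section uniform.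
Context (R : realType).
Local Notation mu := (halfline_measure R).
Implicit Types (h : R -> \bar R) (f g A Phi : R -> R) (p q C : R) (n : nat).

Definition gluemap (Phi : nat -> R -> R) : R -> R :=
  glue (fun n => theta n \o Phi n).

Lemma measurable_gluemap (Phi : nat -> R -> R) : (forall n, measurable_fun setT (Phi n)) ->
  measurable_fun setT (gluemap Phi).
Proof.
move=> mP; apply: measurable_glue => n.
exact: measurableT_comp (measurable_theta n) (mP n).
Qed.

Lemma glue_ge0 (B : nat -> R -> R) x : (forall n x, 0 <= B n x) -> 0 <= glue B x.
Proof. by move=> B0; rewrite /glue; case: (pickle_inv _) => // -[n k]. Qed.

Lemma gluemap_ge0 (Phi : nat -> R -> R) x : (forall n x, 0 <= Phi n x) -> 0 <= gluemap Phi x.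
Proof. by move=> P0; apply: glue_ge0 => n y /=; exact: theta_ge0. Qed.

(** Each copy is carried to the half-line by [rho], estimated there, and carried back into the same
    copy by [theta]. The copies are disjoint, so the bounds add up without loss in [C]. *)
Lemma dom_glue (B Phi : nat -> R -> R) C : 0 <= C ->
  (forall n, measurable_fun setT (B n)) -> (forall n, measurable_fun setT (Phi n)) ->
  (forall n x, 0 <= B n x) -> (forall n, dom (B n) (Phi n) C) ->
  dom (glue B) (gluemap Phi) C.
Proof.
move=> C0 mB mP B0 D h h0 mh.
pose g x : \bar R := ((glue B x)%:E * h (gluemap Phi x))%E.
have g0 x : (0 <= g x)%E by rewrite mule_ge0// lee_fin glue_ge0.
have mg : measurable_fun setT g.
  apply: emeasurable_funM; first by apply/measurable_EFinP; exact: measurable_glue.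
  by apply: (measurableT_comp mh); exact: measurable_gluemap.
have mU : measurable (\bigcup_n (@copy R n)).
  by apply: bigcupT_measurable => n; exact: measurable_copy.
have -> : (\int[mu]_x g x = \int[mu]_(x in \bigcup_n (@copy R n)) g x)%E.
  rewrite [RHS]integral_mkcond; apply: eq_integral => x _; rewrite /patch.
  case: ifPn => //; rewrite notin_setE => nx; rewrite /g glue0 ?mul0e// => n xn.
  by apply: nx; exists n.
apply: (@le_trans _ _ (C%:E * \int[mu]_(x in \bigcup_n (@copy R n)) h x)%E); last first.
  by apply: lee_wpmul2l; [rewrite lee_fin|exact: ge0_subset_integral].
rewrite !ge0_integral_bigcup//; last 6 first.
- by move=> k; exact: measurable_copy.
- exact: measurable_funTS.
- exact: trivIset_copy.
- by move=> k; exact: measurable_copy.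
- exact: measurable_funTS.
- exact: trivIset_copy.
rewrite -nneseriesZl; last by move=> n _; exact: integral_ge0.
apply: lee_nneseries => [n _ _|n _]; first exact: integral_ge0.
pose G t : \bar R := ((B n t)%:E * h (theta n (Phi n t)))%E.
have G0 t : (0 <= G t)%E by rewrite mule_ge0// lee_fin.
have mht : measurable_fun setT (fun y => h (theta n y)).
  exact: (measurableT_comp mh (measurable_theta n)).
have mG : measurable_fun setT G.
  by apply: emeasurable_funM; [exact/measurable_EFinP|exact: (measurableT_comp mht (mP n))].
under eq_integral => x xn.
  move: xn; rewrite inE => xn; rewrite /g /gluemap !(glueE _ xn) /= -/(G (rho x)); over.
apply: le_trans (integral_rho_le n G0 mG) _.
apply: le_trans (D n (fun y => h (theta n y)) (fun=> h0 _) mht) _.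
by apply: lee_wpmul2l; [rewrite lee_fin|exact: integral_theta_le].
Qed.

(** Nonnegativity of [Phi] is required because [rho] inverts [theta n] on nonnegative reals only. *)
Definition head_class C A Phi := head_op C A Phi /\ forall x, 0 <= Phi x.
Definition tail_class C A Phi := tail_op C A Phi /\ forall x, 0 <= Phi x.

Lemma glue_head C (A Phi : nat -> R -> R) :
  (forall n, head_class C (A n) (Phi n)) -> head_class C (glue A) (gluemap Phi).
Proof.
move=> H; have C0 : 0 <= C by have [[_ _ A0 AleC _] _] := H 0%N; exact: le_trans (A0 0) (AleC 0).
split; last by move=> x; apply: gluemap_ge0 => n; have [_] := H n.
split.
- by apply: measurable_glue => n; have [[]] := H n.
- by apply: measurable_gluemap => n; have [[]] := H n.
- by move=> x; apply: glue_ge0 => n; have [[]] := H n.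
- move=> x; rewrite /glue; case: (pickle_inv _) => // -[n k] /=.
  by have [[_ _ _]] := H n.
- by apply: dom_glue => // n; have [[]] := H n.
Qed.

Lemma glue_tail C (A Phi : nat -> R -> R) : 0 <= C ->
  (forall n, tail_class C (A n) (Phi n)) -> tail_class C (glue A) (gluemap Phi).
Proof.
move=> C0 H; have mA n : measurable_fun setT (A n) by have [[]] := H n.
split; last by move=> x; apply: gluemap_ge0 => n; have [_] := H n.
split.
- exact: measurable_glue.
- by apply: measurable_gluemap => n; have [[]] := H n.
- by move=> x; apply: glue_ge0 => n; have [[]] := H n.
- by apply: dom_glue => // n; have [[]] := H n.
- rewrite (_ : \1_[set x | glue A x != 0] = glue (fun n => \1_[set x | A n x != 0])).
    apply: dom_glue => // n; try by have [[]] := H n.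
    exact: measurable_indic (measurable_neq0 (mA n)).
  have mE (P : R -> bool) (y : R) : (y \in [set x | P x]) = P y.
    by apply/idP/idP; rewrite inE.
  apply/funext => x; rewrite indicE mE /glue.
  by case: (pickle_inv _) => [[n k]|] /=; rewrite ?eqxx// indicE mE.
Qed.

Lemma integral_norm h : (forall x, 0 <= h x)%E -> measurable_fun setT h ->
  (\int[mu]_x h `|x|%R = \int[mu]_x h x)%E.
Proof.
move=> h0 mh; have mn : measurable_fun setT (fun x : R => `|x|) by exact: normr_measurable.
apply: ge0_ae_eq_integral => //; first exact: (measurableT_comp mh mn).
by apply: ae_imp (halfline_gt0 R) => x x0 _; rewrite gtr0_norm.
Qed.

Lemma dom_rho n : dom (\1_(copy n)) (fun x : R => `|rho x|) 1.
Proof.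
move=> h h0 mh; rewrite mul1e -[leRHS]integral_norm//.
have mn : measurable_fun setT (fun x : R => h `|x|).
  exact: (measurableT_comp mh (@normr_measurable R setT)).
apply: le_trans (integral_rho_le (h := fun x : R => h `|x|) n (fun=> h0 _) mn).
rewrite [leRHS]integral_mkcond le_eqVlt; apply/orP; left; apply/eqP.
apply: eq_integral => x _; rewrite /patch indicE.
by case: (x \in _); rewrite ?mul1e ?mul0e.
Qed.

Lemma dom_theta n : dom (cst 1) (fun x : R => theta n `|x|) 1.
Proof.
move=> h h0 mh; under eq_integral do rewrite mul1e.
have mht : measurable_fun setT (fun y => h (theta n y)).
  exact: (measurableT_comp mh (measurable_theta n)).
rewrite mul1e (@integral_norm (fun y => h (theta n y)))//.
apply: le_trans (integral_theta_le n h0 mh) _.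
by apply: ge0_subset_integral => //; exact: measurable_copy.
Qed.

Let mrho' : measurable_fun setT (fun x : R => `|rho x|).
Proof. exact: measurableT_comp (@measurable_rho R). Qed.

Let mtheta' n : measurable_fun setT (fun x : R => theta n `|x|).
Proof. exact: measurableT_comp (measurable_theta n) (@normr_measurable R setT). Qed.

Lemma head_rho n : head_class 1 (\1_(copy n)) (fun x : R => `|rho x|).
Proof.
split; first split => //.
- exact: measurable_indic (measurable_copy n).
- exact: dom_rho.
by move=> x.
Qed.

Lemma head_theta n : head_class 1 (cst 1) (fun x : R => theta n `|x|).
Proof.
split; last by move=> x; exact: theta_ge0.
by split => //; exact: dom_theta.
Qed.

Lemma tail_rho n : tail_class 1 (\1_(copy n)) (fun x : R => `|rho x|).
Proof.
split; last by move=> x.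
split => //; first exact: measurable_indic (measurable_copy n).
- exact: dom_rho.
rewrite (_ : [set x | _] = copy n); first exact: dom_rho.
apply/seteqP; split => x /=; rewrite indicE; last by move=> xn; rewrite mem_set ?oner_neq0.
by case: (boolP (x \in _)); rewrite ?inE// eqxx.
Qed.

Lemma tail_theta n : tail_class 1 (cst 1) (fun x : R => theta n `|x|).
Proof.
split; last by move=> x; exact: theta_ge0.
split => //; first exact: dom_theta.
rewrite (_ : \1__ = cst 1); first exact: dom_theta.
by apply/funext => x; rewrite indicE mem_set//= oner_neq0.
Qed.

(* If the constants were not uniform, bad triples [(A n, Phi n, f n)] moved to
   the disjoint copies of the half-line would glue to one unbounded operator. *)
Lemma uniform_bound (E : fspace R) (hE : quasi_Banach_function_space E) p
    (P : R -> (R -> R) -> (R -> R) -> Prop) C : 0 < p ->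
  (forall C A Phi, P C A Phi -> [/\ measurable_fun setT A, measurable_fun setT Phi,
     forall x, 0 <= A x & forall x, 0 <= Phi x]) ->
  (forall A Phi : nat -> R -> R, (forall n, P C (A n) (Phi n)) -> P C (glue A) (gluemap Phi)) ->
  (forall n, P 1 (\1_(copy n)) (fun x : R => `|rho x|)) ->
  (forall n, P 1 (cst 1) (fun x : R => theta n `|x|)) ->
  (forall C A Phi, P C A Phi -> bounded_on E (wop p A Phi)) ->
  exists2 c, 0 < c & forall A Phi f, P C A Phi -> E f ->
    E (wop p A Phi f) /\ qnorm E (wop p A Phi f) <= c * qnorm E f.
Proof.
move=> p0 Pm Pglue Prho Ptheta Pbd.
have pN : p^-1 != 0 by rewrite invr_neq0// gt_eqF.
apply: contrapT => /forall2NP nob.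
have bd A Phi C' : P C' A Phi -> exists c, 0 <= c /\ forall f, E f ->
    E (wop p A Phi f) /\ qnorm E (wop p A Phi f) <= c * qnorm E f.
  move=> /Pbd[c cE]; exists `|c|; split => // f Ef; have [Ew le] := cE f Ef.
  split => //; apply: (le_trans le); rewrite ler_wpM2r ?ler_norm//.
  exact: qB_ge0 hE _ Ef.
have /choice[cr crP] : forall n, exists c, 0 <= c /\ forall f, E f ->
    E (wop p (\1_(copy n)) (fun x : R => `|rho x|) f) /\
    qnorm E (wop p (\1_(copy n)) (fun x : R => `|rho x|) f) <= c * qnorm E f.
  by move=> n; exact: bd (Prho n).
have /choice[ct ctP] : forall n, exists c, 0 <= c /\ forall f, E f ->
    E (wop p (cst 1) (fun x : R => theta n `|x|) f) /\
    qnorm E (wop p (cst 1) (fun x : R => theta n `|x|) f) <= c * qnorm E f.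
  by move=> n; exact: bd (Ptheta n).
(* E is not known to be symmetric, so moving a function into the n-th copy and back costs constants
   [cr n] and [ct n] that may depend on n. They are compensated in advance in the choice of the bad
   triple. *)
have bad n : exists w : (R -> R) * (R -> R) * (R -> R), [/\ P C w.1.1 w.1.2, E w.2 &
    (n.+1%:R * (cr n + 1) * (ct n + 1)) * qnorm E w.2 <
      qnorm E (wop p w.1.1 w.1.2 w.2)].
  have c0 : 0 < n.+1%:R * (cr n + 1) * (ct n + 1).
    by rewrite !mulr_gt0// ltr_pwDr ?(crP n).1 ?(ctP n).1.
  have [//|H] := nob (n.+1%:R * (cr n + 1) * (ct n + 1)).
  apply: contrapT => nex; apply: H => A Phi f PA Ef.
  have [c [_ cE]] := bd _ _ _ PA; have [Ew _] := cE f Ef.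
  split => //; rewrite leNgt; apply/negP => lt; apply: nex.
  by exists (A, Phi, f).
have [w wP] := choice bad.
pose A n := (w n).1.1; pose Phi n := (w n).1.2; pose f n := (w n).2.
have PA n : P C (A n) (Phi n) by have [] := wP n.
have Ef n : E (f n) by have [] := wP n.
have [B [B0 BT]] := bd _ _ _ (Pglue A Phi PA).
(* B < n + 1 for this n, so the glued operator, seen through the n-th copy, contradicts the choice
   of the n-th triple. *)
pose n := Num.truncn B.
have [mA mP A0 P0] := Pm _ _ _ (PA n).
pose f' := wop p (\1_(copy n)) (fun x : R => `|rho x|) (f n).
have [Ef' f'le] : E f' /\ qnorm E f' <= cr n * qnorm E (f n) := (crP n).2 _ (Ef n).
pose T := wop p (glue A) (gluemap Phi).
have [ET Tle] : E (T f') /\ qnorm E (T f') <= B * qnorm E f' := BT _ Ef'.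
pose g := wop p (cst 1) (fun x : R => theta n `|x|) (T f').
have [Eg gle] : E g /\ qnorm E g <= ct n * qnorm E (T f') := (ctP n).2 _ ET.
have mw : measurable_fun setT (wop p (A n) (Phi n) (f n)).
  by apply: measurable_wop => //; exact: qB_measurable hE _ (Ef n).
have gE : {ae mu, forall x, `|wop p (A n) (Phi n) (f n) x| <= `|g x|}.
  apply: ae_imp (halfline_gt0 R) => x x0; rewrite le_eqVlt; apply/orP; left; apply/eqP.
  congr `| _ |; rewrite /g {2}/wop powR1 mul1r gtr0_norm// /T {2}/wop.
  have cx : copy n (theta n x) by apply: theta_copy; exact: ltW.
  rewrite /gluemap !(glueE _ cx) rhoK ?ltW//= /f' {2}/wop.
  have cP : copy n (theta n (Phi n x)) by apply: theta_copy.
  by rewrite indicE mem_set// powR1 mul1r rhoK// ger0_norm.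
have [_ wle] := qB_ideal hE Eg mw gE.
have [_ _] := wP n; rewrite -/(A n) -/(Phi n) -/(f n) ltNge => /negP; apply.
have Q0 : 0 <= qnorm E (f n) := qB_ge0 hE (Ef n).
have [cr0 _] := crP n; have [ct0 _] := ctP n.
apply: (le_trans wle); apply: (le_trans gle).
apply: (@le_trans _ _ (ct n * (B * (cr n * qnorm E (f n))))).
  rewrite ler_wpM2l//; apply: (le_trans Tle); rewrite ler_wpM2l//.
rewrite !mulrA ler_wpM2r//.
rewrite (_ : ct n * B * cr n = B * cr n * ct n); last by ring.
have Bn : B <= n.+1%:R by rewrite ltW// truncnS_gt.
rewrite ler_pM ?mulr_ge0//; last by rewrite lerDl.
by rewrite ler_pM// lerDl.
Qed.

End uniform.

(** * Bounds on rearrangements *)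

Section rearrangement_bounds.
Context (R : realType).
Local Notation leb := (@lebesgue_measure R).
Local Notation mu := (halfline_measure R).
Local Notation dfun f s := (mu [set x | (s < `|f x|)%R]).
Local Notation K := (rank_cst R).
Implicit Types (h : R -> \bar R) (f g F G U : R -> R) (t : R).

Lemma rank_cst_ge0 : 0 <= K.
Proof. by rewrite addr_ge0 ?expR_ge0. Qed.

Lemma rank_cst_gt0 : 0 < K.
Proof. by rewrite addr_gt0 ?expR_gt0. Qed.

Lemma Ipow1 F : Ipow 1 F = (\int[mu]_x `|F x|%:E)%E.
Proof. by apply: eq_integral => x _; rewrite powRr1. Qed.

Lemma Ipow1_abs_pow p f : Ipow 1 (abs_pow p f) = Ipow p f.
Proof. by rewrite Ipow1; apply: eq_integral => x _; rewrite ger0_norm ?abs_pow_ge0. Qed.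

Lemma abs_pow_big p l f : 0 < p -> 0 <= l ->
  abs_pow p (big_part l f) = big_part (l `^ p) (abs_pow p f).
Proof.
move=> p0 l0; apply/funext => x; rewrite /abs_pow /big_part [`|_ `^ p|]ger0_norm ?powR_ge0//.
have -> : (l `^ p < `|f x| `^ p) = (l < `|f x|).
  apply/idP/idP; last by apply: gt0_ltr_powR; rewrite ?nnegrE.
  rewrite !ltNge; apply: contra; apply: ge0_ler_powR; rewrite ?nnegrE// ltW//.
by case: ifP => // _; rewrite normr0 powR0// gt_eqF.
Qed.

Lemma abs_pow_small p l f : 0 < p -> 0 <= l ->
  abs_pow p (small_part l f) = small_part (l `^ p) (abs_pow p f).
Proof.
move=> p0 l0; apply/funext => x; rewrite /abs_pow /small_part [`|_ `^ p|]ger0_norm ?powR_ge0//.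
have -> : (l `^ p < `|f x| `^ p) = (l < `|f x|).
  apply/idP/idP; last by apply: gt0_ltr_powR; rewrite ?nnegrE.
  rewrite !ltNge; apply: contra; apply: ge0_ler_powR; rewrite ?nnegrE// ltW//.
by case: ifP => // _; rewrite normr0 powR0// gt_eqF.
Qed.

Lemma measurable_efun F : measurable_fun setT F -> measurable_fun setT (fun x => (F x)%:E).
Proof. by move=> mF; exact/measurable_EFinP. Qed.

Lemma measurable_enorm F : measurable_fun setT F -> measurable_fun setT (fun x => `|F x|%:E).
Proof. by move=> mF; apply: measurable_efun; exact: measurableT_comp. Qed.

Lemma measurable_erearr F : measurable_fun setT (fun x => (rearr F x)%:E).
Proof. by apply: measurable_efun; exact: measurable_fine_rearr. Qed.

Lemma rearr_fin_le F G : measurable_fun setT F -> measurable_fun setT G ->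
  {ae mu, forall x, `|F x| <= `|G x|} -> rearr_fin G -> rearr_fin F.
Proof.
move=> mF mG FG fG t t0; apply: le_lt_trans (fG t t0); exact: rearr_ae_mono.
Qed.

Lemma rearr_mono F G t : measurable_fun setT F -> measurable_fun setT G ->
  {ae mu, forall x, `|F x| <= `|G x|} -> rearr_fin G -> 0 < t ->
  rearr F t <= rearr G t.
Proof.
move=> mF mG FG fG t0; rewrite -lee_fin -!rearrE//; first exact: rearr_ae_mono.
exact: rearr_fin_le FG fG.
Qed.

Lemma integral_head_fin F t : rearr_fin F ->
  (\int[leb]_(x in `]0%R, t[) rearrangement F x = \int[mu]_(x in `]-oo, t[) (rearr F x)%:E)%E.
Proof.
move=> fF; rewrite -halfline_head; last 2 first.
- by move=> x; rewrite lee_fin fine_rearr_ge0.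
- by apply: measurable_efun; exact: measurable_fine_rearr.
by apply: eq_integral => x; rewrite inE /= in_itv/= => /andP[x0 _]; rewrite rearrE.
Qed.

Lemma integral_tail_fin F t : rearr_fin F -> 0 <= t ->
  (\int[leb]_(x in `]t, +oo[) rearrangement F x = \int[mu]_(x in `]t, +oo[) (rearr F x)%:E)%E.
Proof.
move=> fF t0; rewrite -halfline_tail//; last 2 first.
- by move=> x; rewrite lee_fin fine_rearr_ge0.
- by apply: measurable_efun; exact: measurable_fine_rearr.
apply: eq_integral => x; rewrite inE /= in_itv/= andbT => tx; rewrite rearrE//.
exact: le_lt_trans tx.
Qed.

(** The easy half of a K-functional estimate: G* is at most [K] times |G| along a map pushing [mu]
    to at most 3 [mu], so U contributes its full integral and M contributes over a length t. *)
Lemma rearr_head_ub G U (M t : R) : measurable_fun setT G -> measurable_fun setT U ->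
  rearr_fin G -> (forall x, 0 <= U x) -> 0 <= M -> 0 < t ->
  {ae mu, forall x, `|G x| <= U x + M} ->
  (\int[leb]_(x in `]0%R, t[) rearrangement G x <=
   K%:E * (3%:E * \int[mu]_x (U x)%:E + (t * M)%:E))%E.
Proof.
move=> mG mU fG U0 M0 t0 GU; rewrite integral_head_fin//.
have [psi [mp pS Gp]] := ranking_inverse mG fG.
have mUp : measurable_fun setT (fun x => U (psi x)) by exact: measurableT_comp.
have GUp := ae_submp mp pS GU.
apply: (@le_trans _ _ (\int[mu]_(x in `]-oo, t[) (K%:E * ((U (psi x))%:E + M%:E)))%E).
  apply: ae_ge0_le_integral => //.
  - by move=> x _; rewrite lee_fin fine_rearr_ge0.
  - by apply: measurable_funTS; apply: measurable_efun; exact: measurable_fine_rearr.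
  - by move=> x _; rewrite mule_ge0 ?adde_ge0 ?lee_fin ?rank_cst_ge0.
  - apply: measurable_funTS; apply: measurable_funeM; apply: emeasurable_funD => //.
    exact: measurable_efun.
  apply: ae_imp (ae_and Gp GUp) => x [G1 G2] _; rewrite -EFinD -EFinM lee_fin.
  by apply: (le_trans G1); rewrite ler_wpM2l ?rank_cst_ge0.
rewrite ge0_integralZl//; last 3 first.
- apply: measurable_funTS; apply: emeasurable_funD => //; exact: measurable_efun.
- by move=> x _; rewrite adde_ge0 ?lee_fin.
- by rewrite lee_fin rank_cst_ge0.
apply: lee_wpmul2l; first by rewrite lee_fin rank_cst_ge0.
rewrite ge0_integralD//; last 2 first.
- by move=> x _; rewrite lee_fin.
- by apply: measurable_funTS; exact: measurable_efun.
apply: leeD.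
  apply: (@le_trans _ _ (\int[mu]_x (U (psi x))%:E)%E).
    apply: ge0_subset_integral => //; first exact: measurable_efun.
    by move=> x _; rewrite lee_fin.
  by apply: (pS (fun x => (U x)%:E)) => //; exact: measurable_efun.
by rewrite integral_cst// [X in (_ * X)%E]halfline_Ny_itv ?(ltW t0)// -EFinM mulrC.
Qed.

Lemma integral_rearr_le G : measurable_fun setT G -> rearr_fin G ->
  (\int[mu]_x (rearr G x)%:E <= (3 * K)%:E * Ipow 1 G)%E.
Proof.
move=> mG fG; have [psi [mp pS Gp]] := ranking_inverse mG fG.
rewrite Ipow1.
apply: (@le_trans _ _ (\int[mu]_x (K%:E * `|G (psi x)|%:E))%E).
  apply: ae_ge0_le_integral => //.
  - by move=> x _; rewrite lee_fin fine_rearr_ge0.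
  - by apply: measurable_efun; exact: measurable_fine_rearr.
  - by move=> x _; rewrite mule_ge0 ?lee_fin ?rank_cst_ge0.
  - by apply: measurable_funeM; apply: measurable_enorm; exact: measurableT_comp.
  by apply: ae_imp Gp => x G1 _; rewrite -EFinM lee_fin.
rewrite ge0_integralZl//; last 2 first.
- by apply: measurable_enorm; exact: measurableT_comp.
- by rewrite lee_fin rank_cst_ge0.
rewrite [in leRHS]mulrC EFinM -muleA; apply: lee_wpmul2l; first by rewrite lee_fin rank_cst_ge0.
by apply: (pS (fun x => `|G x|%:E)) => //; exact: measurable_enorm.
Qed.

(** With [integral_rearr_le], this replaces the equality of the integrals of |F| and F* by two
    inequalities, one from each ranking map. *)
Lemma Ipow1_le_rearr F : measurable_fun setT F -> rearr_fin F ->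
  (Ipow 1 F <= (3 * K)%:E * \int[mu]_x (rearr F x)%:E)%E.
Proof.
move=> mF fF; have [sigma [ms sS Fs]] := ranking mF fF.
have mr := measurable_fine_rearr F; have mrs : measurable_fun setT (fun x => rearr F (sigma x)).
  exact: measurableT_comp.
rewrite Ipow1.
apply: (@le_trans _ _ (\int[mu]_x (K%:E * (rearr F (sigma x))%:E))%E).
  apply: ae_ge0_le_integral => //.
  - exact: measurable_enorm.
  - by move=> x _; rewrite mule_ge0 ?lee_fin ?rank_cst_ge0 ?fine_rearr_ge0.
  - by apply: measurable_funeM; exact: measurable_efun.
  by apply: ae_imp Fs => x [_ G1] _; rewrite -EFinM lee_fin.
rewrite ge0_integralZl; last 4 first.
- exact: measurableT.
- exact: measurable_efun.
- by move=> x _; rewrite lee_fin fine_rearr_ge0.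
- by rewrite lee_fin rank_cst_ge0.
rewrite [in leRHS]mulrC EFinM -muleA; apply: lee_wpmul2l; first by rewrite lee_fin rank_cst_ge0.
apply: (sS (fun x => (rearr F x)%:E)); last exact: measurable_efun.
by move=> x; rewrite lee_fin fine_rearr_ge0.
Qed.

Lemma rearr_eq0 F t s : measurable_fun setT F -> rearr_fin F -> 0 < t ->
  (dfun F 0 <= t%:E)%E -> t <= s -> rearr F s = 0.
Proof.
move=> mF fF t0 dt ts; apply/eqP; rewrite eq_le fine_rearr_ge0 andbT.
rewrite fine_rearr_le//; last exact: lt_le_trans ts.
by apply: le_trans dt _; rewrite lee_fin.
Qed.

(** Cut at F*(t), the big part is supported on a set of measure at most t, so its rearrangement
    vanishes beyond t and is at most F* before. *)
Lemma big_part_ub F t : measurable_fun setT F -> rearr_fin F -> 0 < t ->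
  (Ipow 1 (big_part (rearr F t) F) <=
   (3 * K)%:E * \int[leb]_(x in `]0%R, t[) rearrangement F x)%E.
Proof.
move=> mF fF t0; set l := rearr F t; set B := big_part l F.
have mB : measurable_fun setT B by exact: measurable_big_part.
have BF : {ae mu, forall x, `|B x| <= `|F x|}.
  by apply: aeW => x; rewrite /B /big_part; case: ifP => //; rewrite normr0.
have fB := rearr_fin_le mB mF BF fF.
apply: le_trans (Ipow1_le_rearr mB fB) _.
apply: lee_wpmul2l; first by rewrite lee_fin mulr_ge0 ?rank_cst_ge0.
rewrite (integral_head_fin t fF) [leRHS]integral_mkcond.
have mr := @measurable_erearr.
apply: ae_ge0_le_integral => //.
- by move=> x _; rewrite lee_fin fine_rearr_ge0.
- exact: mr.
- by move=> x _; apply: erestrict_ge0 => y _; rewrite lee_fin fine_rearr_ge0.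
- exact: measurable_restrict_itv.
apply: ae_imp (halfline_gt0 R) => x x0 _; rewrite /patch.
case: ifPn; rewrite ?inE ?notin_setE /= in_itv/=.
  by move=> _; rewrite lee_fin; exact: rearr_mono.
move=> /negP; rewrite -leNgt => tx.
rewrite lee_fin (@rearr_eq0 _ t)//.
have := lexx l; rewrite {1}/l fine_rearr_le// ?fine_rearr_ge0//; apply: le_trans.
apply: le_measure; rewrite ?inE; [exact: measurable_gt|exact: measurable_gt|].
by move=> y /=; rewrite /B /big_part; case: ifPn => //; rewrite normr0 ltxx.
Qed.

(** The rearrangement of the small part is bounded by F*(t) up to t, by F* beyond. *)
Lemma small_part_ub F t : measurable_fun setT F -> rearr_fin F -> 0 < t ->
  (Ipow 1 (small_part (rearr F t) F) <=
   (3 * K)%:E * ((t * rearr F t)%:E + \int[leb]_(x in `]t, +oo[) rearrangement F x))%E.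
Proof.
move=> mF fF t0; set l := rearr F t; set B := small_part l F.
have l0 : 0 <= l by exact: fine_rearr_ge0.
have mB : measurable_fun setT B by exact: measurable_small_part.
have BF : {ae mu, forall x, `|B x| <= `|F x|}.
  by apply: aeW => x; rewrite /B /small_part; case: ifP => //; rewrite normr0.
have fB := rearr_fin_le mB mF BF fF.
apply: le_trans (Ipow1_le_rearr mB fB) _.
apply: lee_wpmul2l; first by rewrite lee_fin mulr_ge0 ?rank_cst_ge0.
rewrite (integral_tail_fin fF (ltW t0)).
have -> : ((t * l)%:E = \int[mu]_(x in `]-oo, t]) l%:E)%E.
  by rewrite integral_cst// [X in (_ * X)%E]halfline_Ny_itv ?(ltW t0)// -EFinM mulrC.
rewrite [X in (X + _)%E]integral_mkcond [X in (_ + X)%E]integral_mkcond.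
have mr := @measurable_erearr.
have p1 x : (0 <= ((fun=> l%:E) \_ `]-oo, t]) x)%E.
  by apply: erestrict_ge0 => y _; rewrite lee_fin.
have p2 x : (0 <= ((fun x => (rearr F x)%:E) \_ `]t, +oo[) x)%E.
  by apply: erestrict_ge0 => y _; rewrite lee_fin fine_rearr_ge0.
rewrite -ge0_integralD//; last 2 first.
- exact: measurable_restrict_itv.
- exact: measurable_restrict_itv.
apply: ae_ge0_le_integral => //.
- by move=> x _; rewrite lee_fin fine_rearr_ge0.
- exact: mr.
- by move=> x _; rewrite adde_ge0.
- by apply: emeasurable_funD; exact: measurable_restrict_itv.
apply: ae_imp (halfline_gt0 R) => x x0 _; have [xt|tx] := leP x t.
  apply: (@le_trans _ _ l%:E).
    rewrite lee_fin fine_rearr_le// (_ : [set _ | _] = set0) ?measure0 ?lee_fin ?ltW//.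
    apply/seteqP; split => y //=; rewrite /B /small_part.
    case: ifPn => lF; rewrite ?normr0; first by rewrite ltNge l0.
    by rewrite (negbTE lF).
  apply: (@le_trans _ _ (((fun=> l%:E) \_ `]-oo, t]) x + 0)%E); last exact: leeD2l.
  by rewrite adde0 /patch mem_set//= in_itv.
apply: (@le_trans _ _ (0 + ((fun x => (rearr F x)%:E) \_ `]t, +oo[) x)%E); last exact: leeD2r.
by rewrite add0e /patch mem_set ?lee_fin ?rearr_mono//= in_itv/= tx.
Qed.

(** Let H be G set to 0 on Z. For x > 2 t one has G*(x) <= H*(x / 2), because removing Z costs at
    most t <= x / 2. This is the origin of the dilation in all tail estimates; 6 is 2 for the
    dilation times 3. *)
Lemma rearr_tail_ub G U (Z : set R) t : measurable_fun setT G -> measurable_fun setT U ->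
  measurable Z -> rearr_fin G -> (forall x, 0 <= U x) -> 0 < t -> (mu Z <= t%:E)%E ->
  {ae mu, forall x, ~ Z x -> `|G x| <= U x} ->
  (\int[leb]_(x in `](2 * t)%R, +oo[) rearrangement G x <=
   (6 * K)%:E * \int[mu]_x (U x)%:E)%E.
Proof.
move=> mG mU mZ fG U0 t0 Zt GU.
pose H x := if x \in Z then cst 0 x else G x.
have mH : measurable_fun setT H by apply: measurable_if_in => //; exact: measurable_funTS.
have HG : {ae mu, forall x, `|H x| <= `|G x|}.
  by apply: aeW => x; rewrite /H; case: ifP => //=; rewrite normr0.
have fH := rearr_fin_le mH mG HG fG.
have t20 : 0 < 2 * t by rewrite mulr_gt0.
rewrite integral_tail_fin ?(ltW t20)// integral_mkcond.
have mr := @measurable_erearr.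
have mrh : measurable_fun setT (fun x : R => (rearr H (2^-1 * x))%:E).
  by apply: measurable_efun; apply: (measurableT_comp (measurable_fine_rearr H)); exact: mulrl_measurable.
apply: (@le_trans _ _ (\int[mu]_x (rearr H (2^-1 * x))%:E)%E).
  apply: ae_ge0_le_integral => //.
  - by move=> x _; apply: erestrict_ge0 => y _; rewrite lee_fin fine_rearr_ge0.
  - exact: measurable_restrict_itv.
  - by move=> x _; rewrite lee_fin fine_rearr_ge0.
  apply: ae_imp (halfline_gt0 R) => x x0 _; rewrite /patch; case: ifPn => [|_]; last first.
    by rewrite lee_fin fine_rearr_ge0.
  rewrite inE /= in_itv/= andbT => tx; have x20 : 0 < 2^-1 * x by rewrite mulr_gt0.
  rewrite lee_fin fine_rearr_le// ?fine_rearr_ge0//.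
  have := lexx (rearr H (2^-1 * x)); rewrite fine_rearr_le// ?fine_rearr_ge0// => dH.
  set v := rearr H (2^-1 * x) in dH *.
  apply: (@le_trans _ _ (mu ([set x | v < `|H x|] `|` Z))).
    apply: le_measure; rewrite ?inE; [exact: measurable_gt|apply: measurableU => //; exact: measurable_gt|].
    move=> y /= vG; case: (boolP (y \in Z)) => yZ; first by right; rewrite inE in yZ.
    by left; rewrite /H (negbTE yZ).
  apply: le_trans (measureU2 _ _ _) _ => //; first exact: measurable_gt.
  by apply: (le_trans (leeD dH Zt)); rewrite -EFinD lee_fin; lra.
apply: le_trans (integral_scale (c := 2^-1) _ _ (mr H)) _ => //.
  by move=> x; rewrite lee_fin fine_rearr_ge0.
rewrite invrK (_ : 6 * K = 2 * (3 * K)); last by ring.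
rewrite EFinM -muleA; apply: lee_wpmul2l => //.
apply: le_trans (integral_rearr_le mH fH) _.
apply: lee_wpmul2l; first by rewrite lee_fin mulr_ge0 ?rank_cst_ge0.
rewrite Ipow1; apply: ae_ge0_le_integral => //.
- exact: measurable_enorm.
- by move=> x _; rewrite lee_fin.
- exact: measurable_efun.
apply: ae_imp GU => x GUx _; rewrite lee_fin /H; case: ifPn; rewrite ?notin_setE ?normr0//.
Qed.

End rearrangement_bounds.

(** * Necessity of the majorization criteria *)

Section majorization.
Context (R : realType).
Local Notation leb := (@lebesgue_measure R).
Local Notation mu := (halfline_measure R).
Local Notation dfun f s := (mu [set x | (s < `|f x|)%R]).
Implicit Types (h : R -> \bar R) (f g F G U A Phi : R -> R) (p q C l : R).

Lemma dfun_abs_pow p l f : 0 < p -> 0 <= l ->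
  dfun (abs_pow p f) (l `^ p) = dfun f l.
Proof.
move=> p0 l0; congr (mu _); apply/seteqP; split => x /=;
    rewrite (ger0_norm (abs_pow_ge0 p f x)) /abs_pow.
  by rewrite !ltNge; apply: contra; apply: ge0_ler_powR; rewrite ?nnegrE// ltW.
by apply: gt0_ltr_powR; rewrite ?nnegrE.
Qed.

Lemma rearr_finP F : measurable_fun setT F ->
  (forall t : R, 0 < t -> exists2 s : R, 0 <= s & (dfun F s <= t%:E)%E) -> rearr_fin F.
Proof.
move=> mF H t t0; have [s s0 Fs] := H _ t0.
by apply: (@le_lt_trans _ _ s%:E); rewrite ?ltry// rearr_le.
Qed.

Lemma sum_L1LooP F : sum_space (L 1%:E) (L +oo%E) F ->
  [/\ measurable_fun setT F, rearr_fin F &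
      forall t : R, 0 < t -> (\int[leb]_(x in `]0%R, t[) rearrangement F x < +oo)%E].
Proof.
move=> /(sum_LpLooP _ (@ltr01 R))[mF [l l0 Fl]].
have mB : measurable_fun setT (big_part l F) by exact: measurable_big_part.
have fF : rearr_fin F.
  apply: rearr_finP => // t t0.
  have [i Ei] : exists i, Ipow 1 (big_part l F) = i%:E.
    by exists (fine (Ipow 1 (big_part l F))); rewrite fineK// ge0_fin_numE// Ipow_ge0.
  have i0 : 0 <= i by rewrite -lee_fin -Ei Ipow_ge0.
  have it0 : 0 <= i / t by rewrite divr_ge0// ltW.
  have s0 : 0 < l + 1 + i / t by lra.
  (* By Chebyshev the superlevel set at s has measure at most i / s, and s t >= i; the summand l + 1
     keeps s positive and above the truncation level. *)
  exists (l + 1 + i / t); first exact: ltW.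
  set s := _ + _ in s0 *.
  have := Ipow_chebyshev (@ler01 R) (ltW s0) mB; rewrite powRr1 ?(ltW s0)// Ei => ch.
  apply: (@le_trans _ _ (dfun (big_part l F) s)).
    apply: le_measure; rewrite ?inE; [exact: measurable_gt|exact: measurable_gt|].
    move=> x /= sF; rewrite /big_part (_ : l < `|F x|)//.
    by apply: lt_trans sF; rewrite /s; lra.
  rewrite leNgt; apply/negP => td.
  have : (s%:E * t%:E < i%:E)%E by apply: lt_le_trans ch; rewrite lte_pmul2l.
  rewrite -EFinM lte_fin ltNge /s mulrDl divfK ?gt_eqF// lerDr mulr_ge0//; last exact: ltW.
  exact: addr_ge0.
split => // t t0.
apply: (@le_lt_trans _ _ ((rank_cst R)%:E * (3%:E * \int[mu]_x `|big_part l F x|%:E + (t * l)%:E))%E).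
  apply: (rearr_head_ub (U := fun x => `|big_part l F x|)) => //.
    exact: measurableT_comp.
  apply: aeW => x; rewrite /big_part; case: ifPn; first by rewrite lerDl.
  by rewrite -leNgt normr0 add0r.
by rewrite lte_mul_pinfty ?lee_fin ?rank_cst_ge0// lte_add_pinfty ?ltry//
  lte_mul_pinfty// -Ipow1.
Qed.

(** The superlevel sets at levels l + n start with finite measure and decrease to the empty set, so
    F* is finite. The tail integral is bounded by cutting F at F*(t / 2). *)
Lemma sum_L0L1P F : sum_space L0 (L 1%:E) F ->
  [/\ measurable_fun setT F, rearr_fin F &
      forall t : R, 0 < t -> (\int[leb]_(x in `]t, +oo[) rearrangement F x < +oo)%E].
Proof.
move=> /(sum_L0LqP _ (@ltr01 R))[mF [l [l0 dl Fl]]].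
have mS l' : measurable_fun setT (small_part l' F) by exact: measurable_small_part.
have fF : rearr_fin F.
  apply: rearr_finP => // t t0; apply: contrapT => H.
  have : (t%:E <= mu set0)%E; last by rewrite measure0 lee_fin leNgt t0.
  apply: (@measure_bigcap_sub_ge _ _ _ mu (fun n => [set x | l + n%:R < `|F x|])) => //.
  - by move=> n; exact: measurable_gt.
  - move=> m n mn; apply/subsetPset => x /=; apply: le_lt_trans.
    by rewrite lerD2l ler_nat.
  - move=> x /(_ (Num.truncn `|F x|).+1 I) /=; have := truncnS_gt `|F x|.
    by set u := _%:R => ? ?; lra.
  - by rewrite addr0.
  move=> n; rewrite leNgt; apply/negP => tn; apply: H; exists (l + n%:R); last exact: ltW.
  by rewrite addr_ge0.
split => // t t0.
have t20 : 0 < t / 2 by rewrite divr_gt0.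
set lam := rearr F (t / 2); have lam0 : 0 <= lam by exact: fine_rearr_ge0.
have mD := measurable_gt l mF.
apply: (@le_lt_trans _ _ ((6 * rank_cst R)%:E * \int[mu]_x `|small_part lam F x|%:E)%E).
  rewrite (_ : t = 2 * (t / 2)); last by lra.
  apply: (rearr_tail_ub (U := fun x => `|small_part lam F x|) (Z := [set x | lam < `|F x|])) => //.
  - exact: measurableT_comp.
  - exact: measurable_gt.
  - by rewrite -fine_rearr_le.
  by apply: aeW => x /= /negP; rewrite /small_part => /negbTE ->.
rewrite lte_mul_pinfty ?lee_fin ?mulr_ge0 ?rank_cst_ge0//.
apply: (@le_lt_trans _ _ (\int[mu]_x (`|small_part l F x|%:E +
    lam%:E * (\1_[set x | l < `|F x|] x)%:E))%E).
  apply: ge0_le_integral => //.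
  - exact: measurable_enorm.
  - apply: emeasurable_funD; first exact: measurable_enorm.
    by apply: measurable_funeM; apply: measurable_efun; exact: measurable_indic.
  move=> x _; rewrite -EFinM -EFinD lee_fin /small_part indicE.
  have -> : (x \in [set x | l < `|F x|]) = (l < `|F x|) by apply/idP/idP; rewrite inE.
  case: (ltP lam `|F x|) => h1; case: (ltP l `|F x|) => h2; rewrite ?normr0 ?mulr1 ?mulr0; lra.
rewrite ge0_integralD//; last 3 first.
- exact: measurable_enorm.
- by move=> x _; rewrite mule_ge0.
- by apply: measurable_funeM; apply: measurable_efun; exact: measurable_indic.
rewrite -Ipow1 ge0_integralZl//; last first.
  by apply: measurable_efun; exact: measurable_indic.
by rewrite integral_indic// setIT lte_add_pinfty// lte_mul_pinfty.
Qed.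

Lemma sum_LpLoo_pow p f : 0 < p -> measurable_fun setT f ->
  sum_space (L p%:E) (L +oo%E) f <-> sum_space (L 1%:E) (L +oo%E) (abs_pow p f).
Proof.
move=> p0 mf; have mp := measurable_abs_pow p mf; split.
  move=> /(sum_LpLooP _ p0)[_ [l l0 fl]]; apply/(sum_LpLooP _ (@ltr01 R)); split => //.
  exists (l `^ p); first exact: powR_ge0.
  by rewrite -(abs_pow_big f p0 l0) Ipow1_abs_pow.
move=> /(sum_LpLooP _ (@ltr01 R))[_ [l l0]].
rewrite -(powR_root p0 l0) -(abs_pow_big f p0 (powR_ge0 _ _)) Ipow1_abs_pow => fl.
by apply/(sum_LpLooP _ p0); split => //; exists (l `^ p^-1); rewrite ?powR_ge0.
Qed.

Lemma sum_L0Lq_pow q f : 0 < q -> measurable_fun setT f ->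
  sum_space L0 (L q%:E) f <-> sum_space L0 (L 1%:E) (abs_pow q f).
Proof.
move=> q0 mf; have mp := measurable_abs_pow q mf; split.
  move=> /(sum_L0LqP _ q0)[_ [l [l0 dl fl]]]; apply/(sum_L0LqP _ (@ltr01 R)); split => //.
  exists (l `^ q); split; first exact: powR_ge0.
    by rewrite dfun_abs_pow.
  by rewrite -(abs_pow_small f q0 l0) Ipow1_abs_pow.
move=> /(sum_L0LqP _ (@ltr01 R))[_ [l [l0]]].
rewrite -(powR_root q0 l0) (dfun_abs_pow f q0 (powR_ge0 _ _)).
rewrite -(abs_pow_small f q0 (powR_ge0 _ _)) Ipow1_abs_pow => dl fl.
by apply/(sum_L0LqP _ q0); split => //; exists (l `^ q^-1); split; rewrite ?powR_ge0.
Qed.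

(** Used to make [Phi] nonnegative everywhere, as the classes being glued require; almost every
    point is positive, so integrals do not change. *)
Lemma dom_norm (w Phi : R -> R) C : dom w Phi C -> dom w (fun x => `|Phi x|) C.
Proof.
move=> wP h h0 mh; rewrite -(integral_norm h0 mh).
by apply: (wP (fun x => h `|x|)) => //; exact: measurableT_comp.
Qed.

Lemma bound_norm F G A Phi C k : (forall x, 0 <= A x) -> measurable_fun setT A ->
  measurable_fun setT Phi -> dom A Phi C ->
  {ae mu, forall x, `|G x| <= k * (A x * `|F (Phi x)|)} ->
  {ae mu, forall x, `|G x| <= k * (A x * `|F `|Phi x| |)}.
Proof.
move=> A0 mA mP AP GF.
apply: ae_imp (ae_and GF (ae_dom A0 mA mP AP (halfline_gt0 R))) => x [GFx Px].
apply: (le_trans GFx); have [->|/Px P0] := eqVneq (A x) 0; first by rewrite !mul0r.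
by rewrite (gtr0_norm P0).
Qed.

Lemma head_majorized_op G F : head_majorized G F ->
  exists A Phi, head_class 36 A Phi /\
    {ae mu, forall x, `|G x| <= rank_cst R ^+ 2 * (A x * `|F (Phi x)|)}.
Proof.
move=> [/sum_L1LooP[mG fG _] /sum_L1LooP[mF fF Ffin] GF].
have [A [Phi [[mA mP A0 AC AP] GA]]] := head_operator mF mG fF fG Ffin GF.
exists A, (fun x => `|Phi x|); split; last exact: bound_norm AP GA.
split=> [|x]; last exact: normr_ge0.
by split; [exact: mA|exact: measurableT_comp|exact: A0|exact: AC|exact: dom_norm].
Qed.

Lemma tail_majorized_op G F : tail_majorized G F ->
  exists A Phi, tail_class 18 A Phi /\
    {ae mu, forall x, `|G x| <= rank_cst R ^+ 2 * (A x * `|F (Phi x)|)}.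
Proof.
move=> [/sum_L0L1P[mG fG _] /sum_L0L1P[mF fF Ffin] GF].
have [A [Phi [[mA mP A0 AC AP] GA]]] := tail_operator mF mG fF fG Ffin GF.
exists A, (fun x => `|Phi x|); split; last exact: bound_norm AC GA.
split=> [|x]; last exact: normr_ge0.
by split; [exact: mA|exact: measurableT_comp|exact: A0|exact: dom_norm|exact: dom_norm].
Qed.

Section necessity.
Variables (E : fspace R) (hE : quasi_Banach_function_space E).

Lemma qB_scale (a : R) f : E f -> E (fun x => a * f x).
Proof.
move=> Ef; have := qB_linear hE a Ef (qB_zero hE).
by congr (carrier E _); apply/funext => x; rewrite addr0.
Qed.

Lemma qB_dominated f g (a : R) : 0 <= a -> E f -> measurable_fun setT g ->
  {ae mu, forall x, `|g x| <= a * `|f x|} -> E g /\ qnorm E g <= a * qnorm E f.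
Proof.
move=> a0 Ef mg gf; rewrite -[a in leRHS]ger0_norm// -(qB_homogeneous hE)//.
apply: (qB_ideal hE) => //; first exact: qB_scale.
by apply: ae_imp gf => x; rewrite normrM (ger0_norm a0).
Qed.

(** Common to both couples: roots of order p turn the bound on |g|^p into |g| <= k
    |[wop p A Phi f]|, and [uniform_bound] makes the norm of that operator on E depend on the class
    only. *)
Lemma wop_criterion p (P : R -> (R -> R) -> (R -> R) -> Prop) C : 0 < p ->
  (forall C A Phi, P C A Phi -> [/\ measurable_fun setT A, measurable_fun setT Phi,
     forall x, 0 <= A x & forall x, 0 <= Phi x]) ->
  (forall A Phi : nat -> R -> R, (forall n, P C (A n) (Phi n)) -> P C (glue A) (gluemap Phi)) ->
  (forall n, P 1 (\1_(copy n)) (fun x : R => `|rho x|)) ->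
  (forall n, P 1 (cst 1) (fun x : R => theta n `|x|)) ->
  (forall C A Phi, P C A Phi -> bounded_on E (wop p A Phi)) ->
  exists2 c, 0 < c & forall f g, E f -> measurable_fun setT g ->
    (exists A Phi, P C A Phi /\ {ae mu, forall x,
       `|abs_pow p g x| <= rank_cst R ^+ 2 * (A x * `|abs_pow p f (Phi x)|)}) ->
    E g /\ qnorm E g <= c * qnorm E f.
Proof.
move=> p0 Pm Pg Pr Pt Pb; have [c c0 cP] := uniform_bound hE p0 Pm Pg Pr Pt Pb.
pose k := (rank_cst R ^+ 2) `^ p^-1; have k0 : 0 < k by rewrite powR_gt0 ?exprn_gt0 ?rank_cst_gt0.
exists (k * c); first exact: mulr_gt0.
move=> f g Ef mg [A [Phi [PA gA]]]; have [EA Ac] := cP _ _ _ PA Ef.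
have [mA mPhi A0 _] := Pm _ _ _ PA.
have [] := @qB_dominated (wop p A Phi f) g k (ltW k0) EA mg; last first.
  by move=> Eg gc; split => //; apply: (le_trans gc); rewrite -mulrA ler_wpM2l// ltW.
apply: ae_imp gA => x; rewrite (ger0_norm (abs_pow_ge0 p g x)) (ger0_norm (abs_pow_ge0 p f (Phi x))) /abs_pow /wop => gx.
have pi0 : 0 <= p^-1 by rewrite invr_ge0 ltW.
have H (y : R) : 0 <= y -> (y `^ p) `^ p^-1 = y.
  by move=> y0; rewrite -powRrM mulfV ?gt_eqF// powRr1.
rewrite -[leLHS](H _ (normr_ge0 _)) normrM (ger0_norm (powR_ge0 _ _)).
rewrite -[X in _ * (_ * X)](H _ (normr_ge0 _)) /k.
rewrite -powRM ?powR_ge0// -powRM ?mulr_ge0 ?powR_ge0 ?exprn_ge0 ?rank_cst_ge0//.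
by apply: ge0_ler_powR; rewrite ?nnegrE ?mulr_ge0 ?powR_ge0 ?exprn_ge0 ?rank_cst_ge0.
Qed.

Lemma interpolation_head p : 0 < p -> interpolation_space (L p%:E) (L +oo%E) E ->
  exists2 c : R, 0 < c & forall f g : R -> R,
    E f -> sum_space (L p%:E) (L +oo%E) g ->
    head_majorized (abs_pow p g) (abs_pow p f) -> E g /\ qnorm E g <= c * qnorm E f.
Proof.
move=> p0 [_ _ EI].
have [|||||c c0 cP] := @wop_criterion p (@head_class R) 36 p0.
- by move=> C A Phi [[]].
- by move=> A Phi; exact: glue_head.
- exact: head_rho.
- exact: head_theta.
- by move=> C A Phi [AP _]; apply: EI; exact: head_op_bounded AP.
exists c => // f g Ef /(sum_LpLooP _ p0)[mg _] /head_majorized_op; exact: cP.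
Qed.

Lemma interpolation_tail q : 0 < q -> interpolation_space L0 (L q%:E) E ->
  exists2 c : R, 0 < c & forall f g : R -> R,
    E f -> sum_space L0 (L q%:E) g ->
    tail_majorized (abs_pow q g) (abs_pow q f) -> E g /\ qnorm E g <= c * qnorm E f.
Proof.
move=> q0 [_ _ EI].
(* The sign of the constant is part of the class: [head_op] implies it through 0 <= A <= C, whereas
   [tail_op] has no such bound. *)
have [|||||c c0 cP] := @wop_criterion q (fun C A Phi => 0 <= C /\ tail_class C A Phi) 18 q0.
- by move=> C A Phi [_ [[]]].
- by move=> A Phi H; split => //; apply: glue_tail => // n; have [] := H n.
- by move=> n; split => //; exact: tail_rho.
- by move=> n; split => //; exact: tail_theta.
- by move=> C A Phi [C0 [AP _]]; apply: EI; exact: tail_op_bounded AP.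
exists c => // f g Ef /(sum_L0LqP _ q0)[mg _] /tail_majorized_op[A [Phi [AP gA]]].
by apply: cP => //; exists A, Phi.
Qed.

End necessity.
End majorization.

(** * Sufficiency for the couple (L_p, L_oo) *)

Section truncation.
Context (R : realType).
Local Notation leb := (@lebesgue_measure R).
Local Notation mu := (halfline_measure R).
Local Notation dfun f s := (mu [set x | (s < `|f x|)%R]).
Implicit Types (f g F G U : R -> R) (p q c C l M t : R) (n : nat).

Lemma integral_rearr_subset F (A B : set R) : measurable A -> measurable B -> A `<=` B ->
  (\int[leb]_(x in A) rearrangement F x <= \int[leb]_(x in B) rearrangement F x)%E.
Proof.
move=> mA mB AB; apply: ge0_subset_integral => //.
- by apply: measurable_funTS; exact: measurable_rearr.
- by move=> x _; exact: rearr_ge0.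
Qed.

Lemma rearr_scale_ge F c t : 0 < c ->
  (c%:E * rearrangement F t <= rearrangement (fun x => c * F x)%R t)%E.
Proof.
move=> c0; apply: le_ereal_inf_tmp => _ [s [s0 Fs] <-].
rewrite -(@lee_pdivlMl _ c)// -EFinM; apply: ereal_inf_lbound; exists (c^-1 * s) => //; split.
  by rewrite mulr_ge0 ?invr_ge0// ltW.
apply: le_trans Fs; rewrite (_ : [set x | _] = [set x | s < `|c * F x|])//.
by apply/seteqP; split => x /=; rewrite normrM (gtr0_norm c0) ltr_pdivrMl.
Qed.

Lemma rearr_scale F c t : 0 < c ->
  (rearrangement (fun x => c * F x)%R t = c%:E * rearrangement F t)%E.
Proof.
move=> c0; apply/eqP; rewrite eq_le rearr_scale_ge// andbT -lee_pdivrMl//.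
have ci0 : 0 < c^-1 by rewrite invr_gt0.
apply: le_trans (rearr_scale_ge _ t ci0) _.
by under eq_fun do rewrite mulKf ?gt_eqF//.
Qed.

Lemma integral_rearr_scale F c (D : set R) : 0 < c -> measurable D ->
  (\int[leb]_(x in D) rearrangement (fun x => c * F x)%R x =
   c%:E * \int[leb]_(x in D) rearrangement F x)%E.
Proof.
move=> c0 mD; rewrite -ge0_integralZl//.
- by apply: eq_integral => x _; rewrite rearr_scale.
- by apply: measurable_funTS; exact: measurable_rearr.
- by move=> x _; exact: rearr_ge0.
- by rewrite lee_fin ltW.
Qed.

(** Concavity of the primitive of F*: monotonicity gives F*(x) <= F*((t / u) x), and a change of
    scale concludes. *)
Lemma rearr_head_concave F t u : 0 < t -> t <= u ->
  (t%:E * \int[leb]_(x in `]0%R, u[) rearrangement F x <=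
   u%:E * \int[leb]_(x in `]0%R, t[) rearrangement F x)%E.
Proof.
move=> t0 tu; have u0 := lt_le_trans t0 tu; have c0 : 0 < t / u by rewrite divr_gt0.
have r0 := rearr_ge0 F; have mr := measurable_rearr F.
rewrite (halfline_head t r0 mr) (halfline_head u r0 mr).
rewrite -lee_pdivlMl// muleA -EFinM [(t^-1 * u)%R]mulrC -invf_div.
rewrite integral_mkcond [X in (_ <= _ * X)%E]integral_mkcond.
apply: le_trans (integral_scale c0 _ _); last 2 first.
- by move=> x; apply: erestrict_ge0.
- exact: measurable_restrict_itv.
apply: ae_ge0_le_integral => //.
- by move=> x _; apply: erestrict_ge0.
- exact: measurable_restrict_itv.
- by move=> x _; apply: erestrict_ge0.
- by apply: (measurableT_comp (measurable_restrict_itv _ mr)); exact: mulrl_measurable.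
apply: ae_imp (halfline_gt0 R) => x x0 _; rewrite /patch.
case: ifPn => [|_]; last by case: ifP.
rewrite inE /= in_itv/= => xu; rewrite mem_set/=; last first.
  by rewrite in_itv/= mulrAC ltr_pdivrMr// ltr_pM2l.
by apply: rearr_nincr; rewrite mulrAC ler_pdivrMr// [leRHS]mulrC ler_pM2r.
Qed.

Lemma abs_pow_scale p c f : 0 < p -> 0 <= c ->
  abs_pow p (fun x => c `^ p^-1 * f x) = (fun x => c * abs_pow p f x).
Proof.
move=> p0 c0; apply/funext => x.
by rewrite /abs_pow normrM powRM// (ger0_norm (powR_ge0 _ _)) powR_root.
Qed.

Lemma rearr_itv_lb F (a b : R) : 0 <= a -> a < b ->
  ((b - a)%:E * rearrangement F b <= \int[leb]_(x in `]a, b[) rearrangement F x)%E.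
Proof.
move=> a0 ab.
have -> : ((b - a)%:E = \int[leb]_(x in `]a, b[) cst 1 x)%E.
  rewrite integral_cst// mul1e.
  by transitivity (leb `]a, b[%classic) => //; rewrite lebesgue_measure_itv/= lte_fin ab.
rewrite -ge0_integralZr//; last exact: rearr_ge0.
apply: ge0_le_integral => //.
- by move=> x _; rewrite mul1e rearr_ge0.
- exact: (measurable_cst (1 * rearrangement F b)%E).
- by apply: measurable_funTS; exact: measurable_rearr.
by move=> x /=; rewrite in_itv/= => /andP[_ xb]; rewrite mul1e rearr_nincr// ltW.
Qed.

Lemma rearr_head_lb F t : 0 < t ->
  (t%:E * rearrangement F t <= \int[leb]_(x in `]0%R, t[) rearrangement F x)%E.
Proof. by move=> t0; have := rearr_itv_lb F (lexx 0) t0; rewrite subr0. Qed.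

Lemma rearr_tail_lb F t : 0 < t ->
  ((t / 2)%:E * rearrangement F t <= \int[leb]_(x in `](t / 2)%R, +oo[) rearrangement F x)%E.
Proof.
move=> t0; have t20 : t / 2 < t by lra.
apply: (@le_trans _ _ (\int[leb]_(x in `](t / 2)%R, t[) rearrangement F x)%E).
  by have := rearr_itv_lb F (ltW (divr_gt0 t0 (@ltr0n R 2))) t20; rewrite (_ : t - t / 2 = t / 2)//; lra.
apply: integral_rearr_subset => //.
- by move=> x /=; rewrite !in_itv/= andbT => /andP[].
Qed.

Lemma rearr_lty F c t : 0 < c -> (c%:E * rearrangement F t < +oo)%E ->
  (rearrangement F t < +oo)%E.
Proof.
by move=> c0; rewrite !ltey; apply: contra => /eqP ->; rewrite gt0_muley.
Qed.

(** Converse of [sum_L1LooP]: the finite integral bounds G* at positive points, and then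
    [big_part_ub] at t = 1 exhibits the decomposition. *)
Lemma sum_L1Loo_head G : measurable_fun setT G ->
  (\int[leb]_(x in `]0%R, 1%R[) rearrangement G x < +oo)%E ->
  sum_space (L 1%:E) (L +oo%E) G.
Proof.
move=> mG GI.
have fG : rearr_fin G.
  move=> t t0; apply: (@le_lt_trans _ _ (rearrangement G (Num.min t 1))).
    by apply: rearr_nincr; rewrite ge_min lexx.
  have u0 : 0 < Num.min t 1 by rewrite lt_min t0 ltr01.
  apply: (rearr_lty u0); apply: le_lt_trans GI; apply: le_trans (rearr_head_lb G u0) _.
  apply: integral_rearr_subset => //.
  by move=> x /=; rewrite !in_itv/= lt_min => /andP[-> /andP[_ ->]].
apply/(sum_LpLooP _ (@ltr01 R)); split=> //; exists (rearr G 1); first exact: fine_rearr_ge0.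
apply: le_lt_trans (big_part_ub mG fG (@ltr01 R)) _.
by rewrite lte_mul_pinfty ?lee_fin ?mulr_ge0 ?rank_cst_ge0.
Qed.

Lemma sum_L0L1_tail G : measurable_fun setT G ->
  (forall t, 0 < t -> (\int[leb]_(x in `]t, +oo[) rearrangement G x < +oo)%E) ->
  sum_space L0 (L 1%:E) G.
Proof.
move=> mG GI.
have fG : rearr_fin G.
  move=> t t0; have t20 : 0 < t / 2 by rewrite divr_gt0.
  by apply: (rearr_lty t20); apply: le_lt_trans (GI _ t20); exact: rearr_tail_lb.
apply/(sum_L0LqP _ (@ltr01 R)); split=> //; exists (rearr G 1); split.
- exact: fine_rearr_ge0.
- apply: (@le_lt_trans _ _ 1%:E); rewrite ?ltry//.
  by rewrite -fine_rearr_le// fine_rearr_ge0.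
apply: le_lt_trans (small_part_ub mG fG (@ltr01 R)) _.
by rewrite lte_mul_pinfty ?lee_fin ?mulr_ge0 ?rank_cst_ge0// lte_add_pinfty ?ltry ?GI.
Qed.

(** A Fatou property. It transfers bounds from truncations to elements of E that are not yet known
    to lie in the sum space. *)
Lemma integral_rearr_sup (Fn : nat -> R -> R) F (D : set R) (M : \bar R) : measurable D ->
  (forall n, measurable_fun setT (Fn n)) -> measurable_fun setT F ->
  (forall n x, `|Fn n x| <= `|Fn n.+1 x|) ->
  (forall x s, s < `|F x| -> exists n, s < `|Fn n x|) ->
  (forall n, (\int[leb]_(x in D) rearrangement (Fn n) x <= M)%E) ->
  (\int[leb]_(x in D) rearrangement F x <= M)%E.
Proof.
move=> mD mFn mF Fnd Fsup FM.
have nd x : nondecreasing_seq (fun n => rearrangement (Fn n) x).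
  by apply/nondecreasing_seqP => n; apply: rearr_ae_mono => //; apply: aeW => y; exact: Fnd.
have cvF x := ereal_nondecreasing_cvgn (nd x).
apply: (@le_trans _ _ (\int[leb]_(x in D) limn (fun n => rearrangement (Fn n) x))%E).
  apply: ge0_le_integral => //.
  - by move=> x _; exact: rearr_ge0.
  - by apply: measurable_funTS; exact: measurable_rearr.
  - apply: (emeasurable_fun_cvg (fun n => rearrangement (Fn n))).
      by move=> n; apply: measurable_funTS; exact: measurable_rearr.
    by move=> x _; apply/cvg_ex; eexists; exact: cvF.
  move=> x _; rewrite (cvg_lim _ (cvF x))//.
  set S := ereal_sup _; have Sn n : (rearrangement (Fn n) x <= S)%E.
    by apply: ereal_sup_ubound; exists n.
  case: S Sn => [v| |] Sn; first last.
  - by have := le_trans (rearr_ge0 (Fn 0%N) x) (Sn 0%N).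
  - by rewrite leey.
  have v0 : 0 <= v by rewrite -lee_fin; apply: le_trans (Sn 0%N); exact: rearr_ge0.
  rewrite rearr_le//.
  apply: (@measure_sub_bigcup_le _ _ _ mu (fun n => [set y | v < `|Fn n y|])).
  - by move=> n; exact: measurable_gt.
  - exact: measurable_gt.
  - by apply/nondecreasing_seqP => n; apply/subsetPset => y /= /lt_le_trans; apply.
  - by move=> y /= /Fsup[n]; exists n.
  by move=> n; rewrite -rearr_le.
rewrite monotone_convergence//; last 2 first.
- by move=> n; apply: measurable_funTS; exact: measurable_rearr.
- by move=> n x _; exact: rearr_ge0.
apply: lime_le; last by apply: nearW.
apply: ereal_nondecreasing_is_cvgn => m n mn; apply: ge0_le_integral => //.
- by move=> x _; exact: rearr_ge0.
- by apply: measurable_funTS; exact: measurable_rearr.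
- by apply: measurable_funTS; exact: measurable_rearr.
by move=> x _; exact: nd.
Qed.

(** Cutting height and position together puts [trunc n f] into every space involved, while it stays
    below [|f|] and increases to it. *)
Definition trunc n f x : R := if x < n%:R then Num.min `|f x| n%:R else 0.

Lemma measurable_trunc n f : measurable_fun setT f -> measurable_fun setT (trunc n f).
Proof.
move=> mf; apply: measurable_fun_ifT => //.
  by apply: measurable_fun_ltr => //; exact: measurable_id.
by apply: measurable_minr => //; exact: measurableT_comp.
Qed.

Lemma trunc_ge0 n f x : 0 <= trunc n f x.
Proof. by rewrite /trunc; case: ifP => // _; rewrite le_min normr_ge0 ler0n. Qed.

Lemma trunc_le n f x : `|trunc n f x| <= `|f x|.
Proof.
by rewrite (ger0_norm (trunc_ge0 _ _ _)) /trunc; case: ifP => // _; rewrite ge_min lexx.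
Qed.

Lemma trunc_le_nat n f x : trunc n f x <= n%:R.
Proof. by rewrite /trunc; case: ifP => // _; rewrite ?ge_min ?lexx ?orbT. Qed.

Lemma trunc_nd n f x : trunc n f x <= trunc n.+1 f x.
Proof.
rewrite {1}/trunc; case: ifP => [xn|_]; last exact: trunc_ge0.
have nn : n%:R <= n.+1%:R :> R by rewrite ler_nat.
by rewrite /trunc (lt_le_trans xn nn) le_min !ge_min lexx nn orbT.
Qed.

Lemma trunc_eq f x : exists n, trunc n f x = `|f x|.
Proof.
exists (maxn (Num.truncn x).+1 (Num.truncn `|f x|).+1); rewrite /trunc.
have h (y : R) m : (Num.truncn y < m)%N -> y < m%:R.
  by move=> ym; apply: lt_le_trans (truncnS_gt y) _; rewrite ler_nat.
rewrite h; last by rewrite leq_max leqnn.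
by apply/min_idPl; apply: ltW; apply: h; rewrite leq_max leqnn orbT.
Qed.

Lemma trunc_supp n f : measurable_fun setT f -> (supp_measure (trunc n f) <= n%:R%:E)%E.
Proof.
move=> mf; rewrite -(@halfline_Ny_itv R true n%:R)//; apply: le_measure; rewrite ?inE//.
  by apply: measurable_neq0; exact: measurable_trunc.
by move=> x /=; rewrite /trunc in_itv/=; case: ifP => //; rewrite eqxx.
Qed.

Lemma integral_trunc_sup p f (D : set R) (M : \bar R) : 0 < p -> measurable D ->
  measurable_fun setT f ->
  (forall n, (\int[leb]_(x in D) rearrangement (abs_pow p (trunc n f)) x <= M)%E) ->
  (\int[leb]_(x in D) rearrangement (abs_pow p f) x <= M)%E.
Proof.
move=> p0 mD mf; apply: integral_rearr_sup => //.
- by move=> n; apply: measurable_abs_pow; exact: measurable_trunc.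
- exact: measurable_abs_pow.
- move=> n x; rewrite !(ger0_norm (abs_pow_ge0 _ _ _)); apply: ge0_ler_powR; rewrite ?nnegrE ?(ltW p0)//.
  by rewrite !ger0_norm ?trunc_ge0// trunc_nd.
move=> x s sF; have [n En] := trunc_eq f x; exists n.
by rewrite /abs_pow En normr_id.
Qed.

Lemma Ipow_trunc p n f : 0 < p -> measurable_fun setT f -> (Ipow p (trunc n f) < +oo)%E.
Proof.
move=> p0 mf; have mt := measurable_trunc n mf.
apply: (@le_lt_trans _ _ ((n%:R `^ p)%:E * supp_measure (trunc n f))%E).
  apply: Ipow_bounded => //; [exact: ltW|exact: measurable_neq0|].
  move=> x; rewrite indicE.
  have -> : (x \in [set x | trunc n f x != 0]) = (trunc n f x != 0) by apply/idP/idP; rewrite inE.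
  have [->|nz] := eqVneq (trunc n f x) 0; first by rewrite normr0 powR0 ?gt_eqF// mulr0.
  rewrite mulr1; apply: ge0_ler_powR; rewrite ?nnegrE ?(ltW p0)//.
  by rewrite ger0_norm ?trunc_ge0// trunc_le_nat.
by rewrite lte_mul_pinfty ?lee_fin ?powR_ge0// (le_lt_trans (trunc_supp n mf)) ?ltry.
Qed.

Lemma Loo_cst0 : L +oo%E (cst 0 : R -> R).
Proof. by apply/LooP; split => //; exists 0; apply: aeW => x; rewrite normr0. Qed.

Lemma Lp_cst0 p : 0 < p -> L p%:E (cst 0 : R -> R).
Proof.
move=> p0; apply/(LpP _ p0); split => //; rewrite /Ipow.
by under eq_integral do rewrite normr0 powR0 ?gt_eqF//; rewrite integral0.
Qed.

Lemma L0_cst0 : L0 (cst 0 : R -> R).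
Proof.
split => //; rewrite /supp_measure (_ : [set _ | _] = set0) ?measure0//.
by apply/seteqP; split => x //=; rewrite eqxx.
Qed.

Lemma sum_spacel (X Y : (R -> R) -> Prop) f : X f -> Y (cst 0) -> sum_space X Y f.
Proof. by move=> Xf Y0; exists f, (cst 0); split => //; apply/funext => x /=; rewrite addr0. Qed.

Lemma sum_spacer (X Y : (R -> R) -> Prop) f : X (cst 0) -> Y f -> sum_space X Y f.
Proof. by move=> X0 Yf; exists (cst 0), f; split => //; apply/funext => x /=; rewrite add0r. Qed.

Lemma nontrivial_rearr p f : 0 < p -> measurable_fun setT f -> ~ (f = cst 0 %[ae mu]) ->
  exists t, [/\ 0 < t, t < 1 & (0 < rearrangement (abs_pow p f) t)%E].
Proof.
move=> p0 mf f0; apply: contrapT => H; apply: f0.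
have mp := measurable_abs_pow p mf.
have dF : (dfun (abs_pow p f) 0 <= 0)%E.
  apply/lee_addgt0Pr => e e0; rewrite add0e.
  have u0 : 0 < Num.min e (1 / 2) by rewrite lt_min e0; lra.
  apply: (@le_trans _ _ (Num.min e (1 / 2))%:E); last by rewrite lee_fin ge_min lexx.
  rewrite -rearr_le// leNgt; apply/negP => F0; apply: H; exists (Num.min e (1 / 2)); split => //.
  by rewrite gt_min; apply/orP; right; lra.
exists [set x | 0 < `|abs_pow p f x|]; split.
- exact: measurable_gt.
- by apply/eqP; rewrite eq_le dF measure_ge0.
move=> x /= fx; rewrite (ger0_norm (abs_pow_ge0 _ _ _)) /abs_pow powR_gt0//.
by rewrite normr_gt0; apply/eqP => f0; apply: fx.
Qed.

End truncation.

Section head_sufficiency.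
Context (R : realType).
Local Notation leb := (@lebesgue_measure R).
Local Notation mu := (halfline_measure R).
Local Notation K := (rank_cst R).
Implicit Types (f g F G U : R -> R) (p q c C l M t i : R) (n : nat).

Definition head_criterion (E : fspace R) p c := forall f g,
  E f -> sum_space (L p%:E) (L +oo%E) g ->
  head_majorized (abs_pow p g) (abs_pow p f) -> E g /\ qnorm E g <= c * qnorm E f.

Definition tail_criterion (E : fspace R) q c := forall f g,
  E f -> sum_space L0 (L q%:E) g ->
  tail_majorized (abs_pow q g) (abs_pow q f) -> E g /\ qnorm E g <= c * qnorm E f.

(** Reads a norm estimate backwards, as an upper bound on the integral [i] in its denominator. *)
Lemma root_bound p (a i x y : R) : 0 < p -> 0 < i -> 0 <= a -> 0 < x -> 0 <= y ->
  x <= (a / i) `^ p^-1 * y -> i <= a * (y `^ p / x `^ p).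
Proof.
move=> p0 i0 a0 x0 y0 xy.
have xp0 : 0 < x `^ p by rewrite powR_gt0.
have ai0 : 0 <= a / i by rewrite divr_ge0// ltW.
have := @ge0_ler_powR R p (ltW p0) x ((a / i) `^ p^-1 * y).
rewrite !nnegrE (ltW x0) mulr_ge0 ?powR_ge0// => /(_ isT isT xy).
rewrite powRM ?powR_ge0// powR_root// => H.
rewrite mulrA ler_pdivlMr// -ler_pdivlMl//; apply: (le_trans H).
by rewrite mulrA [i^-1 * a]mulrC.
Qed.

Lemma ereal_gt0_fin (y : \bar R) : (0 < y)%E -> (y < +oo)%E ->
  exists2 i, 0 < i & (i%:E <= y)%E /\ (y <= i%:E)%E.
Proof.
move=> y0 yoo; exists (fine y); first by rewrite fine_gt0// y0.
by rewrite fineK// ge0_fin_numE// ltW.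
Qed.

Lemma ereal_ge0_fin (y : \bar R) : (0 <= y)%E -> (y < +oo)%E -> exists2 i, 0 <= i & y = i%:E.
Proof.
move=> y0 yoo; have fy : y \is a fin_num by rewrite ge0_fin_numE.
by exists (fine y); rewrite ?fine_ge0// fineK.
Qed.

Lemma head_majorized_scale p C f g : 0 < p -> 0 < C -> measurable_fun setT f ->
  sum_space (L p%:E) (L +oo%E) f -> measurable_fun setT g ->
  (forall t, 0 < t -> (\int[leb]_(x in `]0%R, t[) rearrangement (abs_pow p g) x <=
     C%:E * \int[leb]_(x in `]0%R, t[) rearrangement (abs_pow p f) x)%E) ->
  head_majorized (abs_pow p g) (abs_pow p (fun x => C `^ p^-1 * f x)).
Proof.
move=> p0 C0 mf sf mg gf.
have /(sum_LpLoo_pow p0 mf)/sum_L1LooP[mF fF Ffin] := sf.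
have CF t : 0 < t -> (C%:E * \int[leb]_(x in `]0%R, t[) rearrangement (abs_pow p f) x < +oo)%E.
  by move=> t0; rewrite lte_mul_pinfty ?lee_fin ?(ltW C0) ?Ffin.
have sg : sum_space (L 1%:E) (L +oo%E) (abs_pow p g).
  apply: sum_L1Loo_head; first exact: measurable_abs_pow.
  by apply: le_lt_trans (gf (1 : R) ltr01) _; exact: CF.
suff H u : u = (fun x => C * abs_pow p f x) -> head_majorized (abs_pow p g) u.
  by apply: H; exact: (abs_pow_scale f p0 (ltW C0)).
move=> ->; split; first exact: sg.
  apply: sum_L1Loo_head.
    by apply: measurable_funM; [exact: measurable_cst|exact: mF].
  by rewrite integral_rearr_scale// CF.
by move=> t t0; rewrite integral_rearr_scale//; exact: gf.
Qed.

Lemma linear_big_small (V : (R -> R) -> Prop) T l f :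
  (forall (a : R) f g, V f -> V g ->
    T (fun x => a * f x + g x) = (fun x => a * T f x + T g x) %[ae mu]) ->
  V (big_part l f) -> V (small_part l f) ->
  {ae mu, forall x, T f x = T (big_part l f) x + T (small_part l f) x}.
Proof.
move=> Tlin sb ss; have := Tlin 1 _ _ sb ss.
rewrite (_ : (fun x => 1 * big_part l f x + small_part l f x) = f); last first.
  by apply/funext => x; rewrite mul1r -[RHS](congr1 (@^~ x) (big_small l f)).
by apply: ae_imp => x /(_ I) ->; rewrite mul1r.
Qed.

(** With f cut at l = f*(t), the image of the big part is controlled in L_p and that of the small
    part in L_oo. The term t l^p coming from the latter is absorbed because t F*(t) is at most the
    integral of F* over (0, t), F being |f|^p. *)
Lemma head_op_estimate p T : 0 < p -> bounded_on_couple (L p%:E) (L +oo%E) T ->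
  exists2 D : R, 0 < D & forall f, sum_space (L p%:E) (L +oo%E) f -> forall t, 0 < t ->
    (\int[leb]_(x in `]0%R, t[) rearrangement (abs_pow p (T f)) x <=
     D%:E * \int[leb]_(x in `]0%R, t[) rearrangement (abs_pow p f) x)%E.
Proof.
move=> p0 [[TV _ Tlin] /(bounded_LpP _ p0)[Cp Cp0 Tp] /bounded_LooP[C1 C10 To]].
(* The constants of [rearr_head_ub], [powR_normD] and [big_part_ub] combined; the final 1 ensures
   positivity when T vanishes. *)
pose D := K * (3 * (2 `^ p * (Cp * (3 * K))) + 2 `^ p * C1 `^ p) + 1.
have k0 := rank_cst_ge0 R; have p20 : 0 <= 2 `^ p :> R by exact: powR_ge0.
have p10 : 0 <= C1 `^ p by exact: powR_ge0.
have D0 : 0 < D by rewrite ltr_wpDl// !mulr_ge0// !addr_ge0// !mulr_ge0.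
exists D => // f sf t t0; have [mf _] := proj1 (sum_LpLooP _ p0) sf.
have [mT _] := proj1 (sum_LpLooP _ p0) (TV _ sf).
have [mF fF Ffin] := sum_L1LooP (proj1 (sum_LpLoo_pow p0 mf) sf).
have [_ fG _] := sum_L1LooP (proj1 (sum_LpLoo_pow p0 mT) (TV _ sf)).
set F := abs_pow p f in mF fF Ffin *; pose lam := rearr F t; pose l := lam `^ p^-1.
have lam0 : 0 <= lam by exact: fine_rearr_ge0.
have l0 : 0 <= l by exact: powR_ge0.
have lp : l `^ p = lam by rewrite /l powR_root.
set b := big_part l f; set s := small_part l f.
have mb : measurable_fun setT b by exact: measurable_big_part.
have bI : (Ipow p b <= (3 * K)%:E * \int[leb]_(x in `]0%R, t[) rearrangement F x)%E.
  by rewrite -Ipow1_abs_pow (abs_pow_big f p0 l0) lp; exact: big_part_ub.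
have Lb : L p%:E b.
  apply/(LpP _ p0); split=> //; apply: le_lt_trans bI _.
  by rewrite lte_mul_pinfty ?lee_fin ?mulr_ge0 ?Ffin.
have ms : measurable_fun setT s by exact: measurable_small_part.
have sl : {ae mu, forall x, `|s x| <= l}.
  by apply: aeW => x; rewrite /s /small_part; case: ltP => // _; rewrite normr0.
have Ls : L +oo%E s by apply/LooP; split => //; exists l.
have [LTb Tb] := Tp b Lb; have [_ /(_ l l0 sl) Ts] := To s Ls.
have mTb : measurable_fun setT (T b) by case/(LpP _ p0): LTb.
have sb : sum_space (L p%:E) (L +oo%E) b by apply: sum_spacel; [|exact: Loo_cst0].
have ss : sum_space (L p%:E) (L +oo%E) s by apply: sum_spacer; [exact: Lp_cst0|].
have Tf := linear_big_small Tlin sb ss.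
apply: (@le_trans _ _ (K%:E * (3%:E * \int[mu]_x (2 `^ p * abs_pow p (T b) x)%:E +
    (t * (2 `^ p * (C1 * l) `^ p))%:E))%E).
  apply: (@rearr_head_ub _ _ (fun x => 2 `^ p * abs_pow p (T b) x)) => //.
  - exact: measurable_abs_pow.
  - by apply: measurable_funM => //; exact: measurable_abs_pow.
  - by move=> x; rewrite mulr_ge0// abs_pow_ge0.
  - by rewrite mulr_ge0 ?powR_ge0.
  apply: ae_imp (ae_and Tf Ts) => x [Tfx Tsx].
  rewrite (ger0_norm (abs_pow_ge0 _ _ _)) /abs_pow Tfx -mulrDr.
  apply: le_trans (powR_normD _ _ (ltW p0)) _; rewrite ler_wpM2l// lerD2l.
  by apply: ge0_ler_powR; rewrite ?nnegrE ?(ltW p0) ?mulr_ge0.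
set I := integral _ _ _ in bI *.
pose i := fine I; have i0 : 0 <= i by rewrite fine_ge0// integral_ge0// => x _; exact: rearr_ge0.
have EI : (I = i%:E)%E.
  by rewrite fineK// ge0_fin_numE ?Ffin// integral_ge0// => x _; exact: rearr_ge0.
have tl : t * lam <= i.
  by rewrite -lee_fin -EI EFinM /lam -rearrE//; exact: rearr_head_lb.
have -> : (\int[mu]_x (2 `^ p * abs_pow p (T b) x)%:E = (2 `^ p)%:E * Ipow p (T b))%E.
  by rewrite -ge0_integralZl_EFin//; exact: measurable_eabs_pow.
have Tb2 : (Ipow p (T b) <= (Cp * (3 * K * i))%:E)%E.
  apply: (le_trans Tb); rewrite EFinM; apply: lee_wpmul2l; first by rewrite lee_fin.
  by apply: (le_trans bI); rewrite EI -EFinM.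
apply: (@le_trans _ _ (K%:E * (3%:E * ((2 `^ p)%:E * (Cp * (3 * K * i))%:E) +
    (t * (2 `^ p * (C1 * l) `^ p))%:E))%E).
  apply: lee_wpmul2l; first by rewrite lee_fin.
  by apply: leeD => //; apply: lee_wpmul2l => //; apply: lee_wpmul2l => //; rewrite lee_fin.
rewrite EI -!EFinM lee_fin powRM// lp /D.
have -> : t * (2 `^ p * (C1 `^ p * lam)) = 2 `^ p * C1 `^ p * (t * lam) by ring.
rewrite -subr_ge0.
have H : 0 <= K * (2 `^ p * C1 `^ p) * (i - t * lam) by rewrite !mulr_ge0// subr_ge0.
by rewrite [leRHS](_ : _ = K * (2 `^ p * C1 `^ p) * (i - t * lam) + i) ?addr_ge0//; ring.
Qed.

Section head.
Variables (E : fspace R) (hE : quasi_Banach_function_space E) (p c : R).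
Hypotheses (p0 : 0 < p) (c0 : 0 < c) (Ec : head_criterion E p c).

Lemma head_criterion_scale C f g : 0 < C -> E f -> sum_space (L p%:E) (L +oo%E) f ->
  measurable_fun setT g ->
  (forall t, 0 < t -> (\int[leb]_(x in `]0%R, t[) rearrangement (abs_pow p g) x <=
     C%:E * \int[leb]_(x in `]0%R, t[) rearrangement (abs_pow p f) x)%E) ->
  E g /\ qnorm E g <= c * (C `^ p^-1 * qnorm E f).
Proof.
move=> C0 Ef sf mg gf; have mf := qB_measurable hE Ef.
have gm := head_majorized_scale p0 C0 mf sf mg gf.
have k0 : 0 <= C `^ p^-1 by exact: powR_ge0.
have kE := qB_scale hE (C `^ p^-1) Ef.
rewrite -[X in X * qnorm E f](ger0_norm k0) -(qB_homogeneous hE)//; apply: (Ec kE) => //.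
by apply/(sum_LpLoo_pow p0 mg); case: gm.
Qed.

(** A bounded, p-integrable g is majorized by a multiple of any f with nonzero head integral. Being
    quantitative in [i], it serves twice: to embed the intersection in E, and to bound [i] by the
    norm of f when g is a fixed test function. *)
Lemma head_embed f g (B i : R) : E f -> sum_space (L p%:E) (L +oo%E) f ->
  0 < i -> (i%:E <= \int[leb]_(x in `]0%R, 1%R[) rearrangement (abs_pow p f) x)%E ->
  measurable_fun setT g -> 0 < B -> {ae mu, forall x, abs_pow p g x <= B} ->
  (Ipow p g <= B%:E)%E ->
  E g /\ qnorm E g <= c * ((3 * K * B / i) `^ p^-1 * qnorm E f).
Proof.
move=> Ef sf i0 iF mg B0 gB gI; have k0 := rank_cst_gt0 R.
have mG := measurable_abs_pow p mg.
have gL : L p%:E g by apply/(LpP _ p0); split => //; apply: le_lt_trans gI _; rewrite ltry.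
have /(sum_LpLoo_pow p0 mg)/sum_L1LooP[_ fG _] := sum_spacel gL (@Loo_cst0 R).
apply: head_criterion_scale => //; first by rewrite divr_gt0 ?mulr_gt0.
(* Up to time 1 the height bound gives order t B, against at least t i by concavity; after 1 the
   total integral of |g|^p is compared with i. *)
move=> t t0; have [t1|t1] := leP t 1.
  apply: (@le_trans _ _ (K%:E * (3%:E * \int[mu]_x (cst 0 x)%:E + (t * B)%:E))%E).
    apply: (@rearr_head_ub _ _ (cst 0)) => //; first exact: ltW.
    by apply: ae_imp gB => x; rewrite (ger0_norm (abs_pow_ge0 _ _ _)) add0r.
  rewrite integral0 mule0 add0e -EFinM.
  apply: (@le_trans _ _ ((3 * K * B / i)%:E * (t * i)%:E)%E).
    rewrite -EFinM lee_fin (_ : 3 * K * B / i * (t * i) = 3 * (K * (t * B))).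
      by rewrite ler_peMl ?ler1n// !mulr_ge0// ltW.
    by field; rewrite gt_eqF.
  apply: lee_wpmul2l; first by rewrite lee_fin !mulr_ge0 ?invr_ge0// ltW.
  have := rearr_head_concave (abs_pow p f) t0 t1; rewrite mul1e; apply: le_trans.
  by rewrite EFinM; apply: lee_wpmul2l => //; rewrite lee_fin ltW.
apply: (@le_trans _ _ ((3 * K)%:E * Ipow 1 (abs_pow p g))%E).
  apply: le_trans (integral_rearr_le mG fG); rewrite (integral_head_fin t fG).
  apply: ge0_subset_integral => //; first exact: measurable_erearr.
  by move=> x _; rewrite lee_fin fine_rearr_ge0.
apply: (@le_trans _ _ ((3 * K * B / i)%:E * i%:E)%E).
  rewrite Ipow1_abs_pow -EFinM divfK ?gt_eqF// (EFinM (3 * K) B).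
  by apply: lee_wpmul2l => //; rewrite lee_fin mulr_ge0// ltW.
apply: lee_wpmul2l; first by rewrite lee_fin !mulr_ge0 ?invr_ge0// ltW.
apply: (le_trans iF); apply: integral_rearr_subset => //.
by move=> x /=; rewrite !in_itv/= => /andP[-> /lt_trans]; apply.
Qed.

Lemma trunc_head n f : measurable_fun setT f ->
  sum_space (L p%:E) (L +oo%E) (trunc n f).
Proof.
move=> mf; apply: sum_spacel; last exact: Loo_cst0.
by apply/(LpP _ p0); split; [exact: measurable_trunc|exact: Ipow_trunc].
Qed.

Lemma qB_trunc n f : E f -> E (trunc n f) /\ qnorm E (trunc n f) <= qnorm E f.
Proof.
move=> Ef; apply: (qB_ideal hE) => //; last by apply: aeW => x; exact: trunc_le.
by apply: measurable_trunc; exact: qB_measurable Ef.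
Qed.

(** A truncation of a nonzero element works: if all truncations had zero head integral, so would the
    element, by [integral_trunc_sup]. *)
Lemma head_seed : nontrivial E -> exists f i, [/\ E f, sum_space (L p%:E) (L +oo%E) f,
  0 < i & (i%:E <= \int[leb]_(x in `]0%R, 1%R[) rearrangement (abs_pow p f) x)%E].
Proof.
move=> [f Ef f0]; have mf := qB_measurable hE Ef.
have [t [t0 t1 Ft]] := nontrivial_rearr p0 mf f0.
have : (0 < \int[leb]_(x in `]0%R, 1%R[) rearrangement (abs_pow p f) x)%E.
  apply: (@lt_le_trans _ _ (t%:E * rearrangement (abs_pow p f) t)%E); first exact: mule_gt0.
  apply: le_trans (rearr_head_lb _ t0) _; apply: integral_rearr_subset => //.
  by move=> x /=; rewrite !in_itv/= => /andP[-> /lt_trans]; apply.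
rewrite ltNge => I0; apply: contrapT => H; apply: (negP I0).
apply: integral_trunc_sup => // n; rewrite leNgt; apply/negP => In; apply: H.
have sn := trunc_head n mf.
have [_ _ /(_ (1 : R) ltr01)] := sum_L1LooP (proj1 (sum_LpLoo_pow p0 (measurable_trunc n mf)) sn).
move=> Ify; have [i i0 [Ei _]] := ereal_gt0_fin In Ify.
by exists (trunc n f), i; split; [exact: (proj1 (qB_trunc n Ef))|exact: sn|exact: i0|exact: Ei].
Qed.

Let chi : R -> R := \1_(`]0, 1[%classic).

Lemma chi_props : [/\ measurable_fun setT chi, {ae mu, forall x, abs_pow p chi x <= 1},
  (Ipow p chi <= 1%:E)%E & ~ (chi = cst 0 %[ae mu])].
Proof.
have mchi : measurable_fun setT chi by exact: measurable_indic.
have pchi x : `|chi x| `^ p = \1_(`]0, 1[%classic) x.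
  rewrite /chi indicE; case: (_ \in _); first by rewrite normr1 powR1.
  by rewrite normr0 powR0// gt_eqF.
have m01 : mu `]0, 1[%classic = 1%E by rewrite halfline_itv// subr0.
split => //.
- by apply: aeW => x; rewrite /abs_pow pchi indicE; case: (_ \in _).
- rewrite -m01 -[X in (_ <= mu X)%E]setIT -integral_indic//; rewrite le_eqVlt; apply/orP; left; apply/eqP.
  by apply: eq_integral => x _; rewrite pchi.
move=> [N [mN N0 NP]].
have : (mu `]0%R, 1%R[%classic <= mu N)%E.
  apply: le_measure; rewrite ?inE// => x x01; apply: NP => /(_ I)/eqP /=.
  by rewrite /chi indicE mem_set//= oner_eq0.
by rewrite m01 N0 leNgt lte01.
Qed.

Lemma head_small : nontrivial E -> forall f, L p%:E f -> L +oo%E f -> E f.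
Proof.
move=> /head_seed[f [i [Ef sf i0 iF]]] g /(LpP _ p0)[mg gI] /LooP[_ [M gM]].
pose J := fine (Ipow p g); have EJ : (Ipow p g = J%:E)%E by rewrite fineK// ge0_fin_numE// Ipow_ge0.
have J0 : 0 <= J by rewrite fine_ge0// Ipow_ge0.
have M0 : 0 <= `|M| `^ p by exact: powR_ge0.
have [] // := @head_embed f g (`|M| `^ p + J + 1) i Ef sf i0 iF mg.
- lra.
- apply: ae_imp gM => x gx; apply: (@le_trans _ _ (`|M| `^ p)); last by lra.
  by apply: ge0_ler_powR; rewrite ?nnegrE ?(ltW p0)// (le_trans gx)// ler_norm.
by rewrite EJ lee_fin; lra.
Qed.

(** [head_embed] with [chi] and the truncations of f bounds the norm of [chi] by a negative power of
    their head integral times the norm of f. As [chi] has positive norm, these integrals are bounded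
    uniformly in n. *)
Lemma head_large : nontrivial E -> forall f, E f -> sum_space (L p%:E) (L +oo%E) f.
Proof.
move=> nE f Ef; have mf := qB_measurable hE Ef.
have [f0 [i [Ef0 sf0 i0 iF0]]] := head_seed nE.
have [mchi chiB chiI chi0] := chi_props.
have [Echi _] := head_embed Ef0 sf0 i0 iF0 mchi ltr01 chiB chiI.
have chin : 0 < qnorm E chi.
  rewrite lt_neqAle (qB_ge0 hE Echi) andbT; apply/negP => /eqP n0.
  by apply: chi0; apply: (qB_definite hE).
have c3 : 0 <= 3 * K by rewrite mulr_ge0 ?rank_cst_ge0.
have cf0 : 0 <= c * qnorm E f by rewrite mulr_ge0 ?(ltW c0) ?qB_ge0.
apply/(sum_LpLoo_pow p0 mf); apply: sum_L1Loo_head; first exact: measurable_abs_pow.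
apply: (@le_lt_trans _ _ (3 * K * ((c * qnorm E f) `^ p / qnorm E chi `^ p))%:E); last by rewrite ltry.
apply: integral_trunc_sup => // n; have sn := trunc_head n mf.
have [_ _ /(_ (1 : R) ltr01)] := sum_L1LooP (proj1 (sum_LpLoo_pow p0 (measurable_trunc n mf)) sn).
have : (0 <= \int[leb]_(x in `]0%R, 1%R[) rearrangement (abs_pow p (trunc n f)) x)%E.
  by apply: integral_ge0 => x _; exact: rearr_ge0.
rewrite le_eqVlt => /predU1P[<- _|I0 Ify].
  by rewrite lee_fin mulr_ge0// divr_ge0 ?powR_ge0.
have [i1 i10 [iI Ii]] := ereal_gt0_fin I0 Ify.
have [En nn] := qB_trunc n Ef.
have [_] := @head_embed (trunc n f) chi 1 i1 En sn i10 iI mchi ltr01 chiB chiI.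
rewrite mulr1 => H; apply: (le_trans Ii); rewrite lee_fin; apply: (root_bound p0) => //.
rewrite mulrCA; apply: (le_trans H); rewrite ler_wpM2l ?(ltW c0)//.
by rewrite ler_wpM2l ?powR_ge0.
Qed.

Lemma head_bounded T : nontrivial E -> bounded_on_couple (L p%:E) (L +oo%E) T -> bounded_on E T.
Proof.
move=> nE Tb; have [D D0 TD] := head_op_estimate p0 Tb.
exists (c * D `^ p^-1) => f Ef; rewrite -mulrA; have sf := head_large nE Ef.
apply: head_criterion_scale => //; last exact: TD.
by have [[TV _ _] _ _] := Tb; have [] := proj1 (sum_LpLooP _ p0) (TV _ sf).
Qed.

Lemma head_interpolation : nontrivial E -> interpolation_space (L p%:E) (L +oo%E) E.
Proof.
move=> nE; split; [exact: head_small|exact: head_large|].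
by move=> T; exact: head_bounded.
Qed.

End head.
End head_sufficiency.

(** * Sufficiency for the couple (L_0, L_q) *)

Section tail_sufficiency.
Context (R : realType).
Local Notation leb := (@lebesgue_measure R).
Local Notation mu := (halfline_measure R).
Local Notation dfun f s := (mu [set x | (s < `|f x|)%R]).
Implicit Types (f g F G U : R -> R) (p q c C l M t i : R) (n N : nat).

Definition fcopy n f x : R := \1_(copy n) x * f `|rho x|.
(** N disjoint copies multiply the distribution function by N, hence dilate the rearrangement by
    N. *)
Definition fcopies N f x : R := \sum_(n < N) fcopy n f x.

Lemma copy_inj m n (x : R) : copy m x -> copy n x -> m = n.
Proof. by move=> [k e] [k' e']; move: e'; rewrite e => -[]. Qed.

Lemma fcopy_in n f x : copy n x -> fcopy n f x = f `|rho x|.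
Proof. by move=> nx; rewrite /fcopy indicE mem_set// mul1r. Qed.

Lemma fcopy_out n f x : ~ copy n x -> fcopy n f x = 0.
Proof. by move=> nx; rewrite /fcopy indicE memNset// mul0r. Qed.

Lemma fcopies_in n N f x : copy n x -> fcopies N f x = if (n < N)%N then f `|rho x| else 0.
Proof.
move=> nx; rewrite /fcopies; case: ifPn => nN.
  rewrite (bigD1 (Ordinal nN))//= (fcopy_in _ nx) big1 ?addr0// => m /eqP mn.
  by apply: fcopy_out => /(copy_inj nx) nm; apply: mn; apply/val_inj.
rewrite big1// => m _; apply: fcopy_out => /(copy_inj nx) nm.
by move: nN; rewrite nm ltn_ord.
Qed.

Lemma fcopies_out N f x : (forall n, ~ copy n x) -> fcopies N f x = 0.
Proof. by move=> H; rewrite /fcopies big1// => m _; exact: fcopy_out. Qed.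

Lemma measurable_fcopy n f : measurable_fun setT f -> measurable_fun setT (fcopy n f).
Proof.
move=> mf; apply: measurable_funM; first by apply: measurable_indic; exact: measurable_copy.
apply: (measurableT_comp mf); apply: measurableT_comp => //; exact: measurable_rho.
Qed.

Lemma measurable_fcopies N f : measurable_fun setT f -> measurable_fun setT (fcopies N f).
Proof. by move=> mf; apply: measurable_sum => n; exact: measurable_fcopy. Qed.

Lemma abs_pow_fcopy q n f : 0 < q -> abs_pow q (fcopy n f) = fcopy n (abs_pow q f).
Proof.
move=> q0; apply/funext => x; have [nx|nx] := pselect (copy n x).
  by rewrite /abs_pow !fcopy_in.
by rewrite /abs_pow !fcopy_out// normr0 powR0// gt_eqF.
Qed.

Lemma abs_pow_fcopies q N f : 0 < q -> abs_pow q (fcopies N f) = fcopies N (abs_pow q f).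
Proof.
move=> q0; apply/funext => x; rewrite /abs_pow.
have [[n nx]|H] := pselect (exists n, copy n x).
  by rewrite !(fcopies_in _ _ nx); case: ifP => // _; rewrite normr0 powR0// gt_eqF.
have H' n : ~ copy n x by move=> nx; apply: H; exists n.
by rewrite !fcopies_out// normr0 powR0// gt_eqF.
Qed.

Lemma indic_bool (P : R -> bool) x : \1_[set y | P y] x = (P x)%:R :> R.
Proof. by rewrite indicE; congr (nat_of_bool _)%:R; apply/idP/idP; rewrite inE. Qed.

Lemma dfun_integral f s : measurable_fun setT f ->
  dfun f s = (\int[mu]_x (s < `|f x|)%R%:R%:E)%E.
Proof.
move=> mf; transitivity (\int[mu]_x (\1_[set x | s < `|f x|] x)%:E)%E.
  by rewrite integral_indic ?setIT//; exact: measurable_gt.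
by apply: eq_integral => x _; rewrite indic_bool.
Qed.

Lemma measurable_level f s : measurable_fun setT f ->
  measurable_fun setT (fun x => (s < `|f x|)%R%:R%:E : \bar R).
Proof.
move=> mf; apply: measurable_efun; under eq_fun do rewrite -indic_bool.
by apply: measurable_indic; exact: measurable_gt.
Qed.

Lemma rearr_fcopy n f t : measurable_fun setT f ->
  (rearrangement (fcopy n f) t <= rearrangement f t)%E.
Proof.
move=> mf; apply: ereal_inf_le_tmp => _ [s [s0 fs] <-]; exists s => //; split => //.
apply: le_trans fs; rewrite !dfun_integral//; last exact: measurable_fcopy.
rewrite -[leRHS]mul1e.
have h0 x : (0 <= (s < `|f x|)%R%:R%:E :> \bar R)%E by rewrite lee_fin ler0n.
apply: le_trans (dom_rho n h0 (measurable_level s mf)).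
apply: ge0_le_integral => //.
- by apply: measurable_level; exact: measurable_fcopy.
- apply: emeasurable_funM.
    by apply: measurable_efun; apply: measurable_indic; exact: measurable_copy.
  apply: (measurableT_comp (measurable_level s mf)).
  by apply: measurableT_comp => //; exact: measurable_rho.
move=> x _; rewrite -EFinM lee_fin indicE; have [nx|nx] := pselect (copy n x).
  by rewrite fcopy_in// mem_set// mul1r.
by rewrite fcopy_out// normr0 ltNge s0 memNset// mul0r.
Qed.

Lemma integral_rearr_mono F G (D : set R) : measurable D ->
  (forall t, (rearrangement F t <= rearrangement G t)%E) ->
  (\int[leb]_(x in D) rearrangement F x <= \int[leb]_(x in D) rearrangement G x)%E.
Proof.
move=> mD FG; apply: ge0_le_integral => //.
- by move=> x _; exact: rearr_ge0.
- by apply: measurable_funTS; exact: measurable_rearr.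
- by apply: measurable_funTS; exact: measurable_rearr.
Qed.

Lemma dfun_copy n f s : measurable_fun setT f ->
  (dfun f s <= mu (copy n `&` [set x | (s < `|f `|rho x| |)%R]))%E.
Proof.
move=> mf; have mr : measurable_fun setT (fun x : R => `|rho x|).
  by apply: measurableT_comp => //; exact: measurable_rho.
have mfr : measurable_fun setT (fun x => f `|rho x|) by exact: measurableT_comp.
rewrite setIC -integral_indic; [|exact: measurable_copy|exact: measurable_gt].
rewrite dfun_integral//.
apply: (@le_trans _ _ (\int[mu]_(x in copy n) (s < `|f `|rho x| |)%R%:R%:E)%E); last first.
  rewrite le_eqVlt; apply/orP; left; apply/eqP; apply: eq_integral => x _.
  by rewrite (indic_bool (fun y => s < `|f `|rho y| |)).
have h0 x : (0 <= (s < `|f `|rho x| |)%R%:R%:E :> \bar R)%E by rewrite lee_fin ler0n.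
apply: le_trans (integral_theta_le n h0 (measurable_level s mfr)).
apply: ae_ge0_le_integral => //.
- exact: measurable_level.
- by apply: (measurableT_comp (measurable_level s mfr)); exact: measurable_theta.
by apply: ae_imp (halfline_gt0 R) => x x0 _; rewrite rhoK ?(ltW x0)// (gtr0_norm x0).
Qed.

Lemma dfun_fcopies N f s : measurable_fun setT f -> 0 <= s ->
  (N%:R%:E * dfun f s <= dfun (fcopies N f) s)%E.
Proof.
move=> mf s0; pose B n := copy n `&` [set x : R | s < `|f `|rho x| |].
have mB n : measurable (B n).
  apply: measurableI; first exact: measurable_copy.
  apply: measurable_gt; apply: (measurableT_comp mf); apply: measurableT_comp => //.
  exact: measurable_rho.
apply: (@le_trans _ _ (mu (\big[setU/set0]_(n < N) B n))).
  rewrite measure_bigsetU//; last first.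
    apply/trivIsetP => m n _ _ mn; apply/seteqP; split => x //= -[[mx _] [nx _]].
    by move/eqP: mn; apply; exact: copy_inj mx nx.
  apply: (@le_trans _ _ (\sum_(n < N) dfun f s)%E).
    rewrite mule_natl; elim: (N) => [|k IH]; first by rewrite big_ord0.
    by rewrite big_ord_recl muleS leeD.
  by apply: lee_sum => n _; exact: dfun_copy.
apply: le_measure; rewrite ?inE.
- by apply: bigsetU_measurable => n _; exact: mB.
- by apply: measurable_gt; exact: measurable_fcopies.
rewrite -bigcup_mkord => x [n /= nN [nx fx]] /=.
by rewrite (fcopies_in _ _ nx) nN.
Qed.

(** f*(x) is at most the rearrangement of the copies at N x; the change of scale then only helps, as
    N >= 1. *)
Lemma integral_fcopies N f t : measurable_fun setT f -> (0 < N)%N -> 0 < t ->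
  (\int[leb]_(x in `]t, +oo[) rearrangement f x <=
   \int[leb]_(x in `](N%:R * t)%R, +oo[) rearrangement (fcopies N f) x)%E.
Proof.
move=> mf N0 t0; have n0 : 0 < N%:R :> R by rewrite ltr0n.
have ni0 : 0 < N%:R^-1 :> R by rewrite invr_gt0.
have nt0 : 0 < N%:R * t by rewrite mulr_gt0.
have r0 F x : (0 <= rearrangement F x)%E by exact: rearr_ge0.
have mr F := measurable_rearr F.
rewrite (halfline_tail (ltW t0) (r0 f) (mr f)) (halfline_tail (ltW nt0) (r0 (fcopies N f)) (mr _)).
rewrite integral_mkcond [leRHS]integral_mkcond.
set H := (rearrangement (fcopies N f)) \_ _.
have H0 x : (0 <= H x)%E by apply: erestrict_ge0.
have mH : measurable_fun setT H by exact: measurable_restrict_itv.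
apply: (@le_trans _ _ (\int[mu]_x H (N%:R * x)%R)%E); last first.
  apply: le_trans (integral_scale n0 H0 mH) _; rewrite -[leRHS]mul1e; apply: lee_wpmul2r.
    by apply: integral_ge0.
  by rewrite lee_fin invf_le1// ler1n.
apply: ae_ge0_le_integral => //.
- by move=> x _; apply: erestrict_ge0.
- exact: measurable_restrict_itv.
- by apply: (measurableT_comp mH); exact: mulrl_measurable.
apply: ae_imp (halfline_gt0 R) => x x0 _; rewrite /H /patch.
case: ifPn => [|_]; last by case: ifP.
rewrite inE /= in_itv/= andbT => tx; rewrite mem_set/=; last by rewrite in_itv/= andbT ltr_pM2l.
apply: le_ereal_inf_tmp => _ [s [s0 fs] <-]; rewrite rearr_le//.
have := le_trans (dfun_fcopies N mf s0) fs; rewrite EFinM lee_pmul2l ?ltr0n//.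
Qed.

Lemma sum_L0LqD q f g : 0 < q -> sum_space L0 (L q%:E) f -> sum_space L0 (L q%:E) g ->
  sum_space L0 (L q%:E) (f \+ g).
Proof.
move=> q0 [a [b [La Lb ->]]] [a' [b' [La' Lb' ->]]].
exists (a \+ a'), (b \+ b'); split; [exact: L0D|exact: LpD|].
by apply/funext => x /=; rewrite addrACA.
Qed.

End tail_sufficiency.

(** * From the tail criterion to interpolation *)

Section tail_interpolation.
Context (R : realType).
Local Notation leb := (@lebesgue_measure R).
Local Notation mu := (halfline_measure R).
Local Notation dfun f s := (mu [set x | (s < `|f x|)%R]).
Local Notation K := (rank_cst R).
Implicit Types (f g F G U : R -> R) (p q c C l M t i B S : R) (n N : nat).
Lemma tail_majorized_fcopy q n f : 0 < q -> measurable_fun setT f ->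
  sum_space L0 (L q%:E) f ->
  sum_space L0 (L q%:E) (fcopy n f) /\ tail_majorized (abs_pow q (fcopy n f)) (abs_pow q f).
Proof.
move=> q0 mf sf; have mc := measurable_fcopy n mf; have mp := measurable_abs_pow q mf.
have sF := proj1 (sum_L0Lq_pow q0 mf) sf; have [_ _ Ffin] := sum_L0L1P sF.
have le t : (\int[leb]_(x in `]t, +oo[) rearrangement (abs_pow q (fcopy n f)) x <=
    \int[leb]_(x in `]t, +oo[) rearrangement (abs_pow q f) x)%E.
  apply: integral_rearr_mono; first exact: measurable_itv.
  by move=> x; rewrite (abs_pow_fcopy n f q0); exact: rearr_fcopy.
have sG : sum_space L0 (L 1%:E) (abs_pow q (fcopy n f)).
  apply: sum_L0L1_tail; first exact: measurable_abs_pow.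
  by move=> t t0; apply: le_lt_trans (le t) (Ffin t t0).
split; first exact: (proj2 (sum_L0Lq_pow q0 mc) sG).
by split; [exact: sG|exact: sF|move=> t _; exact: le].
Qed.

Lemma sum_fcopies q N f : 0 < q -> measurable_fun setT f -> sum_space L0 (L q%:E) f ->
  sum_space L0 (L q%:E) (fcopies N f).
Proof.
move=> q0 mf sf; elim: N => [|N IH].
  have -> : fcopies 0 f = cst 0 by apply/funext => x; rewrite /fcopies big_ord0.
  by apply: sum_spacel; [exact: L0_cst0|exact: Lp_cst0].
have -> : fcopies N.+1 f = fcopies N f \+ fcopy N f.
  by apply/funext => x; rewrite /fcopies big_ord_recr.
by apply: sum_L0LqD => //; have [] := tail_majorized_fcopy N q0 mf sf.
Qed.

Lemma tail_majorized_fcopies q N C f g : 0 < q -> (0 < N)%N -> 0 < C ->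
  measurable_fun setT f -> sum_space L0 (L q%:E) f -> measurable_fun setT g ->
  (forall t, 0 < t ->
    (\int[leb]_(x in `](N%:R * t)%R, +oo[) rearrangement (abs_pow q g) x <=
     C%:E * \int[leb]_(x in `]t, +oo[) rearrangement (abs_pow q f) x)%E) ->
  tail_majorized (abs_pow q g) (abs_pow q (fun x => C `^ q^-1 * fcopies N f x)).
Proof.
move=> q0 N0 C0 mf sf mg gf; have n0 : 0 < N%:R :> R by rewrite ltr0n.
have mN := measurable_fcopies N mf.
have /(sum_L0Lq_pow q0 mN)/sum_L0L1P[mF _ Ffin] := sum_fcopies N q0 mf sf.
set F := abs_pow q (fcopies N f) in mF Ffin.
have CF t : 0 < t -> (C%:E * \int[leb]_(x in `]t, +oo[) rearrangement F x < +oo)%E.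
  by move=> t0; rewrite lte_mul_pinfty ?lee_fin ?(ltW C0) ?Ffin.
have gF t : 0 < t -> (\int[leb]_(x in `]t, +oo[) rearrangement (abs_pow q g) x <=
    C%:E * \int[leb]_(x in `]t, +oo[) rearrangement F x)%E.
  move=> t0; have [u u0 ->] : exists2 u, 0 < u & t = N%:R * u.
    by exists (N%:R^-1 * t); rewrite ?mulr_gt0 ?invr_gt0// mulrA divff ?gt_eqF// mul1r.
  apply: le_trans (gf u u0) _; apply: lee_wpmul2l; first by rewrite lee_fin ltW.
  by rewrite /F (abs_pow_fcopies N f q0); apply: integral_fcopies => //; exact: measurable_abs_pow.
have sg : sum_space L0 (L 1%:E) (abs_pow q g).
  apply: sum_L0L1_tail; first exact: measurable_abs_pow.
  by move=> t t0; apply: le_lt_trans (gF t t0) (CF t t0).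
suff H u : u = (fun x => C * F x) -> tail_majorized (abs_pow q g) u.
  by apply: H; exact: (abs_pow_scale (fcopies N f) q0 (ltW C0)).
move=> ->; split; first exact: sg.
  apply: sum_L0L1_tail.
    by apply: measurable_funM; [exact: measurable_cst|exact: mF].
  by move=> t t0; rewrite integral_rearr_scale// CF.
by move=> t t0; rewrite integral_rearr_scale//; exact: gF.
Qed.

(** With f cut at f*(t), the big part has support of measure at most t, so its image vanishes off a
    set of measure at most C0 t. Off that set T f is the image of the small part, controlled in L_q;
    the exceptional set forces the dilation N. *)
Lemma tail_op_estimate q T : 0 < q -> bounded_on_couple L0 (L q%:E) T ->
  exists N (D : R), [/\ (0 < N)%N, 0 < D & forall f, sum_space L0 (L q%:E) f ->
    forall t, 0 < t ->
    (\int[leb]_(x in `](N%:R * t)%R, +oo[) rearrangement (abs_pow q (T f)) x <=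
     D%:E * \int[leb]_(x in `]t, +oo[) rearrangement (abs_pow q f) x)%E].
Proof.
move=> q0 [[TV _ Tlin] /bounded_L0P[C0 C00 To] /(bounded_LpP _ q0)[Cq Cq0 Tq]].
have k0 := rank_cst_ge0 R.
(* 4 is 2 from [rearr_tail_ub] times 2 from t = 2 u; C0 + 1 replaces C0 to be positive. *)
pose N := (Num.truncn (4 * (C0 + 1))).+1.
pose D := 6 * K * (Cq * (3 * K * 5)) + 1.
have D0 : 0 < D by rewrite ltr_wpDl// !mulr_ge0.
exists N, D; split => // f sf u u0; have [mf _] := proj1 (sum_L0LqP _ q0) sf.
have [mT _] := proj1 (sum_L0LqP _ q0) (TV _ sf).
have [mF fF Ffin] := sum_L0L1P (proj1 (sum_L0Lq_pow q0 mf) sf).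
have [_ fG _] := sum_L0L1P (proj1 (sum_L0Lq_pow q0 mT) (TV _ sf)).
(* The cut is made at 2 u because the term t F*(t) of [small_part_ub], with F = |f|^q, has to be
   absorbed by a tail integral, and only the one starting at t / 2 controls it. *)
have [t [t0 tu ut]] : exists t : R, [/\ 0 < t, t = 2 * u & u = t / 2].
  by exists (2 * u); split => //; [rewrite mulr_gt0|lra].
set F := abs_pow q f in mF fF Ffin *; pose lam := rearr F t; pose l := lam `^ q^-1.
have lam0 : 0 <= lam by exact: fine_rearr_ge0.
have l0 : 0 <= l by exact: powR_ge0.
have lq : l `^ q = lam by rewrite /l powR_root.
set b := big_part l f; set s := small_part l f.
have mb : measurable_fun setT b by exact: measurable_big_part.
have ms : measurable_fun setT s by exact: measurable_small_part.
have sI : (Ipow q s <= (3 * K)%:E * ((t * lam)%:E + \int[leb]_(x in `]t, +oo[) rearrangement F x))%E.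
  by rewrite -Ipow1_abs_pow (abs_pow_small f q0 l0) lq; exact: small_part_ub.
have Ls : L q%:E s.
  apply/(LpP _ q0); split=> //; apply: le_lt_trans sI _.
  by rewrite lte_mul_pinfty ?lee_fin ?mulr_ge0// lte_add_pinfty ?ltry ?Ffin.
have bS : (supp_measure b <= t%:E)%E.
  apply: (@le_trans _ _ (dfun F lam)); last by rewrite -fine_rearr_le.
  apply: le_measure; rewrite ?inE; [exact: measurable_neq0|exact: measurable_gt|].
  rewrite -lq => x /=; rewrite /b /big_part (ger0_norm (abs_pow_ge0 _ _ _)) /F /abs_pow.
  case: ifP => [lf _|]; last by rewrite eqxx.
  by apply: gt0_ltr_powR; rewrite ?nnegrE.
have Lb : L0 b by split => //; apply: le_lt_trans bS _; rewrite ltry.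
have [LTb Tb] := To b Lb; have [LTs Ts] := Tq s Ls.
have mTb : measurable_fun setT (T b) by case: LTb.
have mTs : measurable_fun setT (T s) by case/(LpP _ q0): LTs.
have sb : sum_space L0 (L q%:E) b by apply: sum_spacel; [|exact: Lp_cst0].
have ss : sum_space L0 (L q%:E) s by apply: sum_spacer; [exact: L0_cst0|].
have Tf := linear_big_small Tlin sb ss.
have C10 : 0 < C0 + 1 by rewrite ltr_wpDl.
have ct0 : 0 < (C0 + 1) * t by rewrite mulr_gt0.
apply: (@le_trans _ _ (\int[leb]_(x in `](2 * ((C0 + 1) * t))%R, +oo[) rearrangement (abs_pow q (T f)) x)%E).
  apply: integral_rearr_subset => //.
  move=> x /=; rewrite !in_itv/= !andbT; apply: le_lt_trans.
  rewrite tu (_ : 2 * _ = 4 * (C0 + 1) * u); last by ring.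
  by rewrite ler_pM2r//; apply: ltW; exact: truncnS_gt.
apply: (@le_trans _ _ ((6 * K)%:E * \int[mu]_x (abs_pow q (T s) x)%:E)%E).
  apply: (rearr_tail_ub (Z := [set x | T b x != 0])) => //.
  - exact: measurable_abs_pow.
  - exact: measurable_abs_pow.
  - exact: measurable_neq0.
  - by move=> x; exact: abs_pow_ge0.
  - apply: (le_trans Tb); apply: (@le_trans _ _ (C0%:E * t%:E)%E).
      by apply: lee_wpmul2l; rewrite ?lee_fin.
    by rewrite -EFinM lee_fin ler_pM2r// lerDl.
  apply: ae_imp Tf => x Tfx /negP; rewrite negbK => /eqP Tb0.
  by rewrite (ger0_norm (abs_pow_ge0 _ _ _)) /abs_pow Tfx Tb0 add0r.
have i0 : (0 <= \int[leb]_(x in `]u, +oo[) rearrangement F x)%E.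
  by apply: integral_ge0 => x _; exact: rearr_ge0.
have tl : ((t * lam)%:E <= 4%:E * \int[leb]_(x in `]u, +oo[) rearrangement F x)%E.
  have := rearr_tail_lb F t0; rewrite -ut rearrE// -/lam -EFinM => H.
  apply: (@le_trans _ _ (4%:E * (u * lam)%:E)%E); last exact: lee_wpmul2l.
  rewrite -EFinM lee_fin tu; apply: (@le_trans _ _ (2 * (u * lam))); first by rewrite mulrA.
  by rewrite ler_wpM2r ?mulr_ge0 ?(ltW u0)// ler_nat.
have tt : (\int[leb]_(x in `]t, +oo[) rearrangement F x <= \int[leb]_(x in `]u, +oo[) rearrangement F x)%E.
  apply: integral_rearr_subset => //.
  by move=> x /=; rewrite !in_itv/= !andbT; apply: lt_trans; rewrite tu; lra.
set I := integral _ _ _ in i0 tl tt *.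
have EI : (I = (fine I)%:E)%E by rewrite fineK// ge0_fin_numE ?Ffin.
set i := fine I in EI.
have ip : 0 <= i by rewrite -lee_fin -EI.
have sI2 : (Ipow q s <= (3 * K * (5 * i))%:E)%E.
  apply: (le_trans sI); rewrite (EFinM (3 * K) (5 * i)); apply: lee_wpmul2l; first by rewrite lee_fin mulr_ge0.
  rewrite (_ : 5 * i = 4 * i + i); last by ring.
  by rewrite EFinD; apply: leeD; [rewrite (EFinM 4 i) -EI|rewrite -EI].
apply: (@le_trans _ _ ((6 * K)%:E * (Cq * (3 * K * (5 * i)))%:E)%E).
  apply: lee_wpmul2l; first by rewrite lee_fin mulr_ge0.
  by apply: (le_trans Ts); rewrite EFinM; apply: lee_wpmul2l; rewrite ?lee_fin.
rewrite EI -!EFinM lee_fin -subr_ge0.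
by rewrite [leRHS](_ : _ = i)//; rewrite /D; ring.
Qed.

Section criterion.
Variables (E : fspace R) (hE : quasi_Banach_function_space E) (q c : R).
Hypotheses (q0 : 0 < q) (c0 : 0 < c) (Ec : tail_criterion E q c).

Lemma fcopy_qB n f : E f -> sum_space L0 (L q%:E) f ->
  E (fcopy n f) /\ qnorm E (fcopy n f) <= c * qnorm E f.
Proof.
move=> Ef sf; have mf := qB_measurable hE Ef.
have [sc cf] := tail_majorized_fcopy n q0 mf sf; exact: Ec.
Qed.

(** Each single copy lies in E by the tail criterion itself; the quasi-triangle inequality is
    applied N times. *)
Lemma fcopies_qB N : exists2 k, 0 < k & forall f, E f -> sum_space L0 (L q%:E) f ->
  E (fcopies N f) /\ qnorm E (fcopies N f) <= k * qnorm E f.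
Proof.
have [K' triK] := qB_quasi_triangle hE.
elim: N => [|N [k k0 IH]].
  exists 1 => // f Ef _; have -> : fcopies 0 f = cst 0.
    by apply/funext => x; rewrite /fcopies big_ord0.
  split; first exact: (qB_zero hE).
  have -> : cst 0 = (fun x : R => 0 * f x) by apply/funext => x; rewrite mul0r.
  by rewrite (qB_homogeneous hE)// normr0 mul0r mul1r (qB_ge0 hE).
exists (`|K'| * (k + c) + 1); first by rewrite ltr_wpDl// mulr_ge0// addr_ge0// ltW.
move=> f Ef sf; have [EN nN] := IH f Ef sf; have [Ec' nc] := fcopy_qB N Ef sf.
have -> : fcopies N.+1 f = fcopies N f \+ fcopy N f.
  by apply/funext => x; rewrite /fcopies big_ord_recr.
split.
  have := qB_linear hE 1 EN Ec'; congr (carrier E _).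
  by apply/funext => x; rewrite mul1r.
apply: le_trans (triK _ _ EN Ec') _.
have f0 := qB_ge0 hE Ef.
apply: (@le_trans _ _ (`|K'| * (k * qnorm E f + c * qnorm E f))); last first.
  by rewrite -mulrDl mulrA [leRHS]mulrDl lerDl mul1r.
apply: (@le_trans _ _ (`|K'| * (qnorm E (fcopies N f) + qnorm E (fcopy N f)))).
  by rewrite ler_wpM2r ?addr_ge0 ?(qB_ge0 hE)// ler_norm.
by rewrite ler_wpM2l// lerD.
Qed.

Lemma tail_criterion_scale N : (0 < N)%N -> exists2 k, 0 < k & forall C f g, 0 < C ->
  E f -> sum_space L0 (L q%:E) f -> measurable_fun setT g ->
  (forall t, 0 < t ->
    (\int[leb]_(x in `](N%:R * t)%R, +oo[) rearrangement (abs_pow q g) x <=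
     C%:E * \int[leb]_(x in `]t, +oo[) rearrangement (abs_pow q f) x)%E) ->
  E g /\ qnorm E g <= k * (C `^ q^-1 * qnorm E f).
Proof.
move=> N0; have [k k0 kP] := fcopies_qB N; exists (c * k); first exact: mulr_gt0.
move=> C f g C0 Ef sf mg gf; have mf := qB_measurable hE Ef.
have [EN nN] := kP f Ef sf; have gm := tail_majorized_fcopies q0 N0 C0 mf sf mg gf.
have d0 : 0 <= C `^ q^-1 by exact: powR_ge0.
have dE := qB_scale hE (C `^ q^-1) EN.
have [|Eg gc] := Ec dE _ gm; first by apply/(sum_L0Lq_pow q0 mg); case: gm.
split => //; apply: (le_trans gc); rewrite (qB_homogeneous hE)// (ger0_norm d0).
by rewrite -mulrA ler_wpM2l ?(ltW c0)// mulrCA ler_wpM2l.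
Qed.

(** Tail counterpart of [head_embed]. N is chosen with N t0 > S, so that for t > t0 the tail of g
    beyond N t vanishes; for t <= t0 the total integral of |g|^q is compared with i. *)
Lemma tail_embed t0 S : 0 < t0 -> 0 <= S -> exists2 k, 0 < k & forall f g B i,
  E f -> sum_space L0 (L q%:E) f -> 0 < i ->
  (i%:E <= \int[leb]_(x in `]t0, +oo[) rearrangement (abs_pow q f) x)%E ->
  measurable_fun setT g -> (supp_measure g <= S%:E)%E -> 0 < B ->
  (Ipow q g <= B%:E)%E ->
  E g /\ qnorm E g <= k * ((3 * K * B / i) `^ q^-1 * qnorm E f).
Proof.
move=> t00 S0; pose N := (Num.truncn (S / t0)).+1.
have [k k0 kP] := @tail_criterion_scale N isT; exists k => // f g B i Ef sf i0 iF mg gS B0 gI.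
have K0 := rank_cst_gt0 R; have mG := measurable_abs_pow q mg.
have gL : L q%:E g by apply/(LpP _ q0); split => //; apply: le_lt_trans gI _; rewrite ltry.
have /(sum_L0Lq_pow q0 mg)/sum_L0L1P[_ fG _] := sum_spacer (@L0_cst0 R) gL.
have D0 : 0 < 3 * K * B / i by rewrite divr_gt0 ?mulr_gt0.
have NS : S < N%:R * t0 by rewrite -ltr_pdivrMr//; exact: truncnS_gt.
apply: kP => // t tp; have nt0 : 0 < N%:R * t by rewrite mulr_gt0.
have [tt|tt] := leP t t0.
  apply: (@le_trans _ _ ((3 * K)%:E * Ipow 1 (abs_pow q g))%E).
    apply: le_trans (integral_rearr_le mG fG); rewrite (integral_tail_fin fG (ltW nt0)).
    apply: ge0_subset_integral => //; first exact: measurable_erearr.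
    by move=> x _; rewrite lee_fin fine_rearr_ge0.
  apply: (@le_trans _ _ ((3 * K * B / i)%:E * i%:E)%E).
    rewrite Ipow1_abs_pow -EFinM divfK ?gt_eqF// (EFinM (3 * K) B).
    by apply: lee_wpmul2l => //; rewrite lee_fin mulr_ge0// ltW.
  apply: lee_wpmul2l; first by rewrite lee_fin ltW.
  apply: (le_trans iF); apply: integral_rearr_subset => //.
  by move=> x /=; rewrite !in_itv/= !andbT; exact: le_lt_trans.
rewrite integral0_eq.
  by rewrite mule_ge0 ?lee_fin ?(ltW D0)// integral_ge0// => x _; exact: rearr_ge0.
move=> x /=; rewrite in_itv/= andbT => tx; apply/eqP; rewrite eq_le rearr_ge0 andbT rearr_le//.
apply: (@le_trans _ _ (supp_measure g)).
  apply: le_measure; rewrite ?inE; [exact: measurable_gt|exact: measurable_neq0|].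
  move=> y /=; rewrite (ger0_norm (abs_pow_ge0 _ _ _)) /abs_pow => gy.
  by apply/eqP => g0; move: gy; rewrite g0 normr0 powR0 ?gt_eqF// ltxx.
apply: (le_trans gS); rewrite lee_fin; apply/ltW; apply: (lt_trans NS); apply: lt_trans tx.
by rewrite ltr_pM2l.
Qed.

Lemma trunc_tail n f : measurable_fun setT f -> sum_space L0 (L q%:E) (trunc n f).
Proof.
move=> mf; apply: sum_spacer; first exact: L0_cst0.
by apply/(LpP _ q0); split; [exact: measurable_trunc|exact: Ipow_trunc].
Qed.

Lemma tail_seed : nontrivial E -> exists f t i, [/\ E f, sum_space L0 (L q%:E) f,
  0 < t, 0 < i & (i%:E <= \int[leb]_(x in `]t, +oo[) rearrangement (abs_pow q f) x)%E].
Proof.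
move=> [f Ef f0]; have mf := qB_measurable hE Ef.
have [t [t0 t1 Ft]] := nontrivial_rearr q0 mf f0.
have t20 : 0 < t / 2 by rewrite divr_gt0.
have : (0 < \int[leb]_(x in `](t / 2)%R, +oo[) rearrangement (abs_pow q f) x)%E.
  by apply: lt_le_trans (rearr_tail_lb _ t0); exact: mule_gt0.
rewrite ltNge => I0; apply: contrapT => H; apply: (negP I0).
apply: integral_trunc_sup => // n; rewrite leNgt; apply/negP => In; apply: H.
have sn := trunc_tail n mf.
have [_ _ /(_ _ t20) Ify] := sum_L0L1P (proj1 (sum_L0Lq_pow q0 (measurable_trunc n mf)) sn).
have [i i0 [Ei _]] := ereal_gt0_fin In Ify.
by exists (trunc n f), (t / 2), i; split; [exact: (proj1 (qB_trunc hE n Ef))|exact: sn|exact: t20|exact: i0|exact: Ei].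
Qed.

Lemma tail_small : nontrivial E -> forall f, L0 f -> L q%:E f -> E f.
Proof.
move=> /tail_seed[f [t [i [Ef sf t0 i0 iF]]]] g [mg gS] /(LpP _ q0)[_ gI].
have [J EJ] : exists J, (Ipow q g = J%:E)%E.
  by exists (fine (Ipow q g)); rewrite fineK// ge0_fin_numE// Ipow_ge0.
have J0 : 0 <= J by rewrite -lee_fin -EJ Ipow_ge0.
have [S ES] : exists S, (supp_measure g = S%:E)%E.
  by exists (fine (supp_measure g)); rewrite fineK// ge0_fin_numE.
have S0 : 0 <= S by rewrite -lee_fin -ES.
have [k k0 kP] := tail_embed t0 S0.
have [] // := kP f g (J + 1) i Ef sf i0 iF mg.
- by rewrite ES.
- by rewrite ltr_wpDl.
by rewrite EJ lee_fin lerDl.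
Qed.

(** Same test function as in [head_large], but each t has its own constant: membership in the sum
    asks only that every tail integral be finite. *)
Lemma tail_large : nontrivial E -> forall f, E f -> sum_space L0 (L q%:E) f.
Proof.
move=> nE f Ef; have mf := qB_measurable hE Ef.
have [mchi _ chiI chi0] := chi_props q0; set chi : R -> R := \1_(_) in mchi chiI chi0.
have chiS : (supp_measure chi <= 1%:E)%E.
  have <- : mu `]0%R, 1%R[%classic = 1%:E by rewrite halfline_itv// subr0.
  apply: le_measure; rewrite ?inE//; first exact: measurable_neq0.
  by move=> x /=; rewrite /chi indicE; case: (boolP (x \in _)); rewrite ?inE// eqxx.
have Echi : E chi.
  apply: (tail_small nE); first by split => //; apply: (le_lt_trans chiS); rewrite ltry.
  by apply/(LpP _ q0); split => //; apply: (le_lt_trans chiI); rewrite ltry.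
have chin : 0 < qnorm E chi.
  rewrite lt_neqAle (qB_ge0 hE Echi) andbT; apply/negP => /eqP n0.
  by apply: chi0; apply: (qB_definite hE).
have c3 : 0 <= 3 * K by rewrite mulr_ge0 ?rank_cst_ge0.
apply/(sum_L0Lq_pow q0 mf); apply: sum_L0L1_tail; first exact: measurable_abs_pow.
move=> t t0; have [k k0 kP] := tail_embed t0 (@ler01 R).
have kf0 : 0 <= k * qnorm E f by rewrite mulr_ge0 ?(ltW k0) ?(qB_ge0 hE).
apply: (@le_lt_trans _ _ (3 * K * ((k * qnorm E f) `^ q / qnorm E chi `^ q))%:E); last by rewrite ltry.
apply: integral_trunc_sup => // n; have sn := trunc_tail n mf.
have [_ _ /(_ _ t0)] := sum_L0L1P (proj1 (sum_L0Lq_pow q0 (measurable_trunc n mf)) sn).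
have : (0 <= \int[leb]_(x in `]t, +oo[) rearrangement (abs_pow q (trunc n f)) x)%E.
  by apply: integral_ge0 => x _; exact: rearr_ge0.
rewrite le_eqVlt => /predU1P[<- _|I0 Ify].
  by rewrite lee_fin mulr_ge0// divr_ge0 ?powR_ge0.
have [i1 i10 [iI Ii]] := ereal_gt0_fin I0 Ify.
have [En nn] := qB_trunc hE n Ef.
have [_] := kP (trunc n f) chi 1 i1 En sn i10 iI mchi chiS ltr01 chiI.
rewrite mulr1 => H; apply: (le_trans Ii); rewrite lee_fin; apply: (root_bound q0) => //.
rewrite mulrCA; apply: (le_trans H); rewrite ler_wpM2l ?(ltW k0)//.
by rewrite ler_wpM2l ?powR_ge0.
Qed.

Lemma tail_bounded T : nontrivial E -> bounded_on_couple L0 (L q%:E) T -> bounded_on E T.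
Proof.
move=> nE Tb; have [N [D [N0 D0 TD]]] := tail_op_estimate q0 Tb.
have [k k0 kP] := tail_criterion_scale N0.
exists (k * D `^ q^-1) => f Ef; rewrite -mulrA; have sf := tail_large nE Ef.
apply: kP => //; last exact: TD.
by have [[TV _ _] _ _] := Tb; have [] := proj1 (sum_L0LqP _ q0) (TV _ sf).
Qed.

Lemma tail_interpolation : nontrivial E -> interpolation_space L0 (L q%:E) E.
Proof.
move=> nE; split; [exact: tail_small|exact: tail_large|].
by move=> T; exact: tail_bounded.
Qed.

End criterion.
End tail_interpolation.

(** * The couple (L_p, L_q) *)

Section two_exponents.
Context (R : realType).
Local Notation leb := (@lebesgue_measure R).
Local Notation mu := (halfline_measure R).
Local Notation dfun f s := (mu [set x | (s < `|f x|)%R]).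
Implicit Types (f g F G U : R -> R) (c C l M t i B S : R) (n N : nat).

Lemma rearr_fin_pow p f : 0 < p -> measurable_fun setT f ->
  rearr_fin (abs_pow p f) -> rearr_fin f.
Proof.
move=> p0 mf fF; apply: rearr_finP => // t t0.
have l0 := fine_rearr_ge0 (abs_pow p f) t.
exists (rearr (abs_pow p f) t `^ p^-1); first exact: powR_ge0.
rewrite -(dfun_abs_pow f p0 (powR_ge0 _ _)) (powR_root p0 l0).
by rewrite -fine_rearr_le//; exact: measurable_abs_pow.
Qed.

Lemma rearr_pow p f t : 0 < p -> measurable_fun setT f -> rearr_fin (abs_pow p f) ->
  0 < t -> rearr (abs_pow p f) t = rearr f t `^ p.
Proof.
move=> p0 mf fF t0; have ff := rearr_fin_pow p0 mf fF.
have mF := measurable_abs_pow p mf.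
apply/eqP; rewrite eq_le; apply/andP; split.
  rewrite fine_rearr_le ?powR_ge0// dfun_abs_pow ?fine_rearr_ge0//.
  by rewrite -fine_rearr_le// fine_rearr_ge0.
have l0 := fine_rearr_ge0 (abs_pow p f) t.
rewrite -[leRHS](powR_root p0 l0); apply: ge0_ler_powR; rewrite ?nnegrE ?powR_ge0 ?(ltW p0) ?fine_rearr_ge0//.
rewrite fine_rearr_le ?powR_ge0// -(dfun_abs_pow f p0 (powR_ge0 _ _)) powR_root//.
by rewrite -fine_rearr_le.
Qed.

Lemma rearr_tail_split G t u : measurable_fun setT G -> rearr_fin G -> 0 < t -> t <= u ->
  (\int[leb]_(x in `]t, +oo[) rearrangement G x <=
   (u * rearr G t)%:E + \int[leb]_(x in `]u, +oo[) rearrangement G x)%E.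
Proof.
move=> mG fG t0 tu; have u0 := lt_le_trans t0 tu; have l0 := fine_rearr_ge0 G t.
rewrite (integral_tail_fin fG (ltW t0)) (integral_tail_fin fG (ltW u0)).
have -> : ((u * rearr G t)%:E = \int[mu]_(x in `]-oo, u]) (rearr G t)%:E)%E.
  by rewrite integral_cst// [X in (_ * X)%E]halfline_Ny_itv ?(ltW u0)// -EFinM mulrC.
rewrite integral_mkcond [X in (_ <= X + _)%E]integral_mkcond [X in (_ <= _ + X)%E]integral_mkcond.
have mr := measurable_erearr G.
have p1 x : (0 <= ((fun=> (rearr G t)%:E) \_ `]-oo, u]) x)%E.
  by apply: erestrict_ge0 => y _; rewrite lee_fin.
have p2 a x : (0 <= ((fun x => (rearr G x)%:E) \_ `]a, +oo[) x)%E.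
  by apply: erestrict_ge0 => y _; rewrite lee_fin fine_rearr_ge0.
have mc : measurable_fun setT ((fun=> (rearr G t)%:E) \_ `]-oo, u] : R -> \bar R).
  by apply: measurable_restrict_itv; exact: measurable_cst.
rewrite -ge0_integralD//; last exact: measurable_restrict_itv.
apply: ge0_le_integral => //.
- exact: measurable_restrict_itv.
- by apply: emeasurable_funD => //; exact: measurable_restrict_itv.
move=> x _; have [xt|tx] := leP x t.
  rewrite [leLHS]/patch memNset ?adde_ge0//= in_itv/= andbT => tx.
  by move: xt; rewrite leNgt tx.
have [xu|ux] := leP x u.
  apply: (@le_trans _ _ (((fun=> (rearr G t)%:E) \_ `]-oo, u]) x + 0)%E); last exact: leeD2l.
  rewrite adde0 /patch mem_set/= ?in_itv/= ?tx// mem_set/= ?in_itv//= lee_fin.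
  by apply: fine_rearr_nincr => //; exact: ltW.
apply: (@le_trans _ _ (0 + ((fun x => (rearr G x)%:E) \_ `]u, +oo[) x)%E); last exact: leeD2r.
by rewrite add0e /patch mem_set/= ?in_itv/= ?tx// mem_set//= in_itv/= andbT.
Qed.

Lemma big_part_L0 p l f : 0 < p -> 0 < l -> L p%:E f -> L0 (big_part l f).
Proof.
move=> p0 l0 /(LpP _ p0)[mf fI]; split; first exact: measurable_big_part.
have lp : 0 < l `^ p by exact: powR_gt0.
apply: (@le_lt_trans _ _ (dfun f l)).
  apply: le_measure; rewrite ?inE; [|exact: measurable_gt|].
    by apply: measurable_neq0; exact: measurable_big_part.
  by move=> x /=; rewrite /big_part; case: ifP => //; rewrite eqxx.
have := le_lt_trans (Ipow_chebyshev (ltW p0) (ltW l0) mf) fI.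
by rewrite !ltey; apply: contra => /eqP ->; rewrite gt0_muley.
Qed.

Section exponents.
Variables (p q : R).
Hypotheses (p0 : 0 < p) (pq : p < q).

Let q0 : 0 < q. Proof. exact: lt_trans pq. Qed.
Let d0 : 0 <= q - p. Proof. by rewrite subr_ge0 ltW. Qed.

Lemma powR_split y : 0 <= y -> y `^ q = y `^ p * y `^ (q - p).
Proof.
move=> y0; rewrite -powRD ?subrKC//; apply/implyP => /eqP qp.
by move: q0; rewrite qp ltxx.
Qed.

(** With [powR_down], exchanges the two exponents at the level k: above k the power p is bounded by
    the power q, below k the converse. *)
Lemma powR_up (y k : R) : 0 <= y -> 0 < k -> y `^ p <= k `^ p + (k `^ (q - p))^-1 * y `^ q.
Proof.
move=> y0 k0; have kd : 0 < k `^ (q - p) by exact: powR_gt0.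
have [yk|ky] := leP y k.
  rewrite -[leLHS]addr0 lerD ?mulr_ge0 ?invr_ge0 ?powR_ge0//.
  by apply: ge0_ler_powR; rewrite ?nnegrE// ltW.
rewrite -[leLHS]add0r lerD ?powR_ge0// powR_split// mulrCA ler_peMr ?powR_ge0//.
rewrite -ler_pdivrMl ?invr_gt0// invrK mulr1.
by apply: ge0_ler_powR; rewrite ?nnegrE// ltW.
Qed.

Lemma powR_down (y k : R) : 0 <= y -> 0 <= k -> y <= k -> y `^ q <= k `^ (q - p) * y `^ p.
Proof.
move=> y0 k0 yk; rewrite powR_split// mulrC ler_wpM2r ?powR_ge0//.
by apply: ge0_ler_powR; rewrite ?nnegrE.
Qed.

Lemma big_part_Lq l f : 0 < l -> L q%:E f -> L p%:E (big_part l f).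
Proof.
move=> l0 /(LpP _ q0)[mf fI]; apply/(LpP _ p0); split; first exact: measurable_big_part.
have ld : 0 < l `^ (q - p) by exact: powR_gt0.
apply: (@le_lt_trans _ _ (((l `^ (q - p))^-1)%:E * Ipow q f)%E); last first.
  by rewrite lte_mul_pinfty ?lee_fin ?invr_ge0 ?powR_ge0.
rewrite /Ipow -ge0_integralZl_EFin//; last 2 first.
- exact: measurable_eabs_pow.
- by rewrite invr_ge0 powR_ge0.
apply: ge0_le_integral => //.
- by apply: measurable_eabs_pow; exact: measurable_big_part.
- by apply: measurable_funeM; exact: measurable_eabs_pow.
move=> x _; rewrite -EFinM lee_fin /big_part; case: ifPn => [lf|_]; last first.
  by rewrite normr0 powR0 ?gt_eqF// mulr_ge0 ?invr_ge0 ?powR_ge0.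
rewrite ler_pdivlMl// powR_split// mulrC ler_wpM2l ?powR_ge0//.
by apply: ge0_ler_powR; rewrite ?nnegrE// ltW.
Qed.

Lemma bounded_Lq l f : 0 <= l -> {ae mu, forall x, `|f x| <= l} -> L p%:E f -> L q%:E f.
Proof.
move=> l0 fl /(LpP _ p0)[mf fI]; apply/(LpP _ q0); split; first exact: mf.
apply: (@le_lt_trans _ _ ((l `^ (q - p))%:E * Ipow p f)%E); last first.
  by rewrite lte_mul_pinfty ?lee_fin ?powR_ge0.
rewrite /Ipow -ge0_integralZl_EFin ?powR_ge0//; last exact: measurable_eabs_pow.
apply: ae_ge0_le_integral => //.
- exact: measurable_eabs_pow.
- by move=> x _; rewrite mule_ge0 ?lee_fin ?powR_ge0.
- by apply: measurable_funeM; exact: measurable_eabs_pow.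
by apply: ae_imp fl => x fx _; rewrite -EFinM lee_fin powR_down.
Qed.

Lemma small_part_Lp l f : 0 < l -> L p%:E f -> L q%:E (small_part l f).
Proof.
move=> l0 Lf; have [mf fI] := proj1 (LpP f p0) Lf.
have ms := measurable_small_part l mf.
apply: (bounded_Lq (ltW l0)).
  by apply: aeW => x; rewrite /small_part; case: ltP => // _; rewrite normr0 ltW.
apply/(LpP _ p0); split; [exact: ms|apply: le_lt_trans fI; apply: Ipow_le => //; first exact: ltW].
by move=> x; rewrite /small_part; case: ifP => // _; rewrite normr0.
Qed.

Lemma small_part_Loo l f : 0 <= l -> measurable_fun setT f -> L +oo%E (small_part l f).
Proof.
move=> l0 mf; apply/LooP; split; first exact: measurable_small_part.
by exists l; apply: aeW => x; rewrite /small_part; case: ltP => // _; rewrite normr0.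
Qed.

Lemma sum_LpLq_head f : sum_space (L p%:E) (L q%:E) f -> sum_space (L p%:E) (L +oo%E) f.
Proof.
move=> [a [b [La Lb ->]]]; have [mb _] := proj1 (LpP b q0) Lb.
exists (a \+ big_part 1 b), (small_part 1 b); split.
- by apply: LpD => //; exact: big_part_Lq.
- exact: small_part_Loo.
by rewrite -{1}(big_small 1 b); apply/funext => x /=; rewrite addrA.
Qed.

Lemma sum_LpLq_tail f : sum_space (L p%:E) (L q%:E) f -> sum_space L0 (L q%:E) f.
Proof.
move=> [a [b [La Lb ->]]].
exists (big_part 1 a), (small_part 1 a \+ b); split.
- exact: (big_part_L0 p0).
- by apply: LpD => //; exact: small_part_Lp.
by rewrite -{1}(big_small 1 a); apply/funext => x /=; rewrite addrA.
Qed.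

(** Above l the function is in L_p. The rest is bounded by l on a set of finite measure where |f| >
    m, and has a q-integrable part below m, so it is in L_q. *)
Lemma sum_LpLq_both f : sum_space (L p%:E) (L +oo%E) f -> sum_space L0 (L q%:E) f ->
  sum_space (L p%:E) (L q%:E) f.
Proof.
move=> /(sum_LpLooP _ p0)[mf [l l0 fl]] /(sum_L0LqP _ q0)[_ [m [m0 dm fm]]].
have ms := measurable_small_part l mf; have mb := measurable_big_part l mf.
have sf x : `|small_part l f x| <= `|f x|.
  by rewrite /small_part; case: ifP => // _; rewrite normr0.
exists (big_part l f), (big_part m (small_part l f) \+ small_part m (small_part l f)); split.
- exact/(LpP _ p0).
- apply: LpD => //; apply/(LpP _ q0); split; try exact: measurable_big_part; try exact: measurable_small_part.
    apply: (@le_lt_trans _ _ ((l `^ q)%:E * dfun f m)%E); last first.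
      by rewrite lte_mul_pinfty ?lee_fin ?powR_ge0.
    apply: Ipow_bounded; rewrite ?powR_ge0 ?(ltW q0)//; [exact: measurable_gt|exact: measurable_big_part|].
    move=> x; rewrite (indic_bool (fun y => m < `|f y|)) /big_part.
    case: ifPn => [ms'|_]; last by rewrite normr0 powR0 ?gt_eqF// mulr_ge0 ?powR_ge0.
    rewrite (lt_le_trans ms' (sf x)) mulr1; apply: ge0_ler_powR; rewrite ?nnegrE ?(ltW q0)//.
    by rewrite /small_part; case: ltP => // _; rewrite normr0.
  apply: le_lt_trans fm; apply: Ipow_le; rewrite ?(ltW q0)//; try exact: measurable_small_part.
  move=> x; rewrite /small_part; case: (ltP l `|f x|) => lf; last by [].
  by case: ifP => _; rewrite normr0.
by rewrite big_small big_small.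
Qed.

End exponents.
End two_exponents.

(** * Operators bounded on both exponents *)

Section couple_estimate.
Context (R : realType).
Local Notation leb := (@lebesgue_measure R).
Local Notation mu := (halfline_measure R).
Local Notation K := (rank_cst R).
Implicit Types (f g F G U : R -> R) (c C l M t i B S : R) (n N : nat).

Section estimate.
Variables (p q : R).
Hypotheses (p0 : 0 < p) (pq : p < q).

Let q0 : 0 < q. Proof. exact: lt_trans pq. Qed.

Local Notation Hd f t := (\int[leb]_(x in `]0%R, t[) rearrangement (abs_pow p f) x)%E.
Local Notation Tl f t := (\int[leb]_(x in `]t, +oo[) rearrangement (abs_pow q f) x)%E.

Lemma sum_LpLq_facts f : sum_space (L p%:E) (L q%:E) f ->
  [/\ measurable_fun setT f, rearr_fin (abs_pow p f), rearr_fin (abs_pow q f),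
      forall t, 0 < t -> (Hd f t < +oo)%E & forall t, 0 < t -> (Tl f t < +oo)%E].
Proof.
move=> sf; have sh := sum_LpLq_head p0 pq sf; have st := sum_LpLq_tail p0 pq sf.
have [mf _] := proj1 (sum_LpLooP f p0) sh.
have [_ fp hp] := sum_L1LooP (proj1 (sum_LpLoo_pow p0 mf) sh).
have [_ fq tq] := sum_L0L1P (proj1 (sum_L0Lq_pow q0 mf) st).
by split.
Qed.

(** The common level k makes the two exponents homogeneous: for each of the two estimates, the image
    whose exponent is wrong is converted at level k by [powR_up] or [powR_down]. *)
Lemma couple_estimate T : bounded_on_couple (L p%:E) (L q%:E) T ->
  exists2 C, 0 < C & forall f t k, sum_space (L p%:E) (L q%:E) f -> 0 < t -> 0 < k ->
    (Hd f t <= (t * k `^ p)%:E)%E -> (Tl f t <= (t * k `^ q)%:E)%E ->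
    (Hd (T f) t <= (C * (t * k `^ p))%:E)%E /\ (Tl (T f) t <= (C * (t * k `^ q))%:E)%E.
Proof.
move=> [[TV _ Tlin] /(bounded_LpP _ p0)[Cp Cp0 Tp] /(bounded_LpP _ q0)[Cq Cq0 Tq]].
have K0 := rank_cst_gt0 R.
pose a := Cp * (3 * K) + Cq * (6 * K).
have a0 : 0 <= a by rewrite addr_ge0 ?mulr_ge0// ltW.
have p20 : 0 < 2 `^ p :> R by rewrite powR_gt0.
have q20 : 0 < 2 `^ q :> R by rewrite powR_gt0.
pose c1 := K * (2 `^ p * (3 * a + 1)).
have c10 : 0 < c1 by rewrite !mulr_gt0// ltr_wpDl// mulr_ge0.
pose c2 := 2 * (a + 1) * (c1 `^ p^-1) `^ q + 6 * K * (2 `^ q * a).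
have q2 := ltW q20; have p2 := ltW p20; have KK := ltW K0.
have a10 : 0 <= a + 1 by rewrite addr_ge0.
have c20 : 0 <= c2.
  by apply: addr_ge0; apply: mulr_ge0; rewrite ?powR_ge0//; apply: mulr_ge0.
exists (c1 + c2); first by rewrite ltr_pwDl.
move=> f t k sf t0 k0 Hf Lf; have [mf fp fq _ _] := sum_LpLq_facts sf.
have [mT gp gq _ _] := sum_LpLq_facts (TV _ sf).
have ff := rearr_fin_pow p0 mf fp; have fg := rearr_fin_pow p0 mT gp.
have mFp := measurable_abs_pow p mf; have mFq := measurable_abs_pow q mf.
have kp0 : 0 < k `^ p by rewrite powR_gt0.
have kq0 : 0 < k `^ q by rewrite powR_gt0.
(* The exchange rate between t k^p and t k^q. *)
pose D := k `^ (q - p); have D0 : 0 < D by rewrite powR_gt0.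
have Dk : D * k `^ p = k `^ q by rewrite mulrC -(powR_split p0 pq (ltW k0)).
pose l := rearr f t; have l0 : 0 <= l by exact: fine_rearr_ge0.
have lp : rearr (abs_pow p f) t = l `^ p by exact: rearr_pow.
have lq : rearr (abs_pow q f) t = l `^ q by exact: rearr_pow.
have root_le (x y : R) : 0 <= x -> 0 <= y -> x `^ p <= y `^ p -> x <= y.
  move=> x0 y0; rewrite !leNgt; apply: contra; apply: gt0_ltr_powR; rewrite ?nnegrE//.
have lk : l <= k.
  apply: root_le => //; first exact: ltW.
  have := le_trans (rearr_head_lb (abs_pow p f) t0) Hf.
  by rewrite rearrE// lp -EFinM lee_fin ler_pM2l.
have lkq : l `^ q <= k `^ q by apply: ge0_ler_powR; rewrite ?nnegrE ?(ltW q0) ?(ltW k0).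
set b := big_part l f; set s := small_part l f.
have mb : measurable_fun setT b by exact: measurable_big_part.
have ms : measurable_fun setT s by exact: measurable_small_part.
have tkp : 0 <= t * k `^ p by rewrite mulr_ge0// ltW.
have tkq : 0 <= t * k `^ q by rewrite mulr_ge0// ltW.
have bI : (Ipow p b <= (3 * K * (t * k `^ p))%:E)%E.
  rewrite -Ipow1_abs_pow (abs_pow_big f p0 l0) -lp.
  apply: le_trans (big_part_ub mFp fp t0) _; rewrite (EFinM (3 * K)).
  by apply: lee_wpmul2l => //; rewrite lee_fin mulr_ge0// ltW.
have sI : (Ipow q s <= (6 * K * (t * k `^ q))%:E)%E.
  rewrite -Ipow1_abs_pow (abs_pow_small f q0 l0) -lq.
  apply: le_trans (small_part_ub mFq fq t0) _.
  rewrite (_ : 6 * K * (t * k `^ q) = 3 * K * (t * k `^ q + t * k `^ q)); last by ring.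
  rewrite (EFinM (3 * K)); apply: lee_wpmul2l; first by rewrite lee_fin mulr_ge0// ltW.
  by rewrite EFinD; apply: leeD => //; rewrite lee_fin ler_pM2l// lq.
have Lb : L p%:E b by apply/(LpP _ p0); split; [exact: mb|apply: le_lt_trans bI _; rewrite ltry].
have Ls : L q%:E s by apply/(LpP _ q0); split; [exact: ms|apply: le_lt_trans sI _; rewrite ltry].
have [LTb Tb] := Tp b Lb; have [LTs Ts] := Tq s Ls.
have mTb : measurable_fun setT (T b) by case/(LpP _ p0): LTb.
have mTs : measurable_fun setT (T s) by case/(LpP _ q0): LTs.
have sb : sum_space (L p%:E) (L q%:E) b by apply: sum_spacel; [|exact: Lp_cst0].
have ss : sum_space (L p%:E) (L q%:E) s by apply: sum_spacer; [exact: Lp_cst0|].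
have Tf := linear_big_small Tlin sb ss.
have {}Tb : (Ipow p (T b) <= (Cp * (3 * K) * (t * k `^ p))%:E)%E.
  apply: (le_trans Tb); rewrite -(mulrA Cp) (EFinM Cp).
  by apply: lee_wpmul2l; rewrite ?lee_fin.
have {}Ts : (Ipow q (T s) <= (Cq * (6 * K) * (t * k `^ q))%:E)%E.
  apply: (le_trans Ts); rewrite -(mulrA Cq) (EFinM Cq).
  by apply: lee_wpmul2l; rewrite ?lee_fin.
have wsum (u v w : R) : 0 <= u -> 0 <= v -> 0 <= w ->
    (\int[mu]_x (w * (u * abs_pow p (T b) x + v * abs_pow q (T s) x))%:E <=
     (w * (u * (Cp * (3 * K) * (t * k `^ p)) + v * (Cq * (6 * K) * (t * k `^ q))))%:E)%E.
  move=> u0 v0 w0; have mp := measurable_eabs_pow p mTb; have mq := measurable_eabs_pow q mTs.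
  have -> : (\int[mu]_x (w * (u * abs_pow p (T b) x + v * abs_pow q (T s) x))%:E =
      w%:E * (u%:E * Ipow p (T b) + v%:E * Ipow q (T s)))%E.
    rewrite /Ipow -ge0_integralZl_EFin// -[X in (_ + X)%E]ge0_integralZl_EFin//.
    rewrite -ge0_integralD//; last 4 first.
    - by move=> x _; rewrite mule_ge0 ?lee_fin ?powR_ge0.
    - exact: measurable_funeM.
    - by move=> x _; rewrite mule_ge0 ?lee_fin ?powR_ge0.
    - exact: measurable_funeM.
    rewrite -ge0_integralZl_EFin//.
    - by move=> x _; rewrite adde_ge0 ?mule_ge0 ?lee_fin ?powR_ge0.
    - by apply: emeasurable_funD; exact: measurable_funeM.
  rewrite (EFinM w) EFinD (EFinM u) (EFinM v); apply: lee_wpmul2l; first by rewrite lee_fin.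
  by apply: leeD; apply: lee_wpmul2l; rewrite ?lee_fin.
have mU (u v w : R) : measurable_fun setT (fun x => w * (u * abs_pow p (T b) x + v * abs_pow q (T s) x)).
  apply: measurable_funM => //; apply: measurable_funD; apply: measurable_funM => //; exact: measurable_abs_pow.
have U0 (u v w : R) x : 0 <= u -> 0 <= v -> 0 <= w ->
    0 <= w * (u * abs_pow p (T b) x + v * abs_pow q (T s) x).
  by move=> u0 v0 w0; rewrite mulr_ge0// addr_ge0// mulr_ge0// abs_pow_ge0.
have hd : (Hd (T f) t <= (c1 * (t * k `^ p))%:E)%E.
  apply: (@le_trans _ _ (K%:E * (3%:E * \int[mu]_x
      (2 `^ p * (1 * abs_pow p (T b) x + D^-1 * abs_pow q (T s) x))%:E + (t * (2 `^ p * k `^ p))%:E))%E).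
    apply: (@rearr_head_ub _ _ (fun x => 2 `^ p * (1 * abs_pow p (T b) x + D^-1 * abs_pow q (T s) x))).
    - exact: measurable_abs_pow.
    - exact: mU.
    - exact: gp.
    - by move=> x; apply: U0 => //; rewrite ?invr_ge0 ltW.
    - by rewrite mulr_ge0// ltW.
    - exact: t0.
    apply: ae_imp Tf => x Tfx; rewrite (ger0_norm (abs_pow_ge0 _ _ _)) /abs_pow Tfx -mulrDr mul1r.
    apply: le_trans (powR_normD _ _ (ltW p0)) _; rewrite ler_wpM2l ?(ltW p20)// -addrA lerD2l addrC.
    exact: powR_up.
  apply: (@le_trans _ _ (K%:E * (3%:E * (2 `^ p * (1 * (Cp * (3 * K) * (t * k `^ p)) +
      D^-1 * (Cq * (6 * K) * (t * k `^ q))))%:E + (t * (2 `^ p * k `^ p))%:E))%E).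
    apply: lee_wpmul2l; first by rewrite lee_fin ltW.
    apply: leeD2r; apply: lee_wpmul2l => //.
    by apply: wsum; rewrite ?invr_ge0// ltW.
  rewrite -!EFinM lee_fin -Dk /c1 /a le_eqVlt; apply/orP; left; apply/eqP.
  by field; rewrite gt_eqF.
have gk : rearr (T f) t <= c1 `^ p^-1 * k.
  apply: root_le; [exact: fine_rearr_ge0|by rewrite mulr_ge0 ?powR_ge0// ltW|].
  rewrite powRM ?powR_ge0 ?(ltW k0)// (powR_root p0 (ltW c10)).
  have := le_trans (rearr_head_lb (abs_pow p (T f)) t0) hd.
  rewrite rearrE// rearr_pow// -EFinM lee_fin (_ : c1 * (t * k `^ p) = t * (c1 * k `^ p)); last by ring.
  by rewrite ler_pM2l.
(* The set where |T b| > k has measure at most a t by Chebyshev in L_p; off it |T b|^q <= D |T b|^p.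
   The estimate therefore starts only at a dilated time. *)
have tl : (Tl (T f) (2 * ((a + 1) * t))%R <= (6 * K * (2 `^ q * a) * (t * k `^ q))%:E)%E.
  have a1t : 0 < (a + 1) * t by rewrite mulr_gt0// ltr_wpDl.
  apply: (@le_trans _ _ ((6 * K)%:E * \int[mu]_x
      (2 `^ q * (D * abs_pow p (T b) x + 1 * abs_pow q (T s) x))%:E)%E).
    apply: (@rearr_tail_ub _ _ (fun x => 2 `^ q * (D * abs_pow p (T b) x + 1 * abs_pow q (T s) x))
      [set x | k < `|T b x|]).
    - exact: measurable_abs_pow.
    - exact: mU.
    - exact: measurable_gt.
    - exact: gq.
    - by move=> x; apply: U0 => //; rewrite ltW.
    - exact: a1t.
    - have := le_trans (Ipow_chebyshev (ltW p0) (ltW k0) mTb) Tb.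
      rewrite -lee_pdivlMl// -EFinM => /le_trans; apply; rewrite lee_fin.
      rewrite (_ : (k `^ p)^-1 * _ = Cp * (3 * K) * t); last by field; rewrite gt_eqF.
      by rewrite ler_pM2r// /a -addrA lerDl addr_ge0// !mulr_ge0// ltW.
    apply: ae_imp Tf => x Tfx /negP; rewrite -leNgt => Tbk.
    rewrite (ger0_norm (abs_pow_ge0 _ _ _)) /abs_pow Tfx mul1r.
    apply: le_trans (powR_normD _ _ (ltW q0)) _; rewrite ler_wpM2l ?(ltW q20)// lerD2r.
    by apply: powR_down => //; exact: ltW.
  apply: (@le_trans _ _ ((6 * K)%:E * (2 `^ q * (D * (Cp * (3 * K) * (t * k `^ p)) +
      1 * (Cq * (6 * K) * (t * k `^ q))))%:E)%E).
    apply: lee_wpmul2l; first by rewrite lee_fin mulr_ge0// ltW.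
    by apply: wsum => //; rewrite ltW.
  rewrite -!EFinM lee_fin -Dk /a le_eqVlt; apply/orP; left; apply/eqP.
  by ring.
split.
  by apply: (le_trans hd); rewrite lee_fin mulrDl lerDl mulr_ge0.
(* The missing stretch between t and the dilated time is filled by the value at t of the
   rearrangement of T f, which the head estimate bounds by a multiple of k. *)
have tu : t <= 2 * ((a + 1) * t).
  by rewrite -subr_ge0 (_ : _ - _ = (2 * a + 1) * t) ?mulr_ge0 ?addr_ge0 ?mulr_ge0 ?(ltW t0)//; ring.
apply: le_trans (rearr_tail_split (measurable_abs_pow q mT) gq t0 tu) _.
apply: (@le_trans _ _ ((2 * ((a + 1) * t) * ((c1 `^ p^-1) `^ q * k `^ q))%:E +
   (6 * K * (2 `^ q * a) * (t * k `^ q))%:E)%E).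
  apply: leeD => //; rewrite lee_fin ler_wpM2l//; first by apply: mulr_ge0 => //; apply: mulr_ge0 => //; exact: ltW.
  rewrite rearr_pow// -powRM ?powR_ge0 ?(ltW k0)//.
  by apply: ge0_ler_powR; rewrite ?nnegrE ?fine_rearr_ge0 ?mulr_ge0 ?powR_ge0 ?(ltW q0) ?(ltW k0).
rewrite -EFinD lee_fin [leRHS]mulrDl.
apply: (@le_trans _ _ (c2 * (t * k `^ q))); last by rewrite lerDr mulr_ge0// ltW.
by rewrite /c2 le_eqVlt; apply/orP; left; apply/eqP; ring.
Qed.

End estimate.
End couple_estimate.

(** * Exhausting a set of reals by its sections *)

Section measure_exhaustion.
Context (R : realType) (nu : {measure set (measurableTypeR R) -> \bar R}).
Implicit Types (S : set R) (z : R) (c : \bar R).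

(** The supremum of S is either in S, so that its own section is all of S, or is approached by
    points of S whose sections increase to S. It allows bounds known only at points of S. *)
Lemma measure_le_sections_up S z c : measurable S -> (forall x, S x -> x <= z) -> (0 <= c)%E ->
  (forall u, S u -> (nu (S `&` `]-oo, u]) <= c)%E) -> (nu S <= c)%E.
Proof.
move=> mS Sz c0 Sc; have [->|/set0P[x0 Sx0]] := eqVneq S set0; first by rewrite measure0.
have hS : has_sup S by split; [exists x0|exists z => x; exact: Sz].
have [Ss|Ss] := pselect (S (sup S)).
  apply: le_trans (Sc _ Ss); apply: le_measure; rewrite ?inE//; first exact: measurableI.
  by move=> x Sx; split => //=; rewrite in_itv/=; exact: sup_upper_bound.
pose F n := S `&` `]-oo, sup S - n.+1%:R^-1].
apply: (@measure_sub_bigcup_le _ _ _ nu F) => //.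
- by move=> n; exact: measurableI.
- move=> m n mn; apply/subsetPset => x [Sx]; rewrite /= !in_itv/= => xm; split => //=.
  rewrite in_itv/=; apply: (le_trans xm); rewrite lerD2l lerN2 lef_pV2 ?posrE//.
  by rewrite ler_nat.
- move=> x Sx; have xs : 0 < sup S - x.
    rewrite subr_gt0 lt_neqAle sup_upper_bound// andbT; apply/negP => /eqP xE.
    by apply: Ss; rewrite -xE.
  exists (Num.truncn (sup S - x)^-1) => //; split => //=; rewrite in_itv/= lerBrDl -lerBrDr.
  rewrite invf_ple ?posrE//; apply/ltW; exact: truncnS_gt.
move=> n; have n0 : 0 < n.+1%:R^-1 :> R by rewrite invr_gt0.
have [u Su us] := sup_adherent n0 hS; apply: le_trans (Sc u Su).
apply: le_measure; rewrite ?inE; [exact: measurableI|exact: measurableI|].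
by move=> x [Sx]; rewrite /= !in_itv/= => xn; split => //; rewrite /= ?in_itv/= (le_trans xn)// ltW.
Qed.

Lemma measure_le_sections_down S z c : measurable S -> (forall x, S x -> z <= x) -> (0 <= c)%E ->
  (forall u, S u -> (nu (S `&` `[u, +oo[) <= c)%E) -> (nu S <= c)%E.
Proof.
move=> mS Sz c0 Sc; have [->|/set0P[x0 Sx0]] := eqVneq S set0; first by rewrite measure0.
have hS : has_inf S by split; [exists x0|exists z => x; exact: Sz].
have lbS x : S x -> inf S <= x by apply: ge_inf; case: hS.
have [Ss|Ss] := pselect (S (inf S)).
  apply: le_trans (Sc _ Ss); apply: le_measure; rewrite ?inE//; first exact: measurableI.
  by move=> x Sx; split => //=; rewrite in_itv/= andbT; exact: lbS.
pose F n := S `&` `[inf S + n.+1%:R^-1, +oo[.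
apply: (@measure_sub_bigcup_le _ _ _ nu F) => //.
- by move=> n; exact: measurableI.
- move=> m n mn; apply/subsetPset => x [Sx]; rewrite /= !in_itv/= !andbT => xm; split => //=.
  rewrite in_itv/= andbT; apply: le_trans xm; rewrite lerD2l lef_pV2 ?posrE//.
  by rewrite ler_nat.
- move=> x Sx; have xs : 0 < x - inf S.
    rewrite subr_gt0 lt_neqAle lbS// andbT; apply/negP => /eqP xE.
    by apply: Ss; rewrite xE.
  exists (Num.truncn (x - inf S)^-1) => //; split => //=; rewrite in_itv/= andbT -lerBrDl.
  rewrite invf_ple ?posrE//; apply/ltW; exact: truncnS_gt.
move=> n; have n0 : 0 < n.+1%:R^-1 :> R by rewrite invr_gt0.
have [u Su us] := inf_adherent n0 hS; apply: le_trans (Sc u Su).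
apply: le_measure; rewrite ?inE; [exact: measurableI|exact: measurableI|].
by move=> x [Sx]; rewrite /= !in_itv/= !andbT => xn; split => //; rewrite /= ?in_itv/= ?andbT (le_trans _ xn)// ltW.
Qed.

End measure_exhaustion.

(** * The head-or-tail alternative and the splitting of g *)

Section splitting.
Context (R : realType).
Local Notation leb := (@lebesgue_measure R).
Local Notation mu := (halfline_measure R).
Local Notation K := (rank_cst R).
Implicit Types (f g F G : R -> R) (c C l M t i B : R) (n N : nat).
Variables (p q : R).
Hypotheses (p0 : 0 < p) (pq : p < q).

Let q0 : 0 < q. Proof. exact: lt_trans pq. Qed.

Local Notation Hd f t := (\int[leb]_(x in `]0%R, t[) rearrangement (abs_pow p f) x)%E.
Local Notation Tl f t := (\int[leb]_(x in `]t, +oo[) rearrangement (abs_pow q f) x)%E.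

Lemma fine_leM (x y : \bar R) C : x \is a fin_num -> y \is a fin_num ->
  fine x <= C * fine y <-> (x <= C%:E * y)%E.
Proof. by move=> fx fy; rewrite -lee_fin EFinM !fineK. Qed.

(** The admissible k are those above both X and Y, the scales at which the two hypotheses on f
    become equalities. Taking k as the larger one turns the corresponding conclusion into a
    comparison with f alone. *)
Lemma dichotomy_scale (hg lg hf lf : \bar R) t C : 0 < C -> 0 < t ->
  (0 <= hf)%E -> (hf < +oo)%E -> (0 <= lf)%E -> (lf < +oo)%E ->
  (forall k, 0 < k -> (hf <= (t * k `^ p)%:E)%E -> (lf <= (t * k `^ q)%:E)%E ->
    (hg <= (C * (t * k `^ p))%:E)%E /\ (lg <= (C * (t * k `^ q))%:E)%E) ->
  (hg <= C%:E * hf)%E \/ (lg <= C%:E * lf)%E.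
Proof.
move=> C0 t0 hf0 hfy lf0 lfy TC.
have [h h0 Eh] := ereal_ge0_fin hf0 hfy; have [l l0 El] := ereal_ge0_fin lf0 lfy.
pose X := (h / t) `^ p^-1; pose Y := (l / t) `^ q^-1.
have X0 : 0 <= X by exact: powR_ge0.
have Y0 : 0 <= Y by exact: powR_ge0.
have hX : h = t * X `^ p by rewrite /X (powR_root p0) ?divr_ge0 ?(ltW t0)// mulrC divfK// gt_eqF.
have lY : l = t * Y `^ q by rewrite /Y (powR_root q0) ?divr_ge0 ?(ltW t0)// mulrC divfK// gt_eqF.
have key k : 0 < k -> X <= k -> Y <= k ->
    (hg <= (C * (t * k `^ p))%:E)%E /\ (lg <= (C * (t * k `^ q))%:E)%E.
  move=> k0 Xk Yk; apply: TC => //.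
    rewrite Eh lee_fin hX ler_pM2l//; apply: ge0_ler_powR; rewrite ?nnegrE ?(ltW k0) ?(ltW p0)//.
  rewrite El lee_fin lY ler_pM2l//; apply: ge0_ler_powR; rewrite ?nnegrE ?(ltW k0) ?(ltW q0)//.
rewrite Eh El -!EFinM; have [YX|XY] := leP Y X; last first.
  by right; have [_] := key Y (le_lt_trans X0 XY) (ltW XY) (lexx _); rewrite -lY.
left; have [X00|X00] := eqVneq X 0; last first.
  have Xp : 0 < X by rewrite lt_neqAle eq_sym X00.
  by have [] := key X Xp (lexx _) YX; rewrite -hX.
(* Both scales are 0, but k must be positive; letting k tend to 0 shows that [hg] vanishes. *)
rewrite hX X00 powR0 ?gt_eqF// !mulr0; apply/lee_addgt0Pr => e e0; rewrite add0e.
have Ct : 0 < C * t by rewrite mulr_gt0.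
have [] := key ((e / (C * t)) `^ p^-1); rewrite ?powR_gt0 ?divr_gt0 ?X00 ?powR_ge0//.
  by apply: (le_trans YX); rewrite X00 powR_ge0.
rewrite (powR_root p0) ?divr_ge0 ?(ltW e0) ?(ltW Ct)// => H _; apply: (le_trans H).
by rewrite lee_fin mulrA [leLHS]mulrC divfK ?gt_eqF.
Qed.

Lemma head_or_tail T : bounded_on_couple (L p%:E) (L q%:E) T ->
  exists2 C, 0 < C & forall f t, sum_space (L p%:E) (L q%:E) f -> 0 < t ->
    (Hd (T f) t <= C%:E * Hd f t)%E \/ (Tl (T f) t <= C%:E * Tl f t)%E.
Proof.
move=> /(couple_estimate p0 pq)[C C0 TC]; exists C => // f t sf t0.
have [_ _ _ /(_ t t0) Hf /(_ t t0) Lf] := sum_LpLq_facts p0 pq sf.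
have H0 : (0 <= Hd f t)%E by apply: integral_ge0 => x _; exact: rearr_ge0.
have L0' : (0 <= Tl f t)%E by apply: integral_ge0 => x _; exact: rearr_ge0.
apply: (dichotomy_scale C0 t0 H0 Hf L0' Lf) => k k0 Hk Lk.
exact: (TC f t k sf t0 k0 Hk Lk).
Qed.

(** g is cut according to whether the rank [sigma x] is a time at which the head alternative holds.
    The two alternatives are only known on complementary sets of times, which is why densities
    restricted to such sets are bounded by exhaustion. *)
Lemma split_majorized f g C : 0 < C -> sum_space (L p%:E) (L q%:E) f ->
  sum_space (L p%:E) (L q%:E) g ->
  (forall t, 0 < t -> (Hd g t <= C%:E * Hd f t)%E \/ (Tl g t <= C%:E * Tl f t)%E) ->
  exists g1 g2 : R -> R, [/\ measurable_fun setT g1, measurable_fun setT g2, g = g1 \+ g2,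
    forall t, 0 < t -> (Hd g1 t <= (10 * K * K `^ p * C)%:E * Hd f t)%E &
    forall t, 0 < t -> (Tl g2 (6%:R * t)%R <= (18 * K * K `^ q * C)%:E * Tl f t)%E].
Proof.
move=> C0 sf sg HT; have K0 := rank_cst_gt0 R; have K00 := ltW K0.
have [mf fp fq Hf Lf] := sum_LpLq_facts p0 pq sf.
have [mg gp gq Hg _] := sum_LpLq_facts p0 pq sg.
have fg := rearr_fin_pow p0 mg gp.
have [sigma [ms sS gs]] := ranking mg fg.
have mwp := measurable_fine_rearr (abs_pow p g); have mwq := measurable_fine_rearr (abs_pow q g).
have wp0 := fine_rearr_ge0 (abs_pow p g); have wq0 := fine_rearr_ge0 (abs_pow q g).
pose nup : {measure set (measurableTypeR R) -> \bar R} := mdensity mu wp0 mwp.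
pose nuq : {measure set (measurableTypeR R) -> \bar R} := mdensity mu wq0 mwq.
have nupE t : nup `]-oo, t]%classic = Hd g t by exact: (integral_rearr_head t gp).
have nuqE t : 0 < t -> nuq `[t, +oo[%classic = Tl g t by move=> t0; exact: (integral_rearr_tail gq t0).
pose U : set R := [set t | 0 < t /\ (Hd g t <= C%:E * Hd f t)%E].
have Hd_nd h t t' : t <= t' -> (Hd h t <= Hd h t')%E.
  move=> tt; apply: integral_rearr_subset => //.
  by move=> x /=; rewrite !in_itv/= => /andP[-> /lt_le_trans]; apply.
have Tl_ni h t t' : t <= t' -> (Tl h t' <= Tl h t)%E.
  move=> tt; apply: integral_rearr_subset => //.
  by move=> x /=; rewrite !in_itv/= !andbT; exact: le_lt_trans.
have Hd_ge0 h t : (0 <= Hd h t)%E by apply: integral_ge0 => x _; exact: rearr_ge0.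
have Tl_ge0 h t : (0 <= Tl h t)%E by apply: integral_ge0 => x _; exact: rearr_ge0.
have mHd h : (forall t, 0 < t -> (Hd h t < +oo)%E) -> measurable_fun setT (fun t => fine (Hd h t)).
  move=> hfin; have fn t : Hd h t \is a fin_num.
    rewrite ge0_fin_numE//; have [t0|t0] := ltP 0 t; first exact: hfin.
    by apply: le_lt_trans (hfin 1 ltr01); apply: Hd_nd; apply: (le_trans t0).
  by apply: nondecreasing_measurable => // x y xy; rewrite -lee_fin !fineK//; exact: Hd_nd.
have mU : measurable U.
  have -> : U = `]0, +oo[%classic `&` [set t | fine (Hd g t) <= C * fine (Hd f t)].
    have fn h t : (forall t, 0 < t -> (Hd h t < +oo)%E) -> 0 < t -> Hd h t \is a fin_num.
      by move=> hfin t0; rewrite ge0_fin_numE// hfin.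
    apply/seteqP; split => t; rewrite /= in_itv/= andbT => -[t0 H]; split; try exact: t0.
      by apply/(fine_leM C (fn g t Hg t0) (fn f t Hf t0)).
    by apply/(fine_leM C (fn g t Hg t0) (fn f t Hf t0)).
  apply: measurableI => //; rewrite -[X in measurable X]setTI.
  apply: (measurable_fun_ler (mHd g Hg) _ measurableT) => //.
  by apply: measurable_funM => //; exact: mHd.
have mD : measurable (sigma @^-1` U) by rewrite -[X in measurable X]setTI; exact: ms.
pose g1 x := if x \in sigma @^-1` U then g x else cst 0 x.
pose g2 x := if x \in sigma @^-1` U then cst 0 x else g x.
have mg1 : measurable_fun setT g1 by apply: measurable_if_in => //; exact: measurable_funTS.
have mg2 : measurable_fun setT g2 by apply: measurable_if_in => //; exact: measurable_funTS.
have gsp x r : 0 < r -> rearr_fin (abs_pow r g) -> 0 < sigma x -> `|g x| <= K * rearr g (sigma x) ->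
    abs_pow r g x <= K `^ r * rearr (abs_pow r g) (sigma x).
  move=> r0 fr sx gx; rewrite rearr_pow// -powRM ?fine_rearr_ge0//.
  by apply: ge0_ler_powR; rewrite ?nnegrE ?mulr_ge0 ?fine_rearr_ge0 ?(ltW r0).
have wS (w : R -> R) (w0 : forall x, 0 <= w x) (mw : measurable_fun setT w) r (S : set R) :
    measurable S ->
    (\int[mu]_x (K `^ r * (w (sigma x) * \1_S (sigma x)))%:E <=
     (3 * K `^ r)%:E * mdensity mu w0 mw S)%E.
  move=> mS; have mwS : measurable_fun setT (fun y => (w y * \1_S y)%:E).
    by apply: measurable_efun; apply: measurable_funM => //; exact: measurable_indic.
  have wS0 y : (0 <= (w y * \1_S y)%:E)%E by rewrite lee_fin mulr_ge0.
  under eq_integral do rewrite EFinM.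
  rewrite ge0_integralZl_EFin ?powR_ge0//; last exact: (measurableT_comp mwS ms).
  rewrite mulrC (EFinM _ 3) -muleA; apply: lee_wpmul2l; first by rewrite lee_fin powR_ge0.
  apply: le_trans (sS _ wS0 mwS) _; apply: lee_wpmul2l => //.
  rewrite /mdensity integral_mkcond le_eqVlt; apply/orP; left; apply/eqP.
  apply: eq_integral => y _; rewrite /patch indicE.
  by case: (y \in S); rewrite ?mulr1 ?mulr0.
have mUU (w : R -> R) r (S : set R) : measurable_fun setT w -> measurable S ->
    measurable_fun setT (fun x => K `^ r * (w (sigma x) * \1_S (sigma x))).
  move=> mw mS; apply: measurable_funM => //.
  apply: (measurableT_comp (f := fun y => w y * \1_S y)) => //.
  by apply: measurable_funM => //; exact: measurable_indic.
exists g1, g2; split; [exact: mg1|exact: mg2| | |].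
- apply/funext => x; rewrite /g1 /g2 /=; case: ifP => _; rewrite /cst ?addr0 ?add0r//.
- move=> t t0; have Ht := Hf t t0; have Ht0 := Hd_ge0 f t.
  have [h h0 Eh] := ereal_ge0_fin Ht0 Ht.
  pose S := U `&` `]-oo, t[; have mS : measurable S by exact: measurableI.
  (* For u in U with u < t, the mass up to u is the head integral of |g|^p at u, at most C times
     that of |f|^p at u, hence at t. *)
  have nS : (nup S <= (C * h)%:E)%E.
    apply: (@measure_le_sections_up _ nup S t) => //.
    - by move=> x [_]; rewrite /= in_itv/=; exact: ltW.
    - by rewrite lee_fin mulr_ge0// ltW.
    move=> u [[u0 Hu]]; rewrite /= in_itv/= => ut.
    apply: (@le_trans _ _ (nup `]-oo, u]%classic)).
      by apply: le_measure; rewrite ?inE//; exact: measurableI.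
    rewrite nupE; apply: (le_trans Hu); rewrite EFinM -Eh; apply: lee_wpmul2l.
      by rewrite lee_fin ltW.
    by apply: Hd_nd; exact: ltW.
  have fG1 : rearr_fin (abs_pow p g1).
    apply: rearr_fin_le gp; [exact: measurable_abs_pow|exact: measurable_abs_pow|].
    apply: aeW => x; rewrite !(ger0_norm (abs_pow_ge0 _ _ _)) /abs_pow /g1; case: ifP => // _.
    by rewrite normr0 powR0 ?powR_ge0// gt_eqF.
  apply: (@le_trans _ _ (K%:E * (3%:E * \int[mu]_x
     (K `^ p * (rearr (abs_pow p g) (sigma x) * \1_S (sigma x)))%:E + (t * (K `^ p * (C * h / t)))%:E))%E).
    apply: (@rearr_head_ub _ _ (fun x => K `^ p * (rearr (abs_pow p g) (sigma x) * \1_S (sigma x)))) => //.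
    - exact: measurable_abs_pow.
    - exact: mUU.
    - by move=> x; rewrite !mulr_ge0 ?powR_ge0.
    - by rewrite mulr_ge0 ?powR_ge0// divr_ge0 ?mulr_ge0// ltW.
    apply: ae_imp gs => x [sx gx]; rewrite (ger0_norm (abs_pow_ge0 _ _ _)).
    have M0 : 0 <= K `^ p * (C * h / t).
      by rewrite mulr_ge0 ?powR_ge0// divr_ge0 ?mulr_ge0// ltW.
    have A0 : 0 <= K `^ p * (rearr (abs_pow p g) (sigma x) * \1_S (sigma x)).
      by rewrite !mulr_ge0 ?powR_ge0.
    rewrite /abs_pow /g1; case: ifPn => [|_]; last first.
      by rewrite normr0 powR0 ?gt_eqF// addr_ge0.
    rewrite inE /= => Ux; have := gsp x p p0 gp sx gx; rewrite /abs_pow => H.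
    apply: (le_trans H); have [st|ts] := ltP (sigma x) t.
      rewrite indicE mem_set ?mulr1 ?lerDl//; split => //=; by rewrite in_itv.
    (* A rank s >= t in U contributes to the bounded part: the rearrangement of |g|^p at s is at
       most 1 / s times its head integral at s, hence at most C / s times that of |f|^p, and
       concavity replaces s by t. *)
    rewrite -[leLHS]add0r lerD// ler_wpM2l ?powR_ge0//.
    have [_ Hs] := Ux.
    have := le_trans (rearr_head_lb (abs_pow p g) sx) Hs.
    rewrite rearrE// -EFinM => H1.
    have := rearr_head_concave (abs_pow p f) t0 ts; rewrite Eh -EFinM => H2.
    rewrite ler_pdivlMr// -(ler_pM2l sx) mulrA.
    rewrite -lee_fin; apply: (@le_trans _ _ (t%:E * (C%:E * Hd f (sigma x)))%E).
      by rewrite mulrC EFinM; apply: lee_wpmul2l; rewrite ?lee_fin ?(ltW t0).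
    rewrite muleCA mulrCA EFinM; apply: lee_wpmul2l; first by rewrite lee_fin ltW.
    exact: H2.
  apply: (@le_trans _ _ (K%:E * (3%:E * ((3 * K `^ p)%:E * (C * h)%:E) + (t * (K `^ p * (C * h / t)))%:E))%E).
    apply: lee_wpmul2l; first by rewrite lee_fin.
    apply: leeD2r; apply: lee_wpmul2l => //; apply: (le_trans (wS _ wp0 mwp p S mS)).
    by apply: lee_wpmul2l => //; rewrite lee_fin mulr_ge0 ?powR_ge0.
  rewrite Eh -!EFinM lee_fin le_eqVlt; apply/orP; left; apply/eqP.
  by field; rewrite gt_eqF.
move=> t t0; pose S := ~` U `&` `[t, +oo[.
have mS : measurable S by apply: measurableI => //; exact: measurableC.
(* At times outside U the tail alternative must hold, and tail integrals of f decrease in time. *)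
have nS : (nuq S <= C%:E * Tl f t)%E.
  apply: (@measure_le_sections_down _ nuq S t) => //.
  - by move=> x [_]; rewrite /= in_itv/= andbT.
  - by rewrite mule_ge0// lee_fin ltW.
  move=> u [Uu]; rewrite /= in_itv/= andbT => tu; have u0 := lt_le_trans t0 tu.
  have Hu : (Tl g u <= C%:E * Tl f u)%E.
    by have [H|H] := HT u u0; [exfalso; apply: Uu; split; [exact: u0|exact: H]|exact: H].
  apply: (@le_trans _ _ (nuq `[u, +oo[%classic)).
    by apply: le_measure; rewrite ?inE//; exact: measurableI.
  rewrite nuqE//; apply: (le_trans Hu); apply: lee_wpmul2l; first by rewrite lee_fin ltW.
  exact: Tl_ni.
have fG2 : rearr_fin (abs_pow q g2).
  apply: rearr_fin_le gq; [exact: measurable_abs_pow|exact: measurable_abs_pow|].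
  apply: aeW => x; rewrite !(ger0_norm (abs_pow_ge0 _ _ _)) /abs_pow /g2; case: ifP => // _.
  by rewrite normr0 powR0 ?powR_ge0// gt_eqF.
have t30 : 0 < 3 * t by rewrite mulr_gt0.
(* The points of rank below t form a set of measure at most 3 t by [submp]; [rearr_tail_ub] doubles
   it. *)
have -> : 6%:R * t = 2 * (3 * t) by ring.
apply: (@le_trans _ _ ((6 * K)%:E * \int[mu]_x
   (K `^ q * (rearr (abs_pow q g) (sigma x) * \1_S (sigma x)))%:E)%E).
  apply: (@rearr_tail_ub _ _ (fun x => K `^ q * (rearr (abs_pow q g) (sigma x) * \1_S (sigma x)))
    (sigma @^-1` `]-oo, t[)) => //.
  - exact: measurable_abs_pow.
  - exact: mUU.
  - by rewrite -[X in measurable X]setTI; exact: ms.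
  - by move=> x; rewrite !mulr_ge0 ?powR_ge0.
  - have mi : measurable_fun setT (fun y : R => (\1_`]-oo, t[ y)%:E : \bar R).
      by apply: measurable_efun; exact: measurable_indic.
    have i0 y : (0 <= (\1_`]-oo, t[ y : R)%:E)%E by rewrite lee_fin.
    have EI : (\int[mu]_y (\1_`]-oo, t[ y : R)%:E = t%:E)%E.
      by rewrite integral_indic// setIT; exact: (halfline_Ny_itv true (ltW t0)).
    have := sS _ i0 mi; rewrite EI -EFinM; apply: le_trans; rewrite le_eqVlt; apply/orP; left; apply/eqP.
    transitivity (\int[mu]_x (\1_(sigma @^-1` `]-oo, t[) x)%:E)%E.
      by rewrite integral_indic ?setIT// -[X in measurable X]setTI; exact: ms.
    by apply: eq_integral => x _; rewrite !indicE; congr (_%:R%:E); apply/idP/idP; rewrite !inE.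
  apply: ae_imp gs => x [sx gx] /=; rewrite in_itv/= => /negP; rewrite -leNgt => ts.
  rewrite (ger0_norm (abs_pow_ge0 _ _ _)).
  rewrite /abs_pow /g2; case: ifPn => [_|]; first by rewrite normr0 powR0 ?gt_eqF// !mulr_ge0 ?powR_ge0.
  rewrite notin_setE /= => Ux; have := gsp x q q0 gq sx gx; rewrite /abs_pow => H.
  apply: (le_trans H); rewrite indicE mem_set ?mulr1//; split => //=.
  by rewrite in_itv/= ts.
apply: (@le_trans _ _ ((6 * K)%:E * ((3 * K `^ q)%:E * (C%:E * Tl f t)))%E).
  apply: lee_wpmul2l; first by rewrite lee_fin mulr_ge0.
  apply: (le_trans (wS _ wq0 mwq q S mS)); apply: lee_wpmul2l => //.
  by rewrite lee_fin mulr_ge0 ?powR_ge0.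
rewrite !muleA -!EFinM; apply: lee_wpmul2r => //.
by rewrite lee_fin le_eqVlt; apply/orP; left; apply/eqP; ring.
Qed.

End splitting.

(** * Comparison of the three couples *)

Section couples.
Context (R : realType).
Local Notation mu := (halfline_measure R).
Local Notation K := (rank_cst R).
Implicit Types (f g A Phi w : R -> R) (c C r : R) (n N : nat).

Lemma Ipow_dom r w Phi C c f g : 0 <= c -> (forall x, 0 <= w x) -> measurable_fun setT w ->
  measurable_fun setT Phi -> dom w Phi C -> measurable_fun setT f -> measurable_fun setT g ->
  {ae mu, forall x, `|g x| `^ r <= c * (w x * `|f (Phi x)| `^ r)} ->
  (Ipow r g <= (c * C)%:E * Ipow r f)%E.
Proof.
move=> c0 w0 mw mP wP mf mg gf; have mfp := measurable_eabs_pow r mf.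
apply: (@le_trans _ _ (\int[mu]_x (c%:E * ((w x)%:E * (`|f (Phi x)| `^ r)%:E)))%E).
  apply: ae_ge0_le_integral => //.
  - exact: measurable_eabs_pow.
  - by move=> x _; rewrite !mule_ge0 ?lee_fin ?powR_ge0.
  - apply: measurable_funeM; apply: emeasurable_funM; first exact: measurable_efun.
    exact: (measurableT_comp mfp mP).
  by apply: ae_imp gf => x H _; rewrite -!EFinM lee_fin.
rewrite ge0_integralZl_EFin//; last 2 first.
- by move=> x _; rewrite mule_ge0 ?lee_fin ?powR_ge0.
- by apply: emeasurable_funM; [exact: measurable_efun|exact: (measurableT_comp mfp mP)].
rewrite EFinM -muleA; apply: lee_wpmul2l; first by rewrite lee_fin.
by apply: (wP (fun y => (`|f y| `^ r)%:E)) => // x; rewrite lee_fin powR_ge0.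
Qed.

Lemma Ipow_scale r c f : measurable_fun setT f ->
  (Ipow r (fun x => c * f x)%R <= (`|c| `^ r)%:E * Ipow r f)%E.
Proof.
move=> mf; apply: Ipow_ae_le; rewrite ?powR_ge0//.
  by apply: measurable_funM => //; exact: measurable_cst.
by apply: aeW => x; rewrite normrM powRM.
Qed.

Lemma Ipow_fcopies r N : 0 < r -> exists2 C, 0 <= C & forall f, measurable_fun setT f ->
  (Ipow r (fcopies N f) <= C%:E * Ipow r f)%E.
Proof.
move=> r0; elim: N => [|N [C C0 IH]].
  exists 0 => // f mf; rewrite mul0e /Ipow (eq_integral (cst 0%E)) ?integral0// => x _.
  by rewrite /fcopies big_ord0 normr0 powR0// gt_eqF.
exists (2 `^ r * (C + 1)); first by rewrite mulr_ge0 ?powR_ge0 ?addr_ge0.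
move=> f mf; have -> : fcopies N.+1 f = fcopies N f \+ fcopy N f.
  by apply/funext => x; rewrite /fcopies big_ord_recr.
apply: le_trans (IpowD (measurable_fcopies N mf) (measurable_fcopy N mf) (ltW r0)) _.
rewrite (EFinM (2 `^ r)) -muleA; apply: lee_wpmul2l; first by rewrite lee_fin powR_ge0.
rewrite EFinD ge0_muleDl ?lee_fin//; apply: leeD; first exact: IH.
rewrite -[in leRHS](mulr1 1); have mr := @measurable_rho R.
apply: (Ipow_dom (w := \1_(copy N)) (Phi := fun x : R => `|rho x|)) => //.
- by apply: measurable_indic; exact: measurable_copy.
- exact: measurableT_comp.
- exact: dom_rho.
- exact: measurable_fcopy.
apply: aeW => x; rewrite mul1r indicE; have [nx|nx] := pselect (copy N x).
  by rewrite fcopy_in// mem_set// mul1r.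
by rewrite fcopy_out// memNset// mul0r normr0 powR0// gt_eqF.
Qed.

Lemma Lp_le r f g : 0 < r -> measurable_fun setT f -> (forall x, `|f x| <= `|g x|) ->
  L r%:E g -> L r%:E f.
Proof.
move=> r0 mf fg /(LpP _ r0)[mg gI]; apply/(LpP _ r0); split; first exact: mf.
by apply: le_lt_trans gI; apply: Ipow_le => //; exact: ltW.
Qed.

Section two_exponents.
Variables (p q : R).
Hypotheses (p0 : 0 < p) (pq : p < q).

Let q0 : 0 < q. Proof. exact: lt_trans pq. Qed.

(** Only stability of L_p + L_q has to be proved. Additivity holds almost everywhere while
    [sum_space] asks for pointwise equality, so the L_q summand is taken to be T f - T a, which
    equals T b almost everywhere. *)
Lemma couple_restrict (V : (R -> R) -> Prop) T : linear_operator V T ->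
  (forall f, sum_space (L p%:E) (L q%:E) f -> V f) ->
  (forall f, V f -> measurable_fun setT f) ->
  bounded_on (L p%:E) T -> bounded_on (L q%:E) T ->
  bounded_on_couple (L p%:E) (L q%:E) T.
Proof.
move=> [TV Tae Tlin] sV mV Tp Tq; split => //; split; last 2 first.
- by move=> f g sf sg; apply: Tae; exact: sV.
- by move=> a f g sf sg; apply: Tlin; exact: sV.
move=> f sf; have [a [b [La Lb fab]]] := sf.
have [[Cp TpP] [Cq TqP]] := (Tp, Tq).
have LTa : L p%:E (T a) by have [] := TpP a La.
have LTb : L q%:E (T b) by have [] := TqP b Lb.
have sa : sum_space (L p%:E) (L q%:E) a by apply: sum_spacel; [|exact: Lp_cst0].
have sb : sum_space (L p%:E) (L q%:E) b by apply: sum_spacer; [exact: Lp_cst0|].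
have mTa := proj1 (proj1 (LpP (T a) p0) LTa).
have [mTb TbI] := proj1 (LpP (T b) q0) LTb.
have mTf := mV _ (TV _ (sV _ sf)).
have mD : measurable_fun setT (T f \- T a) by exact: measurable_funB.
exists (T a), (T f \- T a); split => //; last first.
  by apply/funext => x /=; rewrite addrC subrK.
apply/(LpP _ q0); split; first exact: mD.
apply: le_lt_trans TbI; rewrite -[leRHS]mul1e; apply: Ipow_ae_le => //.
have := Tlin 1 a b (sV _ sa) (sV _ sb).
rewrite (_ : (fun x => 1 * a x + b x) = f); last by rewrite fab; apply/funext => x; rewrite mul1r.
by apply: ae_imp => x /(_ I) /= ->; rewrite mul1r addrC addKr mul1r.
Qed.

(** The L_q bound is obtained without real interpolation: T f and f satisfy the majorization up to a
    constant, so |T f|^p is dominated by a weighted composition of |f|^p, and this domination is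
    raised to the power r = q / p > 1. Boundedness of the weight gives A^r <= 36^(r - 1) A. *)
Lemma head_couple_restrict T : bounded_on_couple (L p%:E) (L +oo%E) T ->
  bounded_on_couple (L p%:E) (L q%:E) T.
Proof.
move=> TB; have [Tlin Tp _] := TB; have [TV _ _] := Tlin.
have sV := @sum_LpLq_head R p q p0 pq.
have mV f : sum_space (L p%:E) (L +oo%E) f -> measurable_fun setT f by case/(sum_LpLooP _ p0).
apply: (couple_restrict Tlin sV mV Tp).
have [D D0 TD] := head_op_estimate p0 TB.
have [r [r1 pr]] : exists r, 1 < r /\ p * r = q.
  by exists (q / p); rewrite ltr_pdivlMr// mul1r mulrC divfK// gt_eqF.
pose k := (K ^+ 2) `^ r * 36 `^ (r - 1).
have k0 : 0 <= k by rewrite mulr_ge0 ?powR_ge0.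
apply/(bounded_LpP _ q0); exists (k * 36 * `|D `^ p^-1| `^ q).
  by rewrite !mulr_ge0 ?powR_ge0.
move=> f Lf; have sf := sV f (sum_spacer (Lp_cst0 p0) Lf).
have [mf fI] := proj1 (LpP f q0) Lf; have mT := mV _ (TV _ sf).
have [A [Phi [[[mA mP A0 A36 AP] _] gA]]] :=
  head_majorized_op (head_majorized_scale p0 D0 mf sf mT (TD f sf)).
have mf' : measurable_fun setT (fun x => D `^ p^-1 * f x).
  by apply: measurable_funM => //; exact: measurable_cst.
have TI : (Ipow q (T f) <= (k * 36 * `|D `^ p^-1| `^ q)%:E * Ipow q f)%E.
  rewrite (EFinM (k * 36)) -muleA.
  apply: (@le_trans _ _ ((k * 36)%:E * Ipow q (fun x => D `^ p^-1 * f x)%R)%E); last first.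
    by apply: lee_wpmul2l; [rewrite lee_fin mulr_ge0|exact: Ipow_scale].
  apply: (Ipow_dom k0 A0 mA mP AP mf' mT); apply: ae_imp gA => x.
  rewrite !(ger0_norm (abs_pow_ge0 _ _ _)) /abs_pow => H.
  rewrite -pr !powRrM; set y := `|_| `^ p in H *; set z := `|_| `^ p in H *.
  have y0 : 0 <= y by exact: powR_ge0.
  have z0 : 0 <= z by exact: powR_ge0.
  have rr : 0 <= r by rewrite (le_trans ler01)// ltW.
  apply: (@le_trans _ _ ((K ^+ 2 * (A x * z)) `^ r)).
    by apply: ge0_ler_powR => //; rewrite nnegrE// (le_trans y0).
  rewrite powRM ?exprn_ge0 ?rank_cst_ge0 ?mulr_ge0// powRM//.
  rewrite /k -!mulrA ler_wpM2l ?powR_ge0// mulrA ler_wpM2r ?powR_ge0//.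
  rewrite (powR_split (@ltr01 R) r1 (A0 x)) powRr1// mulrC ler_wpM2r//.
  by apply: ge0_ler_powR; rewrite ?nnegrE// subr_ge0 ltW.
split; last exact: TI.
apply/(LpP _ q0); split; first exact: mT.
by apply: (le_lt_trans TI); rewrite lte_mul_pinfty ?lee_fin ?mulr_ge0 ?powR_ge0.
Qed.

(** Here the domination is raised to a power r = p / q < 1. The weight is unbounded, and A^r is at
    most 1 or A according to the size of A; the two [dom] conditions of [tail_op] control exactly
    these. The dilation of [tail_op_estimate] brings in [fcopies]. *)
Lemma tail_couple_restrict T : bounded_on_couple L0 (L q%:E) T ->
  bounded_on_couple (L p%:E) (L q%:E) T.
Proof.
move=> TB; have [Tlin _ Tq] := TB; have [TV _ _] := Tlin.
have sV := @sum_LpLq_tail R p q p0 pq.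
have mV f : sum_space L0 (L q%:E) f -> measurable_fun setT f by case/(sum_L0LqP _ q0).
suff Tp : bounded_on (L p%:E) T by exact: (couple_restrict Tlin sV mV Tp).
have [N [D [N0 D0 TD]]] := tail_op_estimate q0 TB.
have [B B0 BP] := Ipow_fcopies N p0.
have [r [r1 r0 pr]] : exists r, [/\ r < 1, 0 < r & q * r = p].
  by exists (p / q); rewrite ltr_pdivrMr// mul1r divr_gt0// mulrCA divff ?mulr1// gt_eqF.
pose k := (K ^+ 2) `^ r; have k0 : 0 <= k by exact: powR_ge0.
pose d := `|D `^ q^-1| `^ p; have dd : 0 <= d by exact: powR_ge0.
apply/(bounded_LpP _ p0); exists (k * (18 + 18) * (d * B)); first by rewrite !mulr_ge0.
move=> f Lf; have sf := sV f (sum_spacel Lf (Lp_cst0 q0)).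
have [mf fI] := proj1 (LpP f p0) Lf; have mT := mV _ (TV _ sf).
have [A [Phi [[[mA mP A0 AP A1P] _] gA]]] :=
  tail_majorized_op (tail_majorized_fcopies q0 N0 D0 mf sf mT (TD f sf)).
have mc := measurable_fcopies N mf.
have mf' : measurable_fun setT (fun x => D `^ q^-1 * fcopies N f x).
  by apply: measurable_funM => //; exact: measurable_cst.
have mA1 : measurable_fun setT (\1_[set x | A x != 0] : R -> R).
  by apply: measurable_indic; exact: measurable_neq0.
pose w x := A x + \1_[set x | A x != 0] x.
have w0 x : 0 <= w x by rewrite addr_ge0.
have mw : measurable_fun setT w by exact: measurable_funD.
have wP : dom w Phi (18 + 18).
  move=> h h0 mh; have mhP : measurable_fun setT (fun x => h (Phi x)) by exact: measurableT_comp.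
  rewrite EFinD ge0_muleDl//.
  under eq_integral do rewrite EFinD ge0_muleDl ?lee_fin//.
  rewrite ge0_integralD//.
  - by apply: leeD; [exact: AP|exact: A1P].
  - by move=> x _; rewrite mule_ge0 ?lee_fin.
  - by apply: emeasurable_funM => //; exact: measurable_efun.
  - by move=> x _; rewrite mule_ge0 ?lee_fin.
  - by apply: emeasurable_funM => //; exact: measurable_efun.
have TI : (Ipow p (T f) <= (k * (18 + 18) * (d * B))%:E * Ipow p f)%E.
  rewrite (EFinM (k * (18 + 18))) -muleA.
  apply: (@le_trans _ _ ((k * (18 + 18))%:E * Ipow p (fun x => D `^ q^-1 * fcopies N f x)%R)%E); last first.
    apply: lee_wpmul2l; first by rewrite lee_fin mulr_ge0.
    apply: le_trans (Ipow_scale p _ mc) _; rewrite (EFinM d) -muleA.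
    by apply: lee_wpmul2l; [rewrite lee_fin|exact: BP].
  apply: (Ipow_dom k0 w0 mw mP wP mf' mT); apply: ae_imp gA => x.
  rewrite !(ger0_norm (abs_pow_ge0 _ _ _)) /abs_pow => H.
  rewrite -pr !powRrM; set y := `|_| `^ q in H *; set z := `|_| `^ q in H *.
  have y0 : 0 <= y by exact: powR_ge0.
  have z0 : 0 <= z by exact: powR_ge0.
  apply: (@le_trans _ _ ((K ^+ 2 * (A x * z)) `^ r)).
    by apply: ge0_ler_powR; rewrite ?(ltW r0) ?nnegrE// (le_trans y0).
  rewrite powRM ?exprn_ge0 ?rank_cst_ge0 ?mulr_ge0// powRM//.
  rewrite ler_wpM2l ?powR_ge0// ler_wpM2r ?powR_ge0//.
  rewrite /w (indic_bool (fun y => A y != 0)); have [->|An0] := eqVneq (A x) 0.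
    by rewrite powR0 ?gt_eqF// addr0.
  have [A1|A1] := leP (A x) 1.
    apply: (@le_trans _ _ (1 `^ r)); last by rewrite powR1 lerDr.
    by apply: ge0_ler_powR; rewrite ?nnegrE ?(ltW r0).
  apply: (@le_trans _ _ (A x)); last by rewrite lerDl.
  by rewrite -[leRHS]powRr1//; apply: ler_powR; [exact: ltW|exact: ltW].
split; last exact: TI.
apply/(LpP _ p0); split; first exact: mT.
by apply: (le_lt_trans TI); rewrite lte_mul_pinfty ?lee_fin ?mulr_ge0.
Qed.

Lemma interpolation_restrict E : interpolation_space (L p%:E) (L q%:E) E ->
  interpolation_space L0 (L q%:E) E /\ interpolation_space (L p%:E) (L +oo%E) E.
Proof.
move=> [Esmall Elarge Eop]; split; split.
- move=> f [mf f0] Lf; apply: (Esmall _ _ Lf); have [_ fI] := proj1 (LpP f q0) Lf.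
  apply/(LpP _ p0); split; first exact: mf.
  have mS := measurable_neq0 mf.
  apply: (@le_lt_trans _ _ (\int[mu]_x ((\1_[set x | f x != 0] x)%:E + (`|f x| `^ q)%:E))%E).
    apply: ge0_le_integral => //.
    - exact: measurable_eabs_pow.
    - apply: emeasurable_funD; last exact: measurable_eabs_pow.
      by apply: measurable_efun; exact: measurable_indic.
    move=> x _; rewrite -EFinD lee_fin (indic_bool (fun y => f y != 0)).
    have [->|fx] := eqVneq (f x) 0; first by rewrite normr0 powR0 ?gt_eqF// add0r powR_ge0.
    have [fx1|fx1] := leP `|f x| 1.
      apply: (@le_trans _ _ (1 `^ p)); last by rewrite powR1 lerDl powR_ge0.
      by apply: ge0_ler_powR; rewrite ?nnegrE ?(ltW p0).
    apply: (@le_trans _ _ (`|f x| `^ q)); last by rewrite lerDr.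
    by apply: ler_powR; exact: ltW.
  rewrite ge0_integralD//; last 2 first.
  - by apply: measurable_efun; exact: measurable_indic.
  - exact: measurable_eabs_pow.
  by rewrite integral_indic// setIT lte_add_pinfty.
- by move=> f /Elarge; exact: sum_LpLq_tail.
- by move=> T /tail_couple_restrict; exact: Eop.
- move=> f Lf /LooP[mf [M fM]]; apply: (Esmall _ Lf).
  apply: (bounded_Lq p0 pq (normr_ge0 M) _ Lf).
  by apply: ae_imp fM => x /le_trans; apply; exact: ler_norm.
- by move=> f /Elarge; exact: sum_LpLq_head.
- by move=> T /head_couple_restrict; exact: Eop.
Qed.

(** T f is split by [split_majorized]; each piece is placed in E by the criterion of its couple,
    available from the necessity halves of (a) and (b). *)
Lemma interpolation_intermediate E : quasi_Banach_function_space E ->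
  interpolation_space L0 (L q%:E) E -> interpolation_space (L p%:E) (L +oo%E) E ->
  interpolation_space (L p%:E) (L q%:E) E.
Proof.
move=> hE E0 Eoo; have [small0 large0 _] := E0; have [smalloo largeoo _] := Eoo.
have qBD f g : E f -> E g -> E (f \+ g).
  move=> Ef Eg; have := qB_linear hE 1 Ef Eg; congr (carrier E _).
  by apply/funext => x; rewrite mul1r.
have large f : E f -> sum_space (L p%:E) (L q%:E) f.
  by move=> Ef; apply: sum_LpLq_both => //; [exact: largeoo|exact: large0].
split => //.
  move=> f Lp Lq; have [mf _] := proj1 (LpP f p0) Lp.
  rewrite -(big_small 1 f); apply: qBD.
    apply: small0; first exact: (big_part_L0 p0).
    apply: Lp_le Lq => //; first exact: measurable_big_part.
    by move=> x; rewrite /big_part; case: ifP => // _; rewrite normr0.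
  apply: smalloo; last exact: small_part_Loo.
  apply: Lp_le Lp => //; first exact: measurable_small_part.
  by move=> x; rewrite /small_part; case: ifP => // _; rewrite normr0.
move=> T TB; have [C C0 TC] := head_or_tail p0 pq TB.
have [ch ch0 Ech] := interpolation_head hE p0 Eoo.
have [ct ct0 Ect] := interpolation_tail hE q0 E0.
(* 6 is the dilation in the tail estimate of [split_majorized]. *)
have [kt kt0 EktP] := tail_criterion_scale hE q0 ct0 Ect (isT : (0 < 6)%N).
have K0 := rank_cst_gt0 R.
pose Ch := 10 * K * K `^ p * C; have Ch0 : 0 < Ch by rewrite !mulr_gt0 ?powR_gt0.
pose Ct := 18 * K * K `^ q * C; have Ct0 : 0 < Ct by rewrite !mulr_gt0 ?powR_gt0.
have [B triB] := qB_quasi_triangle hE.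
exists (`|B| * (ch * Ch `^ p^-1 + kt * Ct `^ q^-1)) => f Ef; have sf := large f Ef.
have [[TV _ _] _ _] := TB.
have [g1 [g2 [mg1 mg2 -> H1 H2]]] := split_majorized p0 pq C0 sf (TV _ sf) (fun t => TC f t sf).
have [E1 n1] := head_criterion_scale hE p0 Ech Ch0 Ef (largeoo f Ef) mg1 H1.
have [E2 n2] := EktP Ct f g2 Ct0 Ef (large0 f Ef) mg2 H2.
split; first exact: qBD.
apply: le_trans (triB _ _ E1 E2) _.
apply: (@le_trans _ _ (`|B| * (qnorm E g1 + qnorm E g2))).
  by rewrite ler_wpM2r ?addr_ge0 ?(qB_ge0 hE)// ler_norm.
have bound (x1 x2 a1 a2 b1 b2 n : R) : x1 <= a1 * (b1 * n) -> x2 <= a2 * (b2 * n) ->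
    `|B| * (x1 + x2) <= `|B| * (a1 * b1 + a2 * b2) * n.
  by move=> h1 h2; rewrite -mulrA ler_wpM2l// mulrDl -!mulrA lerD.
exact: bound n1 n2.
Qed.

End two_exponents.
End couples.

Unset Implicit Arguments.

Theorem theorem1p1 (R : realType) (E : fspace R)
    (hE : quasi_Banach_function_space E) (p q : R) (hp : 0 < p) (hpq : p < q) :
  [/\ nontrivial E ->
      (interpolation_space (L p%:E) (L +oo%E) E <->
       exists2 c : R, 0 < c & forall f g : R -> R,
         E f -> sum_space (L p%:E) (L +oo%E) g ->
         head_majorized (abs_pow p g) (abs_pow p f) ->
         E g /\ qnorm E g <= c * qnorm E f),
      nontrivial E ->
      (interpolation_space L0 (L q%:E) E <->
       exists2 c : R, 0 < c & forall f g : R -> R,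
         E f -> sum_space L0 (L q%:E) g ->
         tail_majorized (abs_pow q g) (abs_pow q f) ->
         E g /\ qnorm E g <= c * qnorm E f) &
      (interpolation_space L0 (L q%:E) E /\
       interpolation_space (L p%:E) (L +oo%E) E <->
       interpolation_space (L p%:E) (L q%:E) E)].
Proof.
split=> [nE|nE|].
- split; first exact: interpolation_head.
  by move=> [c c0 Ec]; exact: (head_interpolation hE hp c0 Ec nE).
- have hq := lt_trans hp hpq; split; first exact: interpolation_tail.
  by move=> [c c0 Ec]; exact: (tail_interpolation hE hq c0 Ec nE).
split; last exact: (interpolation_restrict hp hpq).
by move=> [E0 Eoo]; exact: interpolation_intermediate.
Qed.
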